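(* Let $\alpha_1,\alpha_2,\beta_1,\beta_2$ be real numbers, and for each $N$ let $i_1=\lfloor\beta_1N\rfloor$, $i_2=\lfloor\beta_2N\rfloor$, $j_1=\lfloor\alpha_1N\rfloor$, $j_2=\lfloor\alpha_2N\rfloor$. Let $\Delta_1=\beta_1-\alpha_1$ and $\Delta_2=\beta_2-\alpha_2$. For a random $\sigma$ with distribution $P_N$, let $Z(i,j)$ be the indicator of the event $\{\sigma_i=j\}$, and let $\mathrm{Cov}_N$ denote covariance with respect to $P_N$. (a) Assume $0<\alpha_2<\alpha_1<\beta_1<\beta_2<1$. Then $$P_N(\sigma_{i_1}=j_1,\ \sigma_{i_2}=j_2)\sim\frac{1}{4\pi}\,\frac{N^{-3}}{[(\Delta_2-\Delta_1)\Delta_1(1-\Delta_2)]^{3/2}}$$ and $$\lim_{N\to\infty}N^3\,\mathrm{Cov}_N(Z(i_1,j_1),Z(i_2,j_2))=\frac{\left[\frac{\Delta_2(1-\Delta_1)}{\Delta_2-\Delta_1}\right]^{3/2}-1}{4\pi[\Delta_1\Delta_2(1-\Delta_1)(1-\Delta_2)]^{3/2}}>0.$$ (b) Assume $0<\alpha_1<\beta_1<\alpha_2<\beta_2<1$. Then $$P_N(\sigma_{i_1}=j_1,\ \sigma_{i_2}=j_2)\sim\frac{1}{4\pi}\,\frac{N^{-3}}{[(1-\Delta_1-\Delta_2)\Delta_1\Delta_2]^{3/2}}$$ and $$\lim_{N\to\infty}N^3\,\mathrm{Cov}_N(Z(i_1,j_1),Z(i_2,j_2))=\frac{\left[\frac{(1-\Delta_1)(1-\Delta_2)}{1-\Delta_1-\Delta_2}\right]^{3/2}-1}{4\pi[\Delta_1\Delta_2(1-\Delta_1)(1-\Delta_2)]^{3/2}}>0.$$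 (c) Assume $0<\alpha_1<\alpha_2<\beta_1<\beta_2<1$. Then $P_N(\sigma_{i_1}=j_1,\ \sigma_{i_2}=j_2)=0$ for all sufficiently large $N$, and $$\lim_{N\to\infty}N^3\,\mathrm{Cov}_N(Z(i_1,j_1),Z(i_2,j_2))=\frac{-1}{4\pi[\Delta_1\Delta_2(1-\Delta_1)(1-\Delta_2)]^{3/2}}<0.$$
   Context: $S_N(312)$ is the set of permutations $\sigma=\sigma_1\ldots\sigma_N$ of $1,\dots,N$ for which there are no indices $i_1<i_2<i_3$ with $\sigma_{i_1}>\sigma_{i_3}>\sigma_{i_2}$. $P_N$ is the uniform probability distribution on $S_N(312)$. $f(N)\sim g(N)$ means $\lim_{N\to\infty}f(N)/g(N)=1$. *)

(* Defs.v *)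
From HB Require Import structures.
From mathcomp Require Import all_boot all_order all_algebra all_fingroup.
From mathcomp Require Import all_classical all_reals all_analysis.

Set Implicit Arguments.
Unset Strict Implicit.
Unset Printing Implicit Defensive.

Import Order.TTheory GRing.Theory Num.Theory.
Import numFieldNormedType.Exports.

Local Open Scope classical_set_scope.
Local Open Scope ring_scope.

Definition avoids312 (N : nat) (s : 'S_N) : bool :=
  ~~ [exists i1 : 'I_N, exists i2 : 'I_N, exists i3 : 'I_N,
      [&& (i1 < i2)%N, (i2 < i3)%N, (s i3 < s i1)%N & (s i2 < s i3)%N]].

(* Positions and values of a permutation are numbered from 1, whereas 'I_N is
   numbered from 0; the event is empty when i is not in {1, ..., N}. *)
Definition sends (N : nat) (i j : int) (s : 'S_N) : bool :=
  [exists k : 'I_N, (i == k.+1%:Z) && (j == (s k).+1%:Z)].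

Section UniformLaw.
Variables (R : realType) (N : nat).

Definition prob312 (A : pred 'S_N) : R :=
  #|[pred s : 'S_N | avoids312 s && A s]|%:R / #|@avoids312 N|%:R.

Definition expect312 (X : 'S_N -> R) : R :=
  \sum_(s : 'S_N | avoids312 s) X s * prob312 (pred1 s).

Definition cov312 (X Y : 'S_N -> R) : R :=
  expect312 (fun s => (X s - expect312 X) * (Y s - expect312 Y)).

Definition Z312 (i j : int) (s : 'S_N) : R := (sends i j s)%:R.

End UniformLaw.

Definition asymp_equiv (R : realType) (f g : nat -> R) : Prop :=
  (fun N => f N / g N) @ \oo --> (1 : R).

(* Main.v *)
Require Import Defs.
From HB Require Import structures.
From mathcomp Require Import all_boot all_order all_algebra all_fingroup.
From mathcomp Require Import all_classical all_reals all_analysis.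
From mathcomp Require Import zify ring lra.

Set Implicit Arguments.
Unset Strict Implicit.
Unset Printing Implicit Defensive.

Import Order.TTheory GRing.Theory Num.Theory.
Import numFieldNormedType.Exports.

(** A 312-avoiding permutation is what a stack fed with 1, ..., N can output, so it is
    coded by a Dyck word of length 2N: the up step of rank j pushes j and the down step of
    rank i produces the i-th entry. The event sigma_i = j says that these two steps are
    matched, that is, joined by an arc (arcP, count_avoiders).

    Cutting a word at an arc gives A U B D C. If the arc lies at height a, then B is a Dyck
    word with about i - j + a pairs of steps, and A and C are nonnegative paths from 0 to a
    and from a to 0, with prescribed numbers of up and of down steps. Summing over a counts
    the words (card_sends). Two arcs do not cross (arc_dichotomy). When the order of the
    ranks makes them nested or disjoint, cutting twice gives double sums over heights
    (card_sends_nested, card_sends_disjoint); in the remaining case the event is empty, by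
    a pigeonhole argument (card_sends_crossing).

    Let nu L x y be the probability that a simple random walk leads from x to y in L steps
    without going below zero, and c(k) = nu (2k) 0 0 the Catalan number divided by 4^k. Up
    to a power of 4 the number of words with one arc is the sum over a of
      nu (2n - a) 0 a * c(d + a) * nu (2m - a) a 0
    with n = j - 1, d = i - j and m = N - i. If the times 2n - a and 2m - a did not depend
    on a, the sum over the heights of one parity would be, by Chapman-Kolmogorov, c(n + m)
    times c(d). They depend on a, but only heights o(N) matter (nu_tail), and over such a
    shift of time nu hardly decreases: nu (L + 2k) x y is at least (1 - 3k/L) nu L x y, by
    the reflection principle (npaths_growth, nu_growth). This inequality goes in one
    direction only, yet that is enough: moving all times up to a common value gives an
    upper bound, moving them down a lower bound (merge_upper, merge_lower). The two
    parities contribute the same, so the sum is equivalent to 2 c(d) c(n + m). In the same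
    way the double sums are equivalent to 4 times a product of three values of c, one for
    each of the regions into which the two arcs cut the word (nested_asymp,
    disjoint_asymp).

    Wallis' integrals give c(k) ~ 1 / sqrt (pi k^3) (catalan_cvg). Dividing by the number
    4^N c(N) of all 312-avoiding permutations yields the limits of N^(3/2) P(sigma_i = j)
    and of N^3 times the joint probability, and the covariance is the difference between
    the joint probability and the product of the two others. *)

(** * Dyck words and binary trees *)

Inductive tree := Leaf | Node of tree & tree.

Fixpoint nodes t := if t is Node l r then (nodes l + nodes r).+1 else 0.

(** A binary tree codes an ordered forest: [l] is the forest below the first root and
    [r] the remaining forest, so [word] is the usual Dyck word of the forest, with
    [true] for an up step. *)
Fixpoint word t : seq bool :=
  if t is Node l r then true :: word l ++ false :: word r else [::].

(** The root is labelled first and listed after its left subtree: labels are given in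
    the order of the up steps of [word t], and listed in the order of the down steps.
    This is the output of a stack fed with [o], [o + 1] and so on. *)
Fixpoint flat t o : seq nat :=
  if t is Node l r then flat l o.+1 ++ o :: flat r (o + nodes l).+1 else [::].

(** Reading a word from right to left keeps a stack of trees separated by the down
    steps that are still unmatched. The value is meaningful on suffixes of
    Dyck words. *)
Fixpoint parse (w : seq bool) : seq tree :=
  match w with
  | [::] => [:: Leaf]
  | true :: w' => if parse w' is l :: r :: ts then Node l r :: ts else [::]
  | false :: w' => Leaf :: parse w'
  end.

Fixpoint walk (x : nat) (w : seq bool) : option nat :=
  match w with
  | [::] => Some x
  | true :: w' => walk x.+1 w'
  | false :: w' => if x is x'.+1 then walk x' w' else None
  end.

Definition ups (w : seq bool) := count id w.
Definition downs (w : seq bool) := count negb w.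
Arguments ups : simpl never.
Arguments downs : simpl never.

Lemma ups_cat u v : ups (u ++ v) = ups u + ups v. Proof. exact: count_cat. Qed.
Lemma downs_cat u v : downs (u ++ v) = downs u + downs v.
Proof. exact: count_cat. Qed.
Lemma ups_true w : ups (true :: w) = (ups w).+1. Proof. by []. Qed.
Lemma ups_false w : ups (false :: w) = ups w. Proof. by []. Qed.
Lemma downs_true w : downs (true :: w) = downs w. Proof. by []. Qed.
Lemma downs_false w : downs (false :: w) = (downs w).+1. Proof. by []. Qed.
Definition ups_downsE :=
  (ups_cat, downs_cat, ups_true, ups_false, downs_true, downs_false).

Lemma walk_cat x u v : walk x (u ++ v) = obind (walk ^~ v) (walk x u).
Proof. by elim: u x => [|[] u IH] [|x] //=; rewrite IH. Qed.

Lemma walk_count x w y : walk x w = Some y ->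
  x + ups w = y + downs w.
Proof.
elim: w x => [|[] w IH] x; first by case=> ->.
  by move=> /IH; rewrite !ups_downsE; lia.
by case: x => // x /IH; rewrite !ups_downsE; lia.
Qed.

Lemma size_count (w : seq bool) : size w = ups w + downs w.
Proof. by elim: w => // -[] w IH; rewrite ups_downsE; rewrite /= IH; rewrite ups_downsE; lia. Qed.

Lemma walk_word x t : walk x (word t) = Some x.
Proof.
elim: t x => //= l IHl r IHr x.
by rewrite walk_cat IHl /= IHr.
Qed.

Lemma size_word t : size (word t) = (nodes t).*2.
Proof. by elim: t => //= l IHl r IHr; rewrite size_cat /= IHl IHr; lia. Qed.

Lemma ups_word t : ups (word t) = nodes t.
Proof.
have h := walk_count (walk_word 0 t); have := size_word t.
by rewrite size_count; lia.
Qed.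

Lemma downs_word t : downs (word t) = nodes t.
Proof. by have := walk_count (walk_word 0 t); rewrite ups_word. Qed.

(** A left inverse of [word], also when more of the path follows; it gives the unique
    decomposition of a path at the first passage below its starting height. *)
Lemma parse_word t w ts : parse w = Leaf :: ts -> parse (word t ++ w) = t :: ts.
Proof.
elim: t w ts => [|l IHl r IHr] w ts //= h.
by rewrite -catA /= (IHl _ (r :: ts)) //= (IHr _ _ h).
Qed.

Lemma word_cat_inj t1 t2 w1 w2 :
  word t1 ++ false :: w1 = word t2 ++ false :: w2 -> t1 = t2 /\ w1 = w2.
Proof.
move=> h; have := congr1 parse h.
rewrite !(parse_word _ (erefl : parse (false :: _) = Leaf :: _)) => -[e _].
by move: h; rewrite e => /eqP; rewrite eqseq_cat // => /andP[_ /eqP[]].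
Qed.

(** Every path that comes down to 0 has this form: trees separated by the down steps that
    are first passages. *)
Definition stack_word (t : tree) (ts : seq tree) :=
  word t ++ flatten [seq false :: word u | u <- ts].

(** Cutting a path from [x] to 0 at its first passages to [x - 1], ..., 0. *)
Lemma walk_stack x (w : seq bool) : walk x w = Some 0 ->
  exists t ts, size ts = x /\ w = stack_word t ts.
Proof.
elim: w x => [|[] w IH] x /=; first by case=> ->; exists Leaf, [::].
  move=> /IH[t [[|u ts] [//= [<-] ->]]].
  by exists (Node t u), ts; rewrite /stack_word /= -catA.
case: x => // x /IH[t [ts [<- ->]]].
by exists Leaf, (t :: ts).
Qed.

Lemma walk0P w : reflect (exists t, w = word t) (walk 0 w == Some 0).
Proof.
apply: (iffP eqP) => [/walk_stack[t [ts [/size0nil -> ->]]]|[t ->]].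
  by exists t; rewrite /stack_word cats0.
exact: walk_word.
Qed.

Lemma size_flat t o : size (flat t o) = nodes t.
Proof. by elim: t o => //= l IHl r IHr o; rewrite size_cat /= IHl IHr addnS. Qed.

Lemma perm_flat t o : perm_eq (flat t o) (iota o (nodes t)).
Proof.
elim: t o => //= l IHl r IHr o.
by rewrite -cat1s perm_catCA /= perm_cons iotaD perm_cat.
Qed.

Lemma mem_flat t o v : (v \in flat t o) = (o <= v < o + nodes t).
Proof. by rewrite (perm_mem (perm_flat t o)) mem_iota. Qed.

Lemma nth_flat_bounds t o i : i < nodes t ->
  o <= nth 0 (flat t o) i < o + nodes t.
Proof. by move=> hi; rewrite -mem_flat mem_nth // size_flat. Qed.

(** The label [o] of the root is the least one, and its place separates the two subtrees. *)
Lemma flat_inj o : injective (flat^~ o).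
Proof.
move=> t; elim: t o => [|l IHl r IHr] o [|l' r'] //=.
- by move=> /(congr1 size); rewrite size_cat addnS.
- by move=> /(congr1 size); rewrite size_cat addnS.
move=> h.
have hs : size (flat l o.+1) = size (flat l' o.+1).
  have := congr1 (index o) h; rewrite !index_cat !mem_flat !ltnn /= !eqxx !addn0.
  by [].
move/eqP: h; rewrite eqseq_cat // => /andP[/eqP/IHl <-] /eqP[].
by move/IHr=> <-.
Qed.

(** * 312-avoidance and the traversal of a tree *)

(** The entries after [a] that are smaller than [a] must decrease. *)
Definition no_rise_below (a : nat) : rel nat := [rel b c | ~~ (b < c < a)].

Fixpoint avoids (s : seq nat) : bool :=
  if s is a :: s' then pairwise (no_rise_below a) s' && avoids s' else true.

Lemma avoidsP s : reflect
  (forall x y z, x < y -> y < z -> z < size s ->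
     ~~ (nth 0 s y < nth 0 s z < nth 0 s x)) (avoids s).
Proof.
elim: s => [|a s IH] /=; first by constructor.
apply: (iffP andP) => [[/(pairwiseP 0) h /IH hs] [|x] [|y] [|z] // hxy hyz hz|h].
- by apply: h; rewrite // inE; lia.
- exact: hs.
split; first by apply/(pairwiseP 0) => y z hy hz hyz; exact: (h 0 y.+1 z.+1).
by apply/IH => x y z hxy hyz hz; exact: (h x.+1 y.+1 z.+1).
Qed.

Lemma avoids_cat l s : avoids (l ++ s) -> avoids s.
Proof. by elim: l => //= a l IH /andP[_]. Qed.

Lemma flat_avoids t o : avoids (flat t o).
Proof.
elim: t o => //= l IHl r IHr o.
have ho : avoids (o :: flat r (o + nodes l).+1).
  rewrite /= IHr andbT; apply/(pairwiseP 0) => y z hy hz hyz; rewrite /no_rise_below /=.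
  have := mem_nth 0 hz; rewrite mem_flat; move: (nth _ _ _) (nth _ _ y) => c b; lia.
have hl a : a \in flat l o.+1 -> o < a < (o + nodes l).+1.
  by rewrite mem_flat; lia.
elim: (flat l o.+1) (IHl o.+1) hl => //= a s IH /andP[hp hs] hl.
rewrite IH ?andbT //; last by move=> b hb; apply: hl; rewrite inE hb orbT.
have ha : o < a < (o + nodes l).+1 by apply: hl; rewrite inE eqxx.
rewrite pairwise_cat hp /=; apply/and3P; split.
- apply/allrelP => b c hb; have := hl b; rewrite !inE hb orbT => /(_ isT) hbo.
  by rewrite /no_rise_below; case/orP => [/eqP->|]; rewrite ?mem_flat /=; lia.
- by apply/allP => c; rewrite mem_flat /no_rise_below /=; lia.
- apply/(pairwiseP 0) => y z hy hz hyz; rewrite /no_rise_below /=.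
  have := mem_nth 0 hz; rewrite mem_flat; move: (nth _ _ _) (nth _ _ y) => c b; lia.
Qed.

(** Comparing sorted lists: if every entry of [l] is below every entry of [r], both
    are made of consecutive integers. *)
Lemma perm_iota_cat l r o n : perm_eq (l ++ r) (iota o n) ->
  {in l & r, forall a c, a < c} ->
  perm_eq l (iota o (size l)) /\ perm_eq r (iota (o + size l) (size r)).
Proof.
move=> hp hlr.
have hn : n = size l + size r by rewrite -size_cat (perm_size hp) size_iota.
have hs : sort leq l ++ sort leq r = iota o n.
  apply: (sorted_eq leq_trans anti_leq); rewrite ?iota_sorted //.
    have hsort (q : seq nat) : pairwise leq (sort leq q).
      by rewrite -(sorted_pairwise leq_trans) sort_sorted //; exact: leq_total.
    rewrite (sorted_pairwise leq_trans) pairwise_cat !hsort !andbT.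
    apply/allrelP => a c; rewrite !mem_sort => ha hc.
    by apply/ltnW/hlr.
  by apply: perm_trans hp; rewrite perm_cat // perm_sort.
move: hs; rewrite hn iotaD => /eqP; rewrite eqseq_cat ?size_sort ?size_iota //.
by case/andP => /eqP <- /eqP <-; rewrite ![perm_eq _ (sort _ _)]perm_sym !perm_sort.
Qed.

(** In a 312-avoiding sequence everything before the minimum [o] is smaller than
    everything after it, since a larger earlier entry, [o] and a smaller later entry
    would form 312. So the minimum splits the sequence as a root splits a tree. *)
Lemma flat_surj (s : seq nat) o n : avoids s -> perm_eq s (iota o n) ->
  exists t, s = flat t o /\ nodes t = n.
Proof.
elim/ltn_ind: n s o => -[|n] IH s o hs hp.
  by exists Leaf; split=> //; apply/nilP; rewrite /nilp (perm_size hp).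
have hso : o \in s by rewrite (perm_mem hp) mem_iota; lia.
case/splitPr: hso hs hp => l r hs.
rewrite -cat1s perm_catCA /= perm_cons => hp.
have hm a : a \in l ++ r -> o < a by rewrite (perm_mem hp) mem_iota; lia.
have hu : uniq (l ++ r) by rewrite (perm_uniq hp) iota_uniq.
have [] := perm_iota_cat hp.
  move=> a c ha hc; rewrite ltnNge leq_eqVlt; apply/negP => /orP[/eqP e|hca].
    move: hu; rewrite cat_uniq => /and3P[_ /hasPn /(_ _ hc)].
    by rewrite e /= ha.
  case/splitPr: ha hs => l1 l2; rewrite -catA => /avoids_cat /= /andP[].
  rewrite pairwise_cat /= => /and4P[_ _ /allP /(_ _ hc) + _] _.
  rewrite /no_rise_below /= hca andbT (hm c) //.
  by rewrite mem_cat hc orbT.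
have hn : size l + size r = n by rewrite -size_cat (perm_size hp) size_iota.
have hr : avoids r by move: (avoids_cat hs) => /= /andP[].
have hl : avoids l.
  apply/avoidsP => x y z hxy hyz hz.
  have /avoidsP/(_ _ _ _ hxy hyz) := hs.
  have hy := ltn_trans hyz hz.
  rewrite size_cat !nth_cat (ltn_trans hxy hy) hy hz; apply.
  exact: ltn_addr.
move=> /(IH _ _ _ _ hl)[|tl [etl stl]]; first by lia.
move=> /(IH _ _ _ _ hr)[|tr [etr str]]; first by lia.
exists (Node tl tr); rewrite /= stl str hn; split=> //.
by rewrite -addSn -etr -etl.
Qed.

(** * Arcs of a Dyck word *)

(** The up step of rank [j] is matched with the down step of rank [i], ranks being
    counted from 0. *)
Definition has_arc (w : seq bool) (i j : nat) := exists A t C,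
  [/\ w = A ++ true :: word t ++ false :: C, ups A = j & downs A + nodes t = i].

Lemma arc_catl x w i j : has_arc w i j -> has_arc (x ++ w) (downs x + i) (ups x + j).
Proof.
case=> A [t [C [-> <- <-]]]; exists (x ++ A), t, C.
by rewrite !ups_downsE catA addnA.
Qed.

Lemma arc_catr w y i j : has_arc w i j -> has_arc (w ++ y) i j.
Proof.
by case=> A [t [C [-> <- <-]]]; exists A, t, (C ++ y); rewrite -!(catA, cat_cons).
Qed.

(** An entry [j] at place [i] of the traversal is an arc from the up step of rank [j]
    to the down step of rank [i]: the element is pushed by the one and popped by the other. *)
Lemma arc_flat t o i j : i < nodes t -> nth 0 (flat t o) i = o + j -> has_arc (word t) i j.
Proof.
elim: t o i j => //= l IHl r IHr o i j hi.
rewrite nth_cat size_flat; case: ltnP => hil.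
  have hm := nth_flat_bounds o.+1 hil; move=> e.
  have hj : 0 < j by lia.
  have {}e : nth 0 (flat l o.+1) i = o.+1 + j.-1 by lia.
  have := arc_catr (false :: word r) (IHl _ _ _ hil e).
  move=> /(@arc_catl [:: true]); rewrite /= !ups_downsE !add0n add1n.
  by rewrite (_ : j.-1.+1 = j) //; lia.
case: (ltngtP i (nodes l)) hil => // [hil _|-> _]; last first.
  rewrite subnn /= => e; exists [::], l, (word r); split=> //.
  by rewrite /ups /=; lia.
rewrite (_ : i - nodes l = (i - (nodes l).+1).+1) /=; last by lia.
set i' := i - (nodes l).+1 => e.
have hi' : i' < nodes r by rewrite /i'; lia.
have hm := nth_flat_bounds (o + nodes l).+1 hi'.
have hj : nodes l < j by lia.
have {}e : nth 0 (flat r (o + nodes l).+1) i' = (o + nodes l).+1 + (j - (nodes l).+1) by lia.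
have := arc_catl (true :: word l ++ [:: false]) (IHr _ _ _ hi' e).
rewrite /= -catA !ups_downsE ups_word downs_word /=.
rewrite (_ : _ + i' = i); last by rewrite /downs /= /i'; lia.
by rewrite (_ : _ + _ = j) //; rewrite /ups /=; lia.
Qed.

Lemma split_ups A1 A2 w1 w2 : A1 ++ true :: w1 = A2 ++ true :: w2 ->
  ups A1 = ups A2 -> A1 = A2 /\ w1 = w2.
Proof.
elim: A1 A2 => [|[] A1 IH] [|[] A2] //=; rewrite ?ups_downsE.
- by case=> ->.
- by case=> /IH h [] /h[-> ->].
- by case=> /IH h /h[-> ->].
Qed.

Lemma arc_inj w i1 i2 j : has_arc w i1 j -> has_arc w i2 j -> i1 = i2.
Proof.
case=> A [t [C [-> h1 <-]]] [A' [t' [C' [h2 h3 <-]]]].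
have [|-> e] := split_ups h2; first by rewrite h1 h3.
by have [-> _] := word_cat_inj e.
Qed.

(** The converse follows by uniqueness: the label [j] sits somewhere, which gives an arc
    by [arc_flat], and the up step of rank [j] has only one partner. *)
Lemma flat_arc t o i j : has_arc (word t) i j -> i < nodes t /\ nth 0 (flat t o) i = o + j.
Proof.
move=> h; have hj : j < nodes t.
  case: h => A [u [C [+ <- _]]] => /(congr1 ups).
  by rewrite !ups_downsE ups_word; lia.
have : o + j \in flat t o by rewrite mem_flat; lia.
case/(nthP 0) => i'; rewrite size_flat => hi' e.
by rewrite (arc_inj h (arc_flat hi' e)).
Qed.

Lemma arcP t o i j : has_arc (word t) i j <-> i < nodes t /\ nth 0 (flat t o) i = o + j.
Proof. by split=> [/flat_arc|[]]; [apply|exact: arc_flat]. Qed.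

(** * Enumeration of the words with prescribed arcs *)

Fixpoint words L x y : seq (seq bool) :=
  if L is L'.+1 then
    [seq true :: w | w <- words L' x.+1 y] ++
    (if x is x'.+1 then [seq false :: w | w <- words L' x' y] else [::])
  else if x == y then [:: [::]] else [::].

Definition npaths L x y := size (words L x y).

Lemma npathsS L x y : npaths L.+1 x y =
  npaths L x.+1 y + (if x is x'.+1 then npaths L x' y else 0).
Proof. by rewrite /npaths /= size_cat size_map; case: x => // x; rewrite size_map. Qed.

Lemma mem_words L x y (w : seq bool) : (w \in words L x y) = (size w == L) && (walk x w == Some y).
Proof.
elim: L x w => [|L IH] x w /=.
  case: w => [|c w]; first by rewrite (inj_eq Some_inj) eqxx; case: eqP.
  by case: eqP.
rewrite mem_cat; case: w => [|c w] /=.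
  apply/negbTE; rewrite negb_or; apply/andP; split; first by apply/mapP => -[].
  by case: x => // x; apply/mapP => -[].
have inj d : injective (cons d : seq bool -> _) by move=> ? ? [].
case: c.
  rewrite (mem_map (inj true)) IH eqSS; case: x => [|x]; rewrite ?orbF //.
  by case: (_ \in map _ _) / mapP => [[] //|]; rewrite orbF.
case: (_ \in map (cons true) _) / mapP => [[] //|] _ /=.
by case: x => [|x]; rewrite ?andbF // (mem_map (inj false)) IH eqSS.
Qed.

Lemma words_uniq L x y : uniq (words L x y).
Proof.
elim: L x => [|L IH] x /=; first by case: eqP.
have inj d : injective (cons d : seq bool -> _) by move=> ? ? [].
rewrite cat_uniq map_inj_uniq ?IH //=; case: x => // x.
rewrite map_inj_uniq ?IH // andbT; apply/hasPn => w /mapP[u _ ->].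
by apply/mapP => -[].
Qed.

Definition cross (B C : seq (seq bool)) := [seq b ++ false :: c | b <- B, c <- C].

(** [A], [B] and [C] are the parts before, inside and after an arc, and the index [a] stands for
    the height at which the arc lies. *)
Definition glue (I : seq nat) (As Bs Cs : nat -> seq (seq bool)) :=
  [seq z | a <- I, z <- [seq A ++ true :: y | A <- As a, y <- cross (Bs a) (Cs a)]].

Lemma glueP I As Bs Cs (w : seq bool) : w \in glue I As Bs Cs <-> exists (a : nat) (A B C : seq bool),
  [/\ a \in I, A \in As a, B \in Bs a, C \in Cs a &
      w = A ++ true :: B ++ false :: C].
Proof.
split.
  case/allpairsPdep => a [z [ha /allpairsP[[A y] /= [hA /allpairsP[[B C] /= [hB hC ->]] ->]] ->]].
  by exists a, A, B, C.
case=> a [A [B [C [ha hA hB hC ->]]]].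
apply/allpairsPdep; exists a, (A ++ true :: B ++ false :: C); split=> //.
apply/allpairsP; exists (A, B ++ false :: C); split=> //=.
by apply/allpairsP; exists (B, C).
Qed.

Lemma size_glue I As Bs Cs : size (glue I As Bs Cs) =
  \sum_(a <- I) size (As a) * (size (Bs a) * size (Cs a)).
Proof.
rewrite /glue size_allpairs_dep sumnE big_map; apply: eq_bigr => a _.
by rewrite !size_allpairs.
Qed.

(** No word is produced twice: the number of up steps of [A] fixes where [A] ends, hence
    the height [a], and [B] ends at the first return to that height. *)
Lemma glue_uniq I As Bs Cs x j : uniq I ->
  (forall a, a \in I -> [/\ uniq (As a), uniq (Bs a) & uniq (Cs a)]) ->
  (forall a A, a \in I -> A \in As a -> ups A = j /\ walk x A = Some a) ->
  (forall a B, a \in I -> B \in Bs a -> exists t, B = word t) ->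
  uniq (glue I As Bs Cs).
Proof.
move=> uI uABC hA hB; apply: allpairs_uniq_dep => //.
  move=> a ha; have [uA uB uC] := uABC a ha.
  apply: allpairs_uniq => //.
    apply: allpairs_uniq => // -[B C] [B' C'] /allpairsP[[? ?] /= [b c [-> ->]]].
    move=> /allpairsP[[? ?] /= [b' c' [-> ->]]].
    have [t ->] := hB _ _ ha b; have [t' ->] := hB _ _ ha b'.
    by case/word_cat_inj => -> ->.
  move=> [A y] [A' y'] /allpairsP[[? ?] /= [h _ [-> ->]]].
  move=> /allpairsP[[? ?] /= [h' _ [-> ->]]].
  by case/split_ups => [|-> -> //]; rewrite (hA _ _ ha h).1 (hA _ _ ha h').1.
move=> p q /allpairsPdep[a [z [ha hz ->]]] /allpairsPdep[a' [z' [ha' hz' ->]]] /= e.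
case/allpairsP: hz => -[A y] /= [h _ ez].
case/allpairsP: hz' => -[A' y'] /= [h' _ ez'].
move: e (e); rewrite {1}ez {1}ez' => /split_ups[|eA _ <-].
  by rewrite (hA _ _ ha h).1 (hA _ _ ha' h').1.
suff -> : a = a' by [].
by have := (hA _ _ ha h).2; rewrite eA (hA _ _ ha' h').2 => -[].
Qed.

(** Arcs do not cross: an arc that opens later is either closed inside the first one
    or opened after it is closed. *)
Lemma arc_dichotomy A t C A' t' C' :
  A ++ true :: word t ++ false :: C = A' ++ true :: word t' ++ false :: C' ->
  ups A < ups A' ->
  (exists X Y, [/\ A' = A ++ true :: X, word t = X ++ true :: word t' ++ false :: Y
     & C' = Y ++ false :: C]) \/
  (exists X, A' = A ++ true :: word t ++ false :: X /\
     C = X ++ true :: word t' ++ false :: C').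
Proof.
elim: A A' => [|c A IH] [|c' A'] /=.
- by [].
- case=> <- h _.
  have [hs|hs] := leqP (size (word t)) (size A').
    right; move: h; rewrite -[A'](cat_take_drop (size (word t))) -catA => /eqP.
    rewrite eqseq_cat ?size_takel // => /andP[/eqP <-].
    by case: (drop _ _) => [|? X] // /eqP[<- ->]; exists X.
  left; have := congr1 (take (size A')) h; rewrite take_cat hs take_size_cat // => hA.
  have := congr1 (drop (size A')) h; rewrite drop_cat hs drop_size_cat //.
  set Z := drop _ _ => hZ.
  have hw : word t = A' ++ Z by rewrite -hA cat_take_drop.
  case: Z hZ hw => [|c Z] /= [] // -> {h hA} hZ hw.
  have hj : ups A' < nodes t by rewrite -ups_word hw !ups_downsE; lia.
  have : ups A' \in flat t 0 by rewrite mem_flat; lia.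
  case/(nthP 0) => i'; rewrite size_flat => hi' e.
  have [B [u [D [eB hB _]]]] := arc_flat (o := 0) hi' e.
  have [|? ?] := split_ups (etrans (esym eB) hw); first by rewrite hB.
  subst B Z; move: hZ; rewrite -catA /= => /word_cat_inj[? ?]; subst.
  by exists A', D.
- by case=> _ _; rewrite /ups.
case=> <- /IH h hu.
case: h => [|[X [Y [-> ? ?]]]|[X [-> ->]]]; first by case: c hu; rewrite !ups_downsE.
  by left; exists X, Y.
by right; exists X.
Qed.

(** The paths of length [L] from [x] to 0 in which the up step of rank [j] is matched
    with the down step of rank [i]; [a] is the height just before the arc. With [j] up
    steps before the arc there are [x + j - a] down steps before it, so the arc encloses
    [i + a - (x + j)] down steps. *)
Definition marked_words x L i j := glue (iota 0 (x + j).+1)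
  (fun a => words (j.*2 + x - a) x a) (fun a => words (i + a - (x + j)).*2 0 0)
  (fun a => words (L + x - (i.+1.*2 + a)) a 0).

Lemma words_dyckP n (w : seq bool) : w \in words n.*2 0 0 <-> exists t, w = word t /\ nodes t = n.
Proof.
rewrite mem_words; split.
  by case/andP => /eqP hs /walk0P[t e]; exists t; split=> //; apply: double_inj; rewrite -size_word -e.
by case=> t [-> <-]; rewrite size_word walk_word !eqxx.
Qed.

Lemma walk_arc x A t C :
  walk x (A ++ true :: word t ++ false :: C) = obind (walk^~ C) (walk x A).
Proof. by rewrite walk_cat; case: (walk x A) => //= a; rewrite walk_cat walk_word. Qed.

Lemma size_arc A t C :
  size (A ++ true :: word t ++ false :: C) = size A + (nodes t).+1.*2 + size C.
Proof. by rewrite size_cat /= size_cat /= size_word; lia. Qed.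

Lemma words_ups_walk L j x a (A : seq bool) : A \in words L x a -> L + a = j.*2 + x -> ups A = j.
Proof.
rewrite mem_words => /andP[/eqP hs /eqP /walk_count].
by move: hs; rewrite (size_count A) => <-; lia.
Qed.

(** The height [a] before an arc determines the lengths of the three pieces. *)
Lemma arc_parts x L i j (A : seq bool) t (C : seq bool) :
    A ++ true :: word t ++ false :: C \in words L x 0 ->
    ups A = j -> downs A + nodes t = i ->
  exists a, [/\ a + downs A = x + j, i.+1.*2 + a <= L + x,
    A \in words (j.*2 + x - a) x a, nodes t = i + a - (x + j) &
    C \in words (L + x - (i.+1.*2 + a)) a 0].
Proof.
rewrite mem_words walk_arc size_arc => /andP[/eqP + /eqP] + hj hi.
case wA: (walk x A) => [a|] //= sL wC.
have := walk_count wA; have := size_count A; rewrite hj => sA hc.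
have := walk_count wC; have := size_count C; move=> sC hcC.
exists a; rewrite !mem_words wA wC !eqxx !andbT.
by split=> //; lia.
Qed.

(** When the truncated length of the last piece is 0, that piece is empty and thus
    [a = 0]; so truncation does no harm. *)
Lemma parts_arc x L i j a (A : seq bool) t (C : seq bool) :
    a <= x + j -> x + j <= i -> i.+1.*2 <= L + x ->
    A \in words (j.*2 + x - a) x a -> nodes t = i + a - (x + j) ->
    C \in words (L + x - (i.+1.*2 + a)) a 0 ->
  [/\ A ++ true :: word t ++ false :: C \in words L x 0,
    ups A = j & downs A + nodes t = i].
Proof.
move=> ha hij hiL hA ht.
have hu : ups A = j by apply: (words_ups_walk hA); lia.
move: hA; rewrite !mem_words walk_arc size_arc => /andP[/eqP sA /eqP wA].
rewrite wA /= => /andP[/eqP sC /eqP wC]; rewrite wC.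
have := walk_count wA; rewrite sA sC ht hu => hc.
have haL : i.+1.*2 + a <= L + x \/ a = 0.
  case: (leqP (i.+1.*2 + a) (L + x)) => [|h]; [by left|right].
  have /size0nil eC : size C = 0 by lia.
  by move: wC; rewrite eC => -[].
split=> //; last by lia.
by rewrite andbT; apply/eqP; case: haL; lia.
Qed.

Lemma mem_marked_words x L i j (w : seq bool) : x + j <= i -> i.+1.*2 <= L + x ->
  w \in marked_words x L i j <-> w \in words L x 0 /\ has_arc w i j.
Proof.
move=> hij hiL; rewrite glueP; split.
  case=> a [A [B [C [+ hA /words_dyckP[t [-> ht]] hC ->]]]].
  rewrite mem_iota => ha.
  have [|? ? ?] := parts_arc _ hij hiL hA ht hC; first by lia.
  by split=> //; exists A, t, C.
case=> hw [A [t [C [e hj hi]]]]; move: hw; rewrite e.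
case/(arc_parts)/(_ hj hi) => a [ha _ hA ht hC].
exists a, A, (word t), C; split=> //; first by rewrite mem_iota; lia.
by apply/words_dyckP; exists t.
Qed.

Lemma marked_words_uniq x L i j : uniq (marked_words x L i j).
Proof.
apply: (@glue_uniq _ _ _ _ x j); rewrite ?iota_uniq //.
- by move=> a _; rewrite !words_uniq.
- move=> a A; rewrite mem_iota => ha hA; split.
    by apply: (words_ups_walk hA); lia.
  by move: hA; rewrite mem_words => /andP[_ /eqP].
- by move=> a B _ /words_dyckP[t [-> _]]; exists t.
Qed.

(** The outer arc is cut out first; what it encloses is again a Dyck word, with one arc
    whose ranks are shifted by the steps before it. *)
Definition nested_words N i1 i2 j1 j2 := glue (iota 0 j2.+1)
  (fun a => words (j2.*2 - a) 0 a)
  (fun a => marked_words 0 (i2 + a - j2).*2 (i1 + a - j2) (j1 - j2.+1))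
  (fun a => words (N.*2 - (i2.+1.*2 + a)) a 0).

Lemma mem_nested_words N i1 i2 j1 j2 (w : seq bool) :
    j2 < j1 -> j1 <= i1 -> i1 < i2 -> i2 < N ->
  w \in nested_words N i1 i2 j1 j2 <->
  [/\ w \in words N.*2 0 0, has_arc w i1 j1 & has_arc w i2 j2].
Proof.
move=> h1 h2 h3 h4; rewrite glueP; split.
  case=> a [A [B [C [+ hA + hC ->]]]].
  rewrite mem_iota => ha /mem_marked_words[||/words_dyckP[t [-> ht]] hB]; try by lia.
  have [||||||hw hj hi] := @parts_arc 0 N.*2 i2 j2 a A t C; rewrite ?addn0 //;
    try by lia.
  split=> //; last by exists A, t, C.
  move: hA; rewrite mem_words => /andP[_ /eqP/walk_count hc].
  have := arc_catr (false :: C) hB.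
  move=> /(@arc_catl (A ++ [:: true])); rewrite -!catA /= !ups_downsE.
  rewrite [ups [::]]/= [downs [::]]/=.
  by rewrite (_ : _ + (i1 + _ - _) = i1) 1?(_ : _ + (j1 - _) = j1) //;
    move: hj hi hc; rewrite /ups /downs /=; lia.
case=> hw [A1 [t1 [C1 [e1 u1 d1]]]] [A2 [t2 [C2 [e2 u2 d2]]]].
have [|[X [Y [eA1 et eC1]]]|[X [eA1 eC]]] := arc_dichotomy (etrans (esym e2) e1).
- by rewrite u1 u2.
- move: hw; rewrite e2 => /arc_parts/(_ u2 d2)[a [ha ha' hA ht hC]].
  exists a, A2, (word t2), C2; rewrite -(addn0 j2.*2) -(addn0 N.*2).
  split=> //; first by rewrite mem_iota; lia.
  move: d1 u1; rewrite eA1 !ups_downsE => d1 u1.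
  apply/mem_marked_words; [lia|lia|split].
    by apply/words_dyckP; exists t2.
  by exists X, t1, Y; split=> //; lia.
- by move: d1; rewrite eA1 !ups_downsE downs_word; lia.
Qed.

(** The first arc is cut out; the remaining path starts at height [a] and carries the
    second arc. The bound on [a] keeps [j2 - (i1.+1 + a)] from being truncated. *)
Definition disjoint_words N i1 i2 j1 j2 := glue (iota 0 (minn j1 (j2 - i1.+1)).+1)
  (fun a => words (j1.*2 - a) 0 a)
  (fun a => words (i1 + a - j1).*2 0 0)
  (fun a => marked_words a (N.*2 - (i1.+1.*2 + a)) (i2 - i1.+1) (j2 - (i1.+1 + a))).

Lemma mem_disjoint_words N i1 i2 j1 j2 (w : seq bool) :
    j1 <= i1 -> i1 < j2 -> j2 <= i2 -> i2 < N ->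
  w \in disjoint_words N i1 i2 j1 j2 <->
  [/\ w \in words N.*2 0 0, has_arc w i1 j1 & has_arc w i2 j2].
Proof.
move=> h1 h2 h3 h4; rewrite glueP; split.
  case=> a [A [B [C [+ hA /words_dyckP[t [-> ht]] + ->]]]].
  rewrite mem_iota => ha /mem_marked_words[||hC hB]; try by lia.
  have [||||||hw hj hi] := @parts_arc 0 N.*2 i1 j1 a A t C; rewrite ?addn0 //;
    try by lia.
  split=> //; first by exists A, t, C.
  move: hA; rewrite mem_words => /andP[_ /eqP/walk_count hc].
  have := arc_catl (A ++ true :: word t ++ [:: false]) hB.
  rewrite -!catA /= -catA /= !ups_downsE ups_word downs_word.
  by rewrite (_ : _ + (i2 - _) = i2) 1?(_ : _ + (j2 - _) = j2) //;
    move: hj hi hc; rewrite /ups /downs /=; lia.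
case=> hw [A1 [t1 [C1 [e1 u1 d1]]]] [A2 [t2 [C2 [e2 u2 d2]]]].
have [|[X [Y [eA1 et eC1]]]|[X [eA1 eC]]] := arc_dichotomy (etrans (esym e1) e2).
- by rewrite u1 u2; lia.
- have := congr1 downs et; move: d2.
  by rewrite eA1 !ups_downsE !downs_word; lia.
- move: hw; rewrite e1 => /arc_parts/(_ u1 d1)[a [ha ha' hA ht hC]].
  move: d2 u2; rewrite eA1 !ups_downsE downs_word ups_word => d2 u2.
  exists a, A1, (word t1), C1; rewrite -(addn0 j1.*2) -(addn0 N.*2).
  split=> //; first by rewrite mem_iota; lia.
    by apply/words_dyckP; exists t1.
  apply/mem_marked_words; [lia|lia|split=> //].
  by exists X, t2, C2; split=> //; lia.
Qed.

Lemma nested_words_uniq N i1 i2 j1 j2 : j2 < j1 -> j1 <= i1 -> i1 < i2 ->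
  uniq (nested_words N i1 i2 j1 j2).
Proof.
move=> h1 h2 h3; apply: (@glue_uniq _ _ _ _ 0 j2); rewrite ?iota_uniq //.
- by move=> a _; rewrite !words_uniq marked_words_uniq.
- move=> a A; rewrite mem_iota => ha hA; split.
    by apply: (words_ups_walk hA); lia.
  by move: hA; rewrite mem_words => /andP[_ /eqP].
- move=> a B; rewrite mem_iota => ha.
  by case/mem_marked_words => [||/words_dyckP[t [-> _]] _]; [lia|lia|exists t].
Qed.

Lemma disjoint_words_uniq N i1 i2 j1 j2 : uniq (disjoint_words N i1 i2 j1 j2).
Proof.
apply: (@glue_uniq _ _ _ _ 0 j1); rewrite ?iota_uniq //.
- by move=> a _; rewrite !words_uniq marked_words_uniq.
- move=> a A; rewrite mem_iota => ha hA; split.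
    by apply: (words_ups_walk hA); lia.
  by move: hA; rewrite mem_words => /andP[_ /eqP].
- by move=> a B _ /words_dyckP[t [-> _]]; exists t.
Qed.

(** * Counting 312-avoiding permutations *)

Definition seq_of_perm N (s : 'S_N) : seq nat := [seq val (s k) | k <- enum 'I_N].

Lemma size_seq_of_perm N (s : 'S_N) : size (seq_of_perm s) = N.
Proof. by rewrite size_map size_enum_ord. Qed.

Lemma nth_seq_of_perm N (s : 'S_N) (k : 'I_N) : nth 0 (seq_of_perm s) k = s k.
Proof. by rewrite (nth_map k) ?size_enum_ord // nth_ord_enum. Qed.

Lemma seq_of_perm_inj N : injective (@seq_of_perm N).
Proof.
move=> s s' e; apply/permP => k; apply: val_inj.
by rewrite /= -!nth_seq_of_perm e.
Qed.

Lemma perm_seq_of_perm N (s : 'S_N) : perm_eq (seq_of_perm s) (iota 0 N).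
Proof.
have hu : uniq (seq_of_perm s).
  by rewrite map_inj_uniq ?enum_uniq // => x y /val_inj/perm_inj.
apply: uniq_perm; rewrite ?iota_uniq //.
have := uniq_min_size hu (_ : {subset _ <= iota 0 N}).
case=> //; last by rewrite size_seq_of_perm size_iota.
by move=> _ /mapP[k _ ->]; rewrite mem_iota /= ltn_ord.
Qed.

Lemma seq_of_perm_surj N (q : seq nat) : perm_eq q (iota 0 N) ->
  exists s : 'S_N, seq_of_perm s = q.
Proof.
move=> hq; have hs : size q = N by rewrite (perm_size hq) size_iota.
have hlt (k : 'I_N) : nth 0 q k < N.
  have : nth 0 q k \in q by rewrite mem_nth ?hs.
  by rewrite (perm_mem hq) mem_iota.
pose f k := Ordinal (hlt k).
have fi : injective f.
  move=> x y /(congr1 val) /= /eqP; rewrite nth_uniq ?hs //.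
    by move/eqP/val_inj.
  by rewrite (perm_uniq hq) iota_uniq.
exists (perm fi); apply: (@eq_from_nth _ 0); rewrite size_seq_of_perm ?hs // => i hi.
by rewrite (nth_seq_of_perm _ (Ordinal hi)) permE.
Qed.

Lemma avoids312E N (s : 'S_N) : avoids312 s = avoids (seq_of_perm s).
Proof.
apply/idP/avoidsP => [|h].
  move=> /existsPn h x y z hxy hyz; rewrite size_seq_of_perm => hz.
  have hy := ltn_trans hyz hz; have hx := ltn_trans hxy hy.
  have /existsPn/(_ (Ordinal hy))/existsPn/(_ (Ordinal hz)) := h (Ordinal hx).
  rewrite /= hxy hyz /= -!nth_seq_of_perm /=; apply: contra.
  by case/andP => -> ->.
apply/existsPn => x; apply/existsPn => y; apply/existsPn => z.
apply/negP => /and4P[hxy hyz h1 h2].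
have := h x y z hxy hyz; rewrite size_seq_of_perm ltn_ord !nth_seq_of_perm h1 h2.
by move=> /(_ isT).
Qed.

Lemma sends_nth N (s : 'S_N) (i j : nat) :
  sends i.+1%:Z j.+1%:Z s <-> i < N /\ nth 0 (seq_of_perm s) i = j.
Proof.
split=> [/existsP[k /andP[/eqP ei /eqP ej]]|[hi e]].
  have -> : i = k by case: ei.
  by rewrite ltn_ord nth_seq_of_perm; case: ej => ->.
apply/existsP; exists (Ordinal hi); rewrite eqxx /=.
by rewrite -e (nth_seq_of_perm s (Ordinal hi)).
Qed.

(** The bijection permutation - tree - Dyck word, in the form in which it transports a
    count. *)
Lemma count_avoiders N (A : pred 'S_N) (W : seq (seq bool)) : uniq W ->
    (forall w : seq bool, w \in W -> exists t, w = word t /\ nodes t = N) ->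
    (forall (s : 'S_N) t, nodes t = N -> seq_of_perm s = flat t 0 ->
       A s <-> word t \in W) ->
  #|[pred s : 'S_N | avoids312 s && A s]| = size W.
Proof.
move=> uW hW hA; rewrite cardE -(size_map (@seq_of_perm N)).
rewrite -(size_map (fun w => flat (head Leaf (parse w)) 0) W).
have hp t : head Leaf (parse (word t)) = t.
  by rewrite -[word t]cats0 (@parse_word _ _ [::]).
apply/perm_size/uniq_perm.
- by rewrite map_inj_uniq ?enum_uniq //; exact: seq_of_perm_inj.
- rewrite map_inj_in_uniq // => w w' /hW[t [-> _]] /hW[t' [-> _]].
  by rewrite !hp => /flat_inj ->.
move=> q; apply/mapP/mapP => [[s hs ->]|[w hw ->]].
  move: hs; rewrite mem_enum inE avoids312E => /andP[ha hs].
  have [t [e ht]] := flat_surj ha (perm_seq_of_perm s).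
  by exists (word t); [exact/(hA _ _ ht e)|rewrite hp].
have [t [e ht]] := hW w hw; subst w; rewrite hp.
have [] := @seq_of_perm_surj N (flat t 0); first by rewrite -ht perm_flat.
move=> s es; exists s => //; rewrite mem_enum inE avoids312E es flat_avoids /=.
exact/(hA _ _ ht es).
Qed.

Lemma sends_arc N (s : 'S_N) t i j : nodes t = N -> seq_of_perm s = flat t 0 ->
  sends i.+1%:Z j.+1%:Z s <-> has_arc (word t) i j.
Proof. by move=> ht e; rewrite sends_nth (arcP t 0) e ht. Qed.

Lemma word_in_words t N : nodes t = N -> word t \in words N.*2 0 0.
Proof. by move=> h; apply/words_dyckP; exists t. Qed.

Lemma card_avoids312 N : #|@avoids312 N| = npaths N.*2 0 0.
Proof.
transitivity #|[pred s : 'S_N | avoids312 s && predT s]|.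
  by apply: eq_card => s; rewrite !inE andbT.
apply: count_avoiders; first exact: words_uniq.
  by move=> w /words_dyckP.
by move=> s t ht _; split=> // _; exact: word_in_words.
Qed.

Lemma size_marked_words x L i j : size (marked_words x L i j) =
  \sum_(a < (x + j).+1) npaths (j.*2 + x - a) x a *
    (npaths (i + a - (x + j)).*2 0 0 * npaths (L + x - (i.+1.*2 + a)) a 0).
Proof. by rewrite size_glue -[iota 0 _]/(index_iota 0 (x + j).+1) big_mkord. Qed.

Lemma card_sends N i j : j <= i -> i < N ->
  #|[pred s : 'S_N | avoids312 s && sends i.+1%:Z j.+1%:Z s]| =
  \sum_(a < j.+1) npaths (j.*2 - a) 0 a *
    (npaths (i + a - j).*2 0 0 * npaths (N.*2 - (i.+1.*2 + a)) a 0).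
Proof.
move=> hij hiN; rewrite (@count_avoiders _ _ (marked_words 0 N.*2 i j)).
- by rewrite size_marked_words /= !addn0.
- exact: marked_words_uniq.
- by move=> w /mem_marked_words[||/words_dyckP]; rewrite ?addn0 //; lia.
- move=> s t ht e; rewrite (sends_arc _ _ ht e) mem_marked_words ?addn0 //; last by lia.
  by split=> [|[]//]; split=> //; exact: word_in_words.
Qed.

(** The second arc opens first and closes last, so it encloses the first one. *)
Lemma card_sends_nested N i1 i2 j1 j2 : j2 < j1 -> j1 <= i1 -> i1 < i2 -> i2 < N ->
  #|[pred s : 'S_N | avoids312 s &&
      (sends i1.+1%:Z j1.+1%:Z s && sends i2.+1%:Z j2.+1%:Z s)]| =
  \sum_(a < j2.+1) npaths (j2.*2 - a) 0 a *
    ((\sum_(b < (j1 - j2.+1).+1) npaths ((j1 - j2.+1).*2 - b) 0 b *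
       (npaths (i1 + a - j2 + b - (j1 - j2.+1)).*2 0 0 *
        npaths ((i2 + a - j2).*2 - ((i1 + a - j2).+1.*2 + b)) b 0)) *
     npaths (N.*2 - (i2.+1.*2 + a)) a 0).
Proof.
move=> h1 h2 h3 h4; rewrite (@count_avoiders _ _ (nested_words N i1 i2 j1 j2)).
- rewrite size_glue -[iota 0 _]/(index_iota 0 j2.+1) big_mkord.
  by apply: eq_bigr => a _; rewrite size_marked_words !addn0.
- exact: nested_words_uniq.
- by move=> w /mem_nested_words[||||/words_dyckP].
- move=> s t ht e; rewrite mem_nested_words //.
  have h i j := sends_arc i j ht e.
  split=> [/andP[/h ? /h ?]|[_ /h-> /h->]//].
  by split=> //; exact: word_in_words.
Qed.

(** The first arc opens first and closes first, so the second one comes after it. *)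
Lemma card_sends_disjoint N i1 i2 j1 j2 : j1 <= i1 -> i1 < j2 -> j2 <= i2 -> i2 < N ->
  #|[pred s : 'S_N | avoids312 s &&
      (sends i1.+1%:Z j1.+1%:Z s && sends i2.+1%:Z j2.+1%:Z s)]| =
  \sum_(a < (minn j1 (j2 - i1.+1)).+1) npaths (j1.*2 - a) 0 a *
    (npaths (i1 + a - j1).*2 0 0 *
     (\sum_(b < (j2 - i1.+1).+1) npaths ((j2 - i1.+1).*2 - a - b) a b *
       (npaths (i2 + b - j2).*2 0 0 *
        npaths (N.*2 - (i2.+1.*2 + b)) b 0))).
Proof.
move=> h1 h2 h3 h4; rewrite (@count_avoiders _ _ (disjoint_words N i1 i2 j1 j2)).
- rewrite size_glue -[iota 0 _]/(index_iota 0 _.+1) big_mkord.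
  apply: eq_bigr => a _; congr (_ * (_ * _)); rewrite size_marked_words.
  have ha : a <= j2 - i1.+1 by have := ltn_ord a; lia.
  have e : a + (j2 - (i1.+1 + a)) = j2 - i1.+1 by lia.
  rewrite e; apply: eq_bigr => b _.
  by congr (npaths _ _ _ * (npaths _ _ _ * npaths _ _ _)); lia.
- exact: disjoint_words_uniq.
- by move=> w /mem_disjoint_words[||||/words_dyckP].
- move=> s t ht e; rewrite mem_disjoint_words //.
  have h i j := sends_arc i j ht e.
  split=> [/andP[/h ? /h ?]|[_ /h-> /h->]//].
  by split=> //; exact: word_in_words.
Qed.

(** An entry above [j2] before place [i1] would form 312 with [j1] and [j2]. So the first
    [i1.+1] entries are distinct and below [j2], which is too few values. *)
Lemma card_sends_crossing N i1 i2 j1 j2 : j1 < j2 -> j2 <= i1 -> i1 < i2 ->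
  #|[pred s : 'S_N | avoids312 s &&
      (sends i1.+1%:Z j1.+1%:Z s && sends i2.+1%:Z j2.+1%:Z s)]| = 0.
Proof.
move=> h1 h2 h3; apply: eq_card0 => s; apply/negP; rewrite inE => /andP[ha /andP[]].
move=> /sends_nth[hi1 e1] /sends_nth[hi2 e2].
move: ha; rewrite avoids312E => /avoidsP ha.
have hu : uniq (seq_of_perm s) by rewrite (perm_uniq (perm_seq_of_perm s)) iota_uniq.
(* Pigeonhole: i1 + 1 distinct values below j2. *)
have hsub : {subset take i1.+1 (seq_of_perm s) <= iota 0 j2}.
  move=> v hv; rewrite mem_iota /= add0n; have := nth_index 0 hv.
  have := hv; rewrite -index_mem size_takel ?size_seq_of_perm //.
  set k := index _ _ => hk; rewrite nth_take // => <-.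
  have [->|hki] := eqVneq k i1; first by rewrite e1.
  have hk1 : k < i1 by lia.
  have := ha k i1 i2 hk1 h3; rewrite size_seq_of_perm e1 e2 h1 => /(_ hi2).
  rewrite -leqNgt leq_eqVlt => /orP[/eqP e|//].
  have : nth 0 (seq_of_perm s) k == nth 0 (seq_of_perm s) i2 by rewrite e e2.
  by rewrite nth_uniq ?size_seq_of_perm //; lia.
have := uniq_leq_size (take_uniq _ hu) hsub.
by rewrite size_takel ?size_seq_of_perm // size_iota; lia.
Qed.

(** * The reflection formula and the growth of path counts *)

Lemma npaths_far L x y : (x + L < y) || (y + L < x) -> npaths L x y = 0.
Proof.
elim: L x => [|L IH] x h; first by rewrite /npaths /=; case: eqP => //; lia.
rewrite npathsS IH; last by lia.
by case: x h => // x h; rewrite IH //; lia.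
Qed.

Lemma npaths_parity L x y : odd (L + x + y) -> npaths L x y = 0.
Proof.
elim: L x => [|L IH] x h; first by rewrite /npaths /=; case: eqP => //; lia.
rewrite npathsS IH; last by lia.
by case: x h => // x h; rewrite IH //; lia.
Qed.

(** Reflection principle for paths with [u] up and [v] down steps: those that go below
    zero correspond to the paths with [u + x + 1] up steps. *)
Lemma npaths_reflection L x y u v : u + v = L -> x + u = y + v ->
  npaths L x y + 'C(L, (u + x).+1) = 'C(L, u).
Proof.
elim: L x u v => [|L IH] x u v.
  move=> h; have [-> ->] : u = 0 /\ v = 0 by lia.
  by rewrite !addn0 => ->; rewrite /npaths /= eqxx bin0.
move=> huv hxy; rewrite npathsS.
have h1 : npaths L x.+1 y + 'C(L, (u + x).+1) = if u is u'.+1 then 'C(L, u') else 0.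
  case: u huv hxy => [|u] huv hxy.
    by rewrite npaths_far ?bin_small //; lia.
  by rewrite -(IH x.+1 u v); [congr (_ + 'C(_, _))| |]; lia.
have h2 : (if x is x'.+1 then npaths L x' y else 0) + 'C(L, u + x) = 'C(L, u).
  case: x hxy {h1} => [|x] hxy; first by rewrite addn0.
  case: v huv hxy => [|v] huv hxy.
    by rewrite npaths_far ?bin_small //; lia.
  by rewrite addnS (IH x u v) //; lia.
case: u huv hxy h1 h2 => [|u] huv hxy h1 h2; rewrite !binS ?bin0; last by lia.
by move: h2; rewrite bin0; lia.
Qed.

Lemma fact_prod_le k X Y :
  (k.+1 + X * Y) * ((k + X)`! * (k + Y)`!) <= k.+1`! * (k + X + Y)`!.
Proof.
elim: X => [|X IH]; first by rewrite mul0n !addn0 factS; lia.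
rewrite -(leq_pmul2l (_ : 0 < k.+1 + X * Y)) //.
have -> : k + X.+1 + Y = (k + X + Y).+1 by rewrite addnS addSn.
rewrite addnS (factS (k + X)) (factS (k + X + Y)).
have h : (k.+1 + X.+1 * Y) * (k + X).+1 <= (k.+1 + X * Y) * (k + X + Y).+1.
  rewrite [leqRHS](_ : _ = (k.+1 + X.+1 * Y) * (k + X).+1 + X * (Y * (Y - 1))) ?leq_addr //.
  case: Y {IH} => [|Y]; first by ring.
  by rewrite subSS subn0; ring.
have := leq_mul h IH; move: ((k + X)`!) ((k + Y)`!) ((k + X + Y)`!) => a b c.
move: k.+1`! (k.+1 + X.+1 * Y) (k.+1 + X * Y) (k + X).+1 (k + X + Y).+1.
move=> f p q r s hh.
rewrite [leqLHS](_ : _ = p * r * (q * (a * b))); last by ring.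
by rewrite [leqRHS](_ : _ = q * s * (f * c)) //; ring.
Qed.

(** All paths outnumber the reflected ones by a factor that is a product of [X] quotients
    [(k + 1 + Y + l) / (k + 1 + l)],
    which is at least [1 + X Y / (k + 1)] by induction on [X]. *)
Lemma bin_ratio k X Y :
  (k.+1 + X * Y) * 'C(k + k + X + Y, k) <= k.+1 * 'C(k + k + X + Y, k + X).
Proof.
have h1 := @bin_fact (k + k + X + Y) k (ltac:(lia)).
have h2 := @bin_fact (k + k + X + Y) (k + X) (ltac:(lia)).
rewrite -(leq_pmul2r (_ : 0 < (k`! * (k + X + Y)`!) * ((k + X)`! * (k + Y)`!))); last first.
  by rewrite !muln_gt0 !fact_gt0.
move: h1 h2; rewrite (_ : _ - k = k + X + Y) 1?(_ : _ - (k + X) = k + Y); try by lia.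
have := fact_prod_le k X Y; rewrite factS -mulnA.
set a := 'C(_, k); set b := 'C(_, k + X); set p := k`! * (k + X + Y)`!.
set q := (k + X)`! * (k + Y)`!; set n := (k + k + X + Y)`! => h h1 h2.
have -> : (k.+1 + X * Y) * a * (p * q) = n * ((k.+1 + X * Y) * q) by rewrite -h1; ring.
have -> : k.+1 * b * (p * q) = n * (k.+1 * p) by rewrite -h2; ring.
by rewrite leq_mul2l h orbT.
Qed.

Lemma mul_bin_two L w : w <= L ->
  w.+1 * (L - w).+1 * 'C(L.+2, w.+1) = L.+2 * L.+1 * 'C(L, w).
Proof.
move=> hw; have h1 : L.+2 * 'C(L.+1, w) = w.+1 * 'C(L.+2, w.+1) := mul_bin_diag L.+2 w.
have h2 : L.+1 * 'C(L, w) = (L.+1 - w) * 'C(L.+1, w) := mul_bin_down L.+1 w.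
rewrite subSn // in h2.
by rewrite mulnAC -h1 -[RHS]mulnA h2 mulnAC mulnA.
Qed.

(** Arithmetic core of [npaths_growth]: [c] and [c'] count all paths and reflected
    paths, [c2] and [c2'] the same with two more steps, and [n], [n2] are the
    differences. The factor [s / D] is at least [4 (L + 1) / (L + 2)] by the inequality of
    the means, and the reflected term costs a factor [P / (P + 1)]. *)
Lemma growth_arith (c c' c2 c2' n n2 D s P K Z L : nat) :
  n + c' = c -> n2 + c2' = c2 -> D * c2 = s * c -> P.+1 * K * c2' = s * c' ->
  (K + Z) * c' <= K * c -> D = P.+1 * K + Z -> 4 * D <= (L.+2) * (L.+2) ->
  s = (L.+2) * L.+1 -> L.+2 <= 2 * P -> 0 < K -> 0 < D ->
  4 * (L - 1) * n <= (L.+2) * n2.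
Proof.
move=> <- <- hc2 hc2' hZ hD hDL hs hP K0 D0.
have e1 : P.+1 * K * (D * n2) + s * (Z * c') = P.+1 * K * (s * n).
  apply/eqP; rewrite -(eqn_add2r (P.+1 * K * s * c')); apply/eqP.
  transitivity (P.+1 * K * (D * (n2 + c2'))); last by rewrite hc2; ring.
  rewrite mulnDr mulnDr -addnA; congr (_ + _).
  by rewrite [RHS]mulnCA hc2' hD; ring.
have e2 : Z * c' <= K * n by lia.
have e3 : s * (P * n) <= P.+1 * (D * n2).
  rewrite -(leq_pmul2l K0) -(leq_add2r (s * (Z * c'))).
  rewrite [leqRHS](_ : _ = P.+1 * K * (s * n)); last by rewrite -e1; ring.
  have := leq_mul (leqnn s) e2 => h.
  by rewrite [leqRHS](_ : _ = K * (s * (P * n)) + s * (K * n)) ?leq_add2l //; ring.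
have e4 : 4 * L.+1 * (P * n) <= P.+1 * ((L.+2) * n2).
  rewrite -(leq_pmul2l D0).
  have h1 := leq_mul hDL (leqnn (L.+1 * (P * n))).
  have h2 := leq_mul (leqnn L.+2) e3; rewrite hs in h2.
  rewrite [leqLHS](_ : _ = 4 * D * (L.+1 * (P * n))); last by ring.
  rewrite [leqRHS](_ : _ = L.+2 * (P.+1 * (D * n2))); last by ring.
  apply: leq_trans h1 (leq_trans _ h2).
  by rewrite leq_eqVlt (_ : _ == _) //; apply/eqP; ring.
rewrite -(leq_pmul2l (ltn0Sn P)); apply: leq_trans e4.
rewrite [leqLHS](_ : _ = 4 * (((L - 1) * P.+1) * n)); last by ring.
rewrite [leqRHS](_ : _ = 4 * ((L.+1 * P) * n)); last by ring.
rewrite leq_mul2l leq_mul2r; apply/orP; right; apply/orP; right.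
case: L hDL hs hP => [|L] hDL hs hP; first by lia.
by rewrite subn1 /= mulnS !mulSn; lia.
Qed.

(** Two more steps multiply the number of nonnegative paths by almost 4. The factor
    does not involve the end points. *)
Lemma npaths_growth L x y : x + y + 2 <= L ->
  4 * (L - 1) * npaths L x y <= L.+2 * npaths L.+2 x y.
Proof.
move=> hL; have [ho|he] := boolP (odd (L + x + y)).
  by rewrite npaths_parity ?muln0.
have [k eL] : exists k, L = k + k + x.+1 + y.+1.
  by exists (L - x - y)./2.-1; lia.
have r1 : npaths L x y + 'C(L, (k + y.+1 + x).+1) = 'C(L, k + y.+1).
  by apply: (@npaths_reflection _ _ _ _ (k + x.+1)); lia.
have r2 : npaths L.+2 x y + 'C(L.+2, (k + y.+1 + x).+2) = 'C(L.+2, (k + y.+1).+1).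
  by apply: (@npaths_reflection _ _ _ (k + y.+1).+1 (k + x.+1).+1); lia.
have hb := bin_ratio k x.+1 y.+1; rewrite -eL in hb.
have e1 : 'C(L, k) = 'C(L, (k + y.+1 + x).+1).
  by rewrite -bin_sub; [congr 'C(_, _)|]; lia.
have e2 : 'C(L, k + x.+1) = 'C(L, k + y.+1).
  by rewrite -[RHS]bin_sub; [congr 'C(_, _)|]; lia.
rewrite e1 e2 in hb.
have s1 : (k + y.+1).+1 * (k + x.+1).+1 * 'C(L.+2, (k + y.+1).+1) =
          L.+2 * L.+1 * 'C(L, k + y.+1).
  by rewrite -mul_bin_two; [congr (_ * _ * _)|]; lia.
have s2 : (k + y.+1 + x).+2 * k.+1 * 'C(L.+2, (k + y.+1 + x).+2) =
          L.+2 * L.+1 * 'C(L, (k + y.+1 + x).+1).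
  by rewrite -mul_bin_two; [congr (_ * _ * _)|]; lia.
apply: (growth_arith r1 r2 s1 s2 hb) => //; rewrite ?eL.
- by ring.
- have := nat_AGM2 (k + y.+1).+1 (k + x.+1).+1 => -[+ _].
  rewrite mulnn => h; suff -> : (k + k + x.+1 + y.+1).+2 = (k + y.+1).+1 + (k + x.+1).+1 by [].
  by lia.
- by lia.
Qed.

Local Open Scope classical_set_scope.
Local Open Scope ring_scope.

(** * The walk killed below zero *)

Section Nu.
Variable R : realFieldType.

(** Probability that a simple random walk started at [x] is at [y] after [L] steps without
    having gone below zero. *)
Definition nu L x y : R := (npaths L x y)%:R / 2 ^+ L.

Lemma nu_ge0 L x y : 0 <= nu L x y.
Proof. by rewrite divr_ge0 // exprn_ge0. Qed.

Lemma nu0 x y : nu 0 x y = (x == y)%:R.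
Proof. by rewrite /nu expr0 divr1 /npaths /=; case: eqP. Qed.

Lemma nuS L x y : nu L.+1 x y =
  (nu L x.+1 y + (if x is x'.+1 then nu L x' y else 0)) / 2.
Proof.
rewrite /nu npathsS natrD exprS invfM; case: x => [|x].
  by rewrite !addr0; field.
by field.
Qed.

Lemma nu_parity L x y : odd (L + x + y) -> nu L x y = 0.
Proof. by move=> h; rewrite /nu npaths_parity ?mul0r. Qed.

Lemma nu_far L x y : (x + L < y)%N || (y + L < x)%N -> nu L x y = 0.
Proof. by move=> h; rewrite /nu npaths_far ?mul0r. Qed.

(** Chapman-Kolmogorov; heights above [B] cannot be reached in [L1] steps. *)
Lemma nu_chapman B L1 L2 x y : (x + L1 <= B)%N ->
  \sum_(a < B.+1) nu L1 x a * nu L2 a y = nu (L1 + L2) x y.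
Proof.
elim: L1 x => [|L1 IH] x hB.
  have hx : (x < B.+1)%N by lia.
  rewrite (bigD1 (Ordinal hx)) //= nu0 eqxx mul1r big1 ?addr0 // => a ha.
  rewrite nu0 (_ : (x == a)%N = false) ?mul0r //.
  by apply/negP => /eqP e; case/eqP: ha; apply: val_inj.
rewrite addSn nuS -IH; last by lia.
case: x hB => [|x] hB.
  rewrite addr0 mulr_suml; apply: eq_bigr => a _.
  by rewrite nuS addr0; ring.
rewrite -(IH x); last by lia.
rewrite -big_split /= mulr_suml; apply: eq_bigr => a _.
by rewrite nuS; ring.
Qed.

(** Exponential Markov inequality; [r] below 1 bounds the probability of coming down
    from a large height. *)
Lemma nu_chernoff r L x y : 0 < r ->
  nu L x y <= ((r + r^-1) / 2) ^+ L * r ^+ x / r ^+ y.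
Proof.
move=> r0; have r1 : r != 0 by rewrite gt_eqF.
elim: L x => [|L IH] x.
  rewrite nu0 expr0 mul1r; case: eqP => [->|_].
    by rewrite divff // expf_neq0.
  by rewrite divr_ge0 // exprn_ge0 // ltW.
rewrite nuS; have h1 := IH x.+1.
have h2 : (if x is x'.+1 then nu L x' y else 0) <=
    ((r + r^-1) / 2) ^+ L * (r ^+ x / r) / r ^+ y.
  case: x {h1} => [|x]; last by rewrite [_ ^+ x.+1]exprSr mulfK //; exact: IH.
  by rewrite !mulr_ge0 ?invr_ge0 ?exprn_ge0 ?divr_ge0 ?addr_ge0 ?invr_ge0 // ltW.
have -> : ((r + r^-1) / 2) ^+ L.+1 * r ^+ x / r ^+ y =
   (((r + r^-1) / 2) ^+ L * r ^+ x.+1 / r ^+ y +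
    ((r + r^-1) / 2) ^+ L * (r ^+ x / r) / r ^+ y) / 2.
  by rewrite !exprS; field; rewrite r1 expf_neq0.
by rewrite ler_wpM2r ?invr_ge0 // lerD.
Qed.

Lemma nu_le1 L x y : nu L x y <= 1.
Proof.
have := @nu_chernoff 1 L x y ltr01.
by rewrite invr1 divff ?pnatr_eq0 // !expr1n mul1r divr1.
Qed.

Lemma nu_growth2 L x y : (x + y + 2 <= L)%N ->
  (1 - 3 / L%:R) * nu L x y <= nu L.+2 x y.
Proof.
move=> hL; have L0 : 0 < L%:R :> R by rewrite ltr0n; lia.
have := npaths_growth hL; rewrite -(ler_nat R) !natrM natrB; last by lia.
rewrite /nu !exprS; set n := (npaths L x y)%:R; set n2 := (npaths L.+2 x y)%:R.
set e := 2 ^+ L => h.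
have e0 : 0 < e by rewrite exprn_gt0.
have n0 : 0 <= n by [].
have l1 : L.+2%:R = L%:R + 2 :> R by rewrite -natr1 -natr1; ring.
rewrite l1 in h.
have h3 : 4 * (1 - 3 / L%:R) * n <= n2.
  rewrite -(ler_pM2l (_ : 0 < L%:R + 2)); last by lra.
  apply: le_trans h.
  have -> : (L%:R + 2) * (4 * (1 - 3 / L%:R) * n) =
            4 * (L%:R - 1) * n - 4 * (6 / L%:R) * n.
    by field; lra.
  by rewrite lerBlDr lerDl !mulr_ge0 ?invr_ge0 // ltW.
rewrite [leRHS](_ : _ = n2 / 4 / e); last by field; lra.
rewrite mulrA ler_wpM2r ?invr_ge0 ?(ltW e0) // ler_pdivlMr //; lra.
Qed.

Lemma nu_growth L x y k : (x + y + 2 <= L)%N ->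
  (1 - 3 * k%:R / L%:R) * nu L x y <= nu (L + k.*2) x y.
Proof.
move=> hL; have L0 : 0 < L%:R :> R by rewrite ltr0n; lia.
elim: k => [|k IH]; first by rewrite mulr0 mul0r subr0 mul1r double0 addn0.
have [h|h] := leP (1 - 3 * k.+1%:R / L%:R : R) 0.
  by apply: le_trans (nu_ge0 _ _ _); rewrite mulr_le0_ge0 // nu_ge0.
rewrite doubleS !addnS; apply: le_trans (@nu_growth2 _ _ _ _); last by lia.
have hk : 3 / (L + k.*2)%:R <= 3 / L%:R :> R.
  rewrite ler_wpM2l // lef_pV2 ?posrE // ?ler_nat ?leq_addr //.
  by rewrite ltr0n; lia.
have h3 : 3 * k.+1%:R / L%:R = 3 * k%:R / L%:R + 3 / L%:R :> R.
  by rewrite -natr1; field; lra.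
have p0 : 0 <= 3 * k%:R / L%:R :> R by rewrite divr_ge0 ?mulr_ge0 // ltW.
have p1 : 0 <= 3 / L%:R :> R by rewrite divr_ge0 // ltW.
apply: le_trans (_ : (1 - 3 / L%:R) * ((1 - 3 * k%:R / L%:R) * nu L x y) <= _).
  rewrite mulrA ler_wpM2r ?nu_ge0 //; nra.
apply: le_trans (_ : (1 - 3 / L%:R) * nu (L + k.*2) x y <= _).
  by rewrite ler_wpM2l //; lra.
by rewrite ler_wpM2r ?nu_ge0 //; lra.
Qed.

(** Moving to a later time loses at most a factor [1 - d], provided that heights and time
    shift are bounded by some [M] that is small compared with [d * L]. *)
Lemma nu_le_later (d : R) M L L' x y : (x + y + 2 <= M)%N -> (L <= L' <= L + M.*2)%N ->
  ~~ odd (L' - L) -> 0 < d -> 3 * M%:R <= d * L%:R -> d <= 1 ->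
  (1 - d) * nu L x y <= nu L' x y.
Proof.
move=> hxy hL ho d0 hM d1.
have hLM : (M <= L)%N.
  rewrite -(ler_nat R); have : d * L%:R <= 1 * L%:R :> R by rewrite ler_wpM2r.
  have : 0 <= M%:R :> R by []. by lra.
have -> : L' = (L + ((L' - L)./2).*2)%N by lia.
apply: le_trans (nu_growth _ _); last by lia.
rewrite ler_wpM2r ?nu_ge0 // lerD2l lerN2.
have L0 : 0 < L%:R :> R by rewrite ltr0n; lia.
rewrite ler_pdivrMr //; apply: le_trans hM; rewrite ler_wpM2l // ler_nat; lia.
Qed.
End Nu.

(** * Splicing two pieces of path at a height-dependent time *)

Section Merge.
Variable R : realFieldType.
Local Notation nu := (nu R).

Lemma sum_ord_split (f : nat -> R) A B : (A <= B)%N ->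
  \sum_(a < B) f a = \sum_(a < A) f a + \sum_(A <= a < B) f a.
Proof. by move=> h; rewrite -!(big_mkord xpredT) -big_cat_nat. Qed.

Lemma ler_sum_ord (f : nat -> R) A B : (A <= B)%N -> (forall a, 0 <= f a) ->
  \sum_(a < A) f a <= \sum_(a < B) f a.
Proof. by move=> h f0; rewrite (sum_ord_split f h) lerDl sumr_ge0. Qed.

Lemma ler_sum_tail (f : nat -> R) A B tau : (A <= B)%N -> 0 <= tau ->
  (forall a, (A <= a)%N -> f a <= tau) ->
  \sum_(a < B) f a <= \sum_(a < A) f a + B%:R * tau.
Proof.
move=> h t0 ft; rewrite (sum_ord_split f h) lerD2l.
apply: le_trans (_ : \sum_(A <= a < B) tau <= _).
  by rewrite big_nat_cond [leRHS]big_nat_cond ler_sum // => a /andP[/andP[/ft]].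
rewrite sumr_const_nat -[leLHS]mulr_natl ler_wpM2r // ler_nat; lia.
Qed.

Lemma close_le (d : R) M n L : 0 < d -> 3 * M%:R <= d * n%:R -> (n <= L)%N ->
  3 * M%:R <= d * L%:R.
Proof. by move=> d0 h hn; apply: le_trans h _; rewrite ler_pM2l // ler_nat. Qed.

Lemma close_leq (d : R) M n : 0 < d -> d <= 1 -> 3 * M%:R <= d * n%:R ->
  (3 * M <= n)%N.
Proof.
move=> d0 d1 h; rewrite -(ler_nat R) natrM; apply: le_trans h _.
by rewrite -[leRHS]mul1r ler_wpM2r.
Qed.

Lemma mul_close (d x1 y1 x2 y2 : R) : d <= 1 -> 0 <= x1 -> 0 <= x2 ->
  (1 - d) * x1 <= y1 -> (1 - d) * x2 <= y2 -> (1 - d) ^+ 2 * (x1 * x2) <= y1 * y2.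
Proof.
move=> d1 x10 x20 h1 h2; rewrite expr2 mulrACA; apply: ler_pM => //.
  by rewrite mulr_ge0 //; lra.
by rewrite mulr_ge0 //; lra.
Qed.

Section Bounds.
Variables (d : R) (M n p A b : nat).
Hypotheses (d0 : 0 < d) (d1 : d <= 1).
Hypotheses (hn : 3 * M%:R <= d * n%:R) (hp : 3 * M%:R <= d * p%:R).
Hypothesis hM : (2 * A + b + 2 <= M)%N.

Let hn3 : (3 * M <= n)%N := close_leq d0 d1 hn.
Let hp3 : (3 * M <= p)%N := close_leq d0 d1 hp.

(** Splicing at a time that depends on the height [a]. Times [2n - a] with [a] even are
    moved up to [2n], those with [a] odd to [2n + 1]; for each parity the sum is then a
    Chapman-Kolmogorov sum. The two parities explain the factor 2. *)
Lemma merge_upper :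
  (1 - d) ^+ 2 * (\sum_(a < A.+1) nu (n.*2 - a) 0 a * nu (p.*2 - a - b) a b) <=
  2 * nu ((n + p).*2 - b) 0 b.
Proof.
(* E vanishes at odd heights and O at even ones. *)
pose E a := nu n.*2 0 a * nu (p.*2 - b) a b.
pose O a := nu n.*2.+1 0 a * nu (p.*2 - b).-1 a b.
have E0 a : 0 <= E a by rewrite mulr_ge0 ?nu_ge0.
have O0 a : 0 <= O a by rewrite mulr_ge0 ?nu_ge0.
have sE : \sum_(a < ((n + p).*2).+1) E a = nu ((n + p).*2 - b) 0 b.
  by rewrite nu_chapman; [congr (nu _ _ _)|]; lia.
have sO : \sum_(a < ((n + p).*2).+1) O a = nu ((n + p).*2 - b) 0 b.
  by rewrite nu_chapman; [congr (nu _ _ _)|]; lia.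
rewrite mulr_natl mulr2n -{1}sE -sO mulr_sumr.
have hAB : (A.+1 <= ((n + p).*2).+1)%N by lia.
apply: le_trans (lerD (ler_sum_ord hAB E0) (ler_sum_ord hAB O0)).
rewrite -big_split /=; apply: ler_sum => a _.
have ha := ltn_ord a.
have [ho|ho] := boolP (odd a).
  apply: le_trans (_ : O a <= _); last by rewrite lerDr.
  by apply: mul_close; rewrite ?nu_ge0 //; apply: (nu_le_later (M := M)) => //;
    first [by clear -hn3 hp3 hM ha ho; lia | by apply: close_le hn _; clear -hn3 hp3 hM ha ho; lia
    | by apply: close_le hp _; clear -hn3 hp3 hM ha ho; lia].
apply: le_trans (_ : E a <= _); last by rewrite lerDl.
by apply: mul_close; rewrite ?nu_ge0 //; apply: (nu_le_later (M := M)) => //;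
  first [by clear -hn3 hp3 hM ha ho; lia | by apply: close_le hn _; clear -hn3 hp3 hM ha ho; lia
    | by apply: close_le hp _; clear -hn3 hp3 hM ha ho; lia].
Qed.

(** Here all times are moved down, to [2n - 2A] or [2n - 2A - 1] according to parity. The
    heights above [A], absent from the sum, are paid for by [tau]. *)
Lemma merge_lower tau : (0 < A)%N ->
  (forall t a, (t <= n.*2)%N -> (A < a)%N -> nu t 0 a <= tau) ->
  (1 - d) ^+ 2 * (2 * nu ((n + p - A.*2).*2 - b) 0 b - 8 * n%:R * tau) <=
  \sum_(a < A.+1) nu (n.*2 - a) 0 a * nu (p.*2 - a - b) a b.
Proof.
move=> A0 htau.
have t0 : 0 <= tau by apply: le_trans (nu_ge0 _ 0 0 A.+1) (htau 0%N A.+1 _ _).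
(* E vanishes at odd heights and O at even ones. *)
pose E a := nu (n - A).*2 0 a * nu ((p - A).*2 - b) a b.
pose O a := nu (n - A).*2.-1 0 a * nu ((p - A).*2 - b).+1 a b.
have E0 a : 0 <= E a by rewrite mulr_ge0 ?nu_ge0.
have O0 a : 0 <= O a by rewrite mulr_ge0 ?nu_ge0.
pose B := n.*2.
have sE : \sum_(a < B.+1) E a = nu ((n + p - A.*2).*2 - b) 0 b.
  by rewrite nu_chapman; [congr (nu _ _ _)|]; rewrite /B; lia.
have sO : \sum_(a < B.+1) O a = nu ((n + p - A.*2).*2 - b) 0 b.
  by rewrite nu_chapman; [congr (nu _ _ _)|]; rewrite /B; lia.
have hAB : (A.+1 <= B.+1)%N by rewrite /B; lia.
have tE a : (A < a)%N -> E a <= tau.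
  move=> ha; rewrite -[tau]mulr1; apply: ler_pM; rewrite ?nu_ge0 ?nu_le1 //.
  by apply: htau => //; lia.
have tO a : (A < a)%N -> O a <= tau.
  move=> ha; rewrite -[tau]mulr1; apply: ler_pM; rewrite ?nu_ge0 ?nu_le1 //.
  by apply: htau => //; lia.
have hE := ler_sum_tail hAB t0 tE; have hO := ler_sum_tail hAB t0 tO.
rewrite sE in hE; rewrite sO in hO.
have hB : B.+1%:R * tau <= 4 * n%:R * tau.
  rewrite -natrM ler_wpM2r // ler_nat /B; lia.
set v := nu _ 0 b in hE hO *.
have h1 : 2 * v - 8 * n%:R * tau <= \sum_(a < A.+1) (E a + O a).
  rewrite big_split /=; lra.
apply: le_trans (_ : (1 - d) ^+ 2 * (\sum_(a < A.+1) (E a + O a)) <= _).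
  by rewrite ler_wpM2l // sqr_ge0.
rewrite mulr_sumr; apply: ler_sum => a _.
have ha := ltn_ord a.
have [ho|ho] := boolP (odd a).
  rewrite {1}/E nu_parity ?mul0r ?add0r; last by clear -ho; lia.
  by apply: mul_close; rewrite ?nu_ge0 //; apply: (nu_le_later (M := M)) => //;
    first [by clear -hn3 hp3 hM ha ho; lia | by apply: close_le hn _; clear -hn3 hp3 hM ha ho; lia
    | by apply: close_le hp _; clear -hn3 hp3 hM ha ho; lia].
rewrite {1}/O nu_parity ?mul0r ?addr0; last by clear -hn3 hM ho; lia.
by apply: mul_close; rewrite ?nu_ge0 //; apply: (nu_le_later (M := M)) => //;
  first [by clear -hn3 hp3 hM ha ho; lia | by apply: close_le hn _; clear -hn3 hp3 hM ha ho; lia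
    | by apply: close_le hp _; clear -hn3 hp3 hM ha ho; lia].
Qed.
End Bounds.
End Merge.

(** * Normalized Catalan numbers *)

Section Catalan.
Variable R : realFieldType.

(** The Catalan number of index [n], divided by [4 ^ n]. *)
Definition catalan n : R := nu R n.*2 0 0.

Lemma mul_npaths_bin n : (n.+1 * npaths n.*2 0 0 = 'C(n.*2, n))%N.
Proof.
have h := @npaths_reflection n.*2 0 0 n n (addnn n) erefl.
rewrite addn0 in h.
have h2 := mul_bin_left n.*2 n.
by rewrite (_ : (n.*2 - n)%N = n) in h2; lia.
Qed.

Lemma catalan_ge0 n : 0 <= catalan n. Proof. exact: nu_ge0. Qed.
Lemma catalan_le1 n : catalan n <= 1. Proof. exact: nu_le1. Qed.

Lemma catalanS n : (n.*2 + 4)%:R * catalan n.+1 = n.*2.+1%:R * catalan n.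
Proof.
have h := mul_npaths_bin n; have h' := mul_npaths_bin n.+1.
have := @mul_bin_two n.*2 n (ltac:(lia)); rewrite (_ : (n.*2 - n)%N = n); last by lia.
rewrite -doubleS -h' -h => /eqP.
rewrite (_ : (n.*2.+2 * n.*2.+1 * (n.+1 * _) = n.+1 * n.+1 * (2 * n.*2.+1 * npaths n.*2 0 0))%N); last first.
  by rewrite -muln2; ring.
rewrite eqn_pmul2l // => /eqP/(congr1 (fun k => k%:R : R)).
rewrite !natrM => e; rewrite /catalan /nu doubleS !exprS.
have e0 : 2 ^+ n.*2 != 0 :> R by rewrite expf_neq0 // pnatr_eq0.
have -> : (n.*2 + 4)%:R = 2 * n.+2%:R :> R by rewrite -natrM; congr _%:R; lia.
rewrite [LHS](_ : _ = (n.+2%:R * (npaths n.+1.*2 0 0)%:R) / 2 / 2 ^+ n.*2).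
  by rewrite e; field.
by rewrite doubleS; field.
Qed.

Lemma catalan_gt0 n : 0 < catalan n.
Proof.
rewrite /catalan /nu divr_gt0 ?exprn_gt0 // ltr0n.
have := mul_npaths_bin n; have : (0 < 'C(n.*2, n))%N by rewrite bin_gt0; lia.
by case: npaths => //; lia.
Qed.

Lemma catalan_decrS n : catalan n.+1 <= catalan n.
Proof.
rewrite -(ler_pM2l (_ : 0 < (n.*2 + 4)%:R)) ?ltr0n ?addn_gt0 ?orbT //.
by rewrite catalanS ler_wpM2r ?catalan_ge0 // ler_nat; lia.
Qed.

Lemma catalan_decr m n : (m <= n)%N -> catalan n <= catalan m.
Proof.
move=> /subnKC <-; elim: (n - m)%N => [|k IH]; first by rewrite addn0.
by rewrite addnS (le_trans (catalan_decrS _)).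
Qed.

Lemma catalan_lower n : 1 <= (n.+1 * n.*2.+1)%:R * catalan n.
Proof.
elim: n => [|n IH]; first by rewrite mul1n mul1r /catalan nu0.
apply: le_trans IH _; have h := catalanS n; have c0 := catalan_ge0 n.
have e : (n.+2 * n.+1.*2.+1)%:R * catalan n.+1 = n.*2.+3%:R / 2 * (n.*2.+1%:R * catalan n).
  rewrite -h doubleS natrM.
  have -> : (n.*2 + 4)%:R = 2 * n.+2%:R :> R by rewrite -natrM; congr _%:R; lia.
  by field.
rewrite e natrM -mulrA ler_wpM2r ?mulr_ge0 //.
rewrite ler_pdivlMr // -natrM ler_nat; lia.
Qed.
End Catalan.

(** * Large heights are negligible *)

Section Tail.
Variable R : realFieldType.
(** [nu_chernoff] with [r = 1 + 1 / (2 q)]: in [2 N] steps the walk multiplies [r ^ height]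
    by at most [r ^ (N / q + 1)] on average, whereas heights above [10 N / q] would need
    [r ^ (10 N / q)]. The quotient is at most [r ^ (- 9 N / q)], hence at most a constant
    times [N ^ (- 9)], since [r ^ (N / q)] grows at least linearly. *)
Lemma nu_tail q : (0 < q)%N -> exists2 C : R, 0 < C &
  forall N t a, (t <= N.*2)%N -> (10 * (N %/ q) < a)%N ->
    nu R t 0 a <= C / N.+1%:R ^+ 9 /\ nu R t a 0 <= C / N.+1%:R ^+ 9.
Proof.
move=> q0; have q0' : 0 < q%:R :> R by rewrite ltr0n.
(* With r = 1 + e the mean of r and 1/r is at most 1 + e^2/2, whose 2q-th power is at
   most r by Bernoulli's inequality because 2 q e = 1. *)
pose e : R := (2 * q%:R)^-1; have e0 : 0 < e by rewrite invr_gt0; lra.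
have e1 : e <= 1 / 2.
  have q1 : 1 <= q%:R :> R by rewrite ler1n.
  by rewrite /e div1r lef_pV2 ?posrE; lra.
pose r := 1 + e; have r0 : 0 < r by rewrite /r; lra.
pose s := (r + r^-1) / 2.
have s1 : 1 <= s /\ s <= 1 + e ^+ 2 / 2.
  have -> : s = 1 + e ^+ 2 / 2 / (1 + e) by rewrite /s /r; field; lra.
  split; first by rewrite lerDl !divr_ge0 ?sqr_ge0 //; lra.
  rewrite lerD2l ler_pdivrMr; last by lra.
  by rewrite -[leLHS]mulr1 ler_wpM2l ?divr_ge0 ?sqr_ge0 //; lra.
have s2 : s ^+ q.*2 <= r.
  have x0 : 0 <= e ^+ 2 / 2 by rewrite divr_ge0 ?sqr_ge0.
  have x1 : e ^+ 2 / 2 <= 1 by nra.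
  have hb : 1 - e / 2 <= (1 - e ^+ 2 / 2) ^+ q.*2.
    have -> : e / 2 = q.*2%:R * (e ^+ 2 / 2).
      by rewrite -muln2 natrM /e; field; lra.
    elim: (q.*2) => [|k IH]; first by rewrite mul0r subr0 expr0.
    have k0 : 0 <= k%:R :> R by [].
    move: (e ^+ 2 / 2) x0 x1 IH => x x0 x1 IH; rewrite exprS -natr1.
    have h1 : 0 <= 1 - x by lra.
    have h2 := ler_wpM2l h1 IH; have h3 := mulr_ge0 k0 (mulr_ge0 x0 x0).
    by apply: le_trans h2; lra.
  have h1 : s ^+ q.*2 * (1 - e ^+ 2 / 2) ^+ q.*2 <= 1.
    rewrite -exprMn; move: (e ^+ 2 / 2) s1 x0 x1 {hb} => x [h1 h2] x0 x1.
    rewrite exprn_ile1 //; first by rewrite mulr_ge0 //; lra.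
    apply: le_trans (_ : (1 + x) * (1 - x) <= _).
      by rewrite ler_wpM2r //; lra.
    by have := sqr_ge0 x; rewrite expr2; lra.
  have h2 : s ^+ q.*2 * (1 - e / 2) <= 1.
    apply: le_trans h1; rewrite ler_wpM2l // exprn_ge0 //; lra.
  rewrite /r; have : 1 <= (1 + e) * (1 - e / 2) by nra.
  have : 0 < 1 - e / 2 by lra.
  move=> h3 h4; rewrite -(ler_pM2r h3); exact: le_trans h2 h4.
exists ((q%:R / e) ^+ 9); first by rewrite exprn_gt0 // divr_gt0.
move=> N t a ht ha; set B := (N %/ q)%N in ha.
have hN : (N.+1 <= q * B.+1)%N by rewrite /B mulnC ltn_ceil.
suff hs : s ^+ t / r ^+ a <= (q%:R / e) ^+ 9 / N.+1%:R ^+ 9.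
  split.
    by apply: le_trans (nu_chernoff _ _ _ r0) _; rewrite expr0 mulr1.
  have ri0 : 0 < r^-1 by rewrite invr_gt0.
  apply: le_trans (nu_chernoff _ _ _ ri0) _.
  by rewrite expr0 divr1 invrK exprVn addrC.
have st : s ^+ t <= r ^+ B.+1.
  apply: le_trans (_ : s ^+ (q.*2 * B.+1) <= _).
    by apply: ler_weXn2l; [exact: s1.1|lia].
  by rewrite exprM lerXn2r // nnegrE ?exprn_ge0 //; lra.
have ra : r ^+ (10 * B).+1 <= r ^+ a by apply: ler_weXn2l; rewrite // /r; lra.
apply: le_trans (_ : r ^+ B.+1 / r ^+ (10 * B).+1 <= _).
  apply: ler_pM => //.
  - by rewrite exprn_ge0 //; lra.
  - by rewrite invr_ge0 exprn_ge0 // ltW.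
  - by rewrite lef_pV2 ?posrE ?exprn_gt0.
have -> : r ^+ B.+1 / r ^+ (10 * B).+1 = ((r ^+ B)^-1) ^+ 9.
  rewrite (_ : (10 * B).+1 = B.+1 + B * 9)%N; last by lia.
  by rewrite exprD exprVn exprM; field; rewrite !expf_neq0 // gt_eqF.
rewrite -expr_div_n lerXn2r ?nnegrE ?invr_ge0 ?exprn_ge0 ?divr_ge0 //; try exact: ltW.
rewrite -[leRHS]invrK lef_pV2 ?posrE ?exprn_gt0 ?invr_gt0 ?divr_gt0 //.
rewrite !invf_div; apply: le_trans (_ : e * B.+1%:R <= _).
  by rewrite mulrCA ler_pM2l // ler_pdivrMr // -natrM ler_nat mulnC.
elim: (B) => [|k IH]; first by rewrite expr0; lra.
have h1 : 1 <= r ^+ k by rewrite exprn_ege1 // /r; lra.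
have h2 : e * 1 <= e * r ^+ k by rewrite ler_pM2l.
rewrite exprS {1}/r -natr1; lra.
Qed.
End Tail.

(** * Two-sided bounds for the three sums over heights *)

Section Sums.
Variable R : realFieldType.
Local Notation nu := (nu R).
Local Notation catalan := (catalan R).

(** Normalized number of Dyck words with one prescribed arc: [n] up steps before it, [m]
    down steps after it, and [d + a] pairs of steps inside it when it lies at height [a]. *)
Definition one_arc n d m : R :=
  \sum_(a < n.+1) nu (n.*2 - a) 0 a * (catalan (d + a) * nu (m.*2 - a) a 0).

(** Normalized number of Dyck words with two nested arcs, the outer one at height [a] and
    the inner one at height [b] relative to the outer one. *)
Definition nested_sum n n' d m' m : R :=
  \sum_(a < n.+1) nu (n.*2 - a) 0 a *
    ((\sum_(b < n'.+1) nu (n'.*2 - b) 0 b *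
        (catalan (d + a + b) * nu (m'.*2 - b) b 0)) * nu (m.*2 - a) a 0).

(** Normalized number of Dyck words with two arcs one after the other, at heights [a]
    and [b]. *)
Definition disjoint_sum n d1 p d2 m : R :=
  \sum_(a < (minn n p).+1) nu (n.*2 - a) 0 a *
    (catalan (d1 + a) * (\sum_(b < p.+1) nu (p.*2 - a - b) a b *
        (catalan (d2 + b) * nu (m.*2 - b) b 0))).

(** The sum [one_arc] without the inside of the arc. *)
Definition splice n m B : R := \sum_(a < B) nu (n.*2 - a) 0 a * nu (m.*2 - a) a 0.

Lemma mul_sub_le (s s' u u' v : R) : 0 <= s -> 0 <= s' -> 0 <= u -> 0 <= u' ->
  0 <= v -> u <= 2 -> u' <= 2 -> u - v <= s -> u' - v <= s' ->
  u * u' - 4 * v <= s * s'.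
Proof.
move=> s0 s0' u0 u0' v0 u2 u2' h h'.
have h1 := mulr_ge0 s0 s0'.
have [c|c] := leP u v; first by apply: le_trans h1; nra.
have [c'|c'] := leP u' v; first by apply: le_trans h1; nra.
apply: le_trans (_ : (u - v) * (u' - v) <= _); first by nra.
by apply: ler_pM => //; lra.
Qed.

Section Bounds.
Variables (d : R) (N M A : nat) (tau : R).
Hypotheses (d0 : 0 < d) (d1 : d < 1) (hM : (3 * A + 2 <= M)%N) (A0 : (0 < A)%N).
Hypothesis t0 : 0 <= tau.
Hypothesis htau : forall t a, (t <= N.*2)%N -> (A < a)%N ->
  nu t 0 a <= tau /\ nu t a 0 <= tau.

(** Lengths for which heights up to [M] are negligible, with relative precision [d]. *)
Definition long n := 3 * M%:R <= d * n%:R.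

Let long3 n : long n -> (3 * M <= n)%N.
Proof. by move=> h; exact: (close_leq d0 (ltW d1) h). Qed.

Lemma long_le n m : long n -> (n <= m)%N -> long m.
Proof. by move=> h; exact: (close_le d0 h). Qed.

Lemma catalan_close n a : long n -> (a <= A.*2)%N -> (1 - d) * catalan n <= catalan (n + a).
Proof.
move=> hn ha; have := long3 hn => hn3.
apply: (nu_le_later (M := M)) => //; last exact: ltW.
all: try by clear -hn3 hM ha A0; lia.
by apply: (long_le hn); clear; lia.
Qed.

Lemma splice_ge0 n m B : 0 <= splice n m B.
Proof. by rewrite sumr_ge0 // => a _; rewrite mulr_ge0 ?nu_ge0. Qed.

Lemma splice_upper n m : long n -> long m ->
  (1 - d) ^+ 2 * splice n m A.+1 <= 2 * catalan (n + m).
Proof.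
move=> hn hm.
have := @merge_upper R d M n m A 0 d0 (ltW d1) hn hm.
rewrite /= subn0 addn0 => /(_ _) h; apply: le_trans (h _); last by clear -hM; lia.
rewrite ler_wpM2l ?sqr_ge0 //; apply: ler_sum => a _; by rewrite subn0.
Qed.

Lemma splice_lower n m : long n -> long m -> (n <= N)%N ->
  (1 - d) ^+ 2 * (2 * catalan (n + m) - 8 * N%:R * tau) <= splice n m A.+1.
Proof.
move=> hn hm hnN; have hm3 := long3 hm; have hn3 := long3 hn.
have := @merge_lower R d M n m A 0 d0 (ltW d1) hn hm.
rewrite subn0 addn0 => /(_ _ tau A0) h; apply: le_trans (le_trans (h _ _) _).
- rewrite ler_wpM2l ?sqr_ge0 //.
  have h1 : catalan (n + m) <= nu ((n + m - A.*2).*2) 0 0 by apply: catalan_decr; lia.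
  have h2 : n%:R * tau <= N%:R * tau by rewrite ler_wpM2r // ler_nat.
  lra.
- by clear -hM; lia.
- by move=> t a ht ha; apply: (htau _ ha).1; clear -ht hnN; lia.
- by apply: ler_sum => a _; rewrite subn0.
Qed.

Lemma splice_tail n m B : (A < B)%N -> (n <= N)%N ->
  splice n m B <= splice n m A.+1 + B%:R * tau.
Proof.
move=> hB hn; apply: (@ler_sum_tail R (fun a => nu (n.*2 - a) 0 a * nu (m.*2 - a) a 0)) => //.
move=> a ha; rewrite -[tau]mulr1; apply: ler_pM; rewrite ?nu_ge0 ?nu_le1 //.
by apply: (htau _ _).1 => //; clear -hn; lia.
Qed.

(** Only heights up to [A] are kept, for which the inside of the arc is almost as likely
    as at height 0. *)
Lemma one_arc_lower n e m : long n -> long e -> long m -> (n <= N)%N ->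
  (1 - d) ^+ 3 * (2 * catalan e * catalan (n + m)) - 8 * N%:R * tau <= one_arc n e m.
Proof.
move=> hn he hm hnN; have hn3 := long3 hn.
have hl := splice_lower hn hm hnN.
have h1 : (1 - d) * catalan e * splice n m A.+1 <= one_arc n e m.
  apply: le_trans (_ : \sum_(a < A.+1) nu (n.*2 - a) 0 a * (catalan (e + a) * nu (m.*2 - a) a 0) <= _).
    rewrite mulr_sumr; apply: ler_sum => a _.
    rewrite mulrCA ler_wpM2l ?nu_ge0 // ler_wpM2r ?nu_ge0 // catalan_close //.
    by have := ltn_ord a; clear; lia.
  apply: (@ler_sum_ord _ (fun a => nu (n.*2 - a) 0 a * (catalan (e + a) * nu (m.*2 - a) a 0))).
    by clear -hn3 hM; lia.
  by move=> a; rewrite !mulr_ge0 ?nu_ge0.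
apply: le_trans h1.
have c0 := catalan_ge0 R e; have c1 := catalan_le1 R e.
have [d0' d1'] : 0 <= 1 - d /\ 1 - d <= 1 by rewrite subr_ge0 gerBl !ltW.
have dc : 0 <= (1 - d) * catalan e by rewrite mulr_ge0.
have h2 := ler_wpM2l dc hl.
apply: le_trans h2; rewrite !exprS expr0 mulr1.
set x := 8 * N%:R * tau; have x0 : 0 <= x by rewrite /x !mulr_ge0.
have h3 : (1 - d) * catalan e * ((1 - d) * (1 - d)) <= 1.
  exact: (mulr_ile1 dc (mulr_ge0 d0' d0') (mulr_ile1 d0' c0 d1' c1) (mulr_ile1 d0' d0' d1' d1')).
have := ler_wpM2r x0 h3; lra.
Qed.

Lemma one_arc_upper n e m : long n -> long m -> (n <= N)%N ->
  (1 - d) ^+ 2 * one_arc n e m <= 2 * catalan e * catalan (n + m) + n.+1%:R * tau.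
Proof.
move=> hn hm hnN; have hn3 := long3 hn.
have hu := splice_upper hn hm.
have hAn : (A < n.+1)%N by clear -hn3 hM; lia.
have ht := splice_tail m hAn hnN.
have c0 := catalan_ge0 R e; have c1 := catalan_le1 R e.
have h1 : one_arc n e m <= catalan e * splice n m n.+1.
  rewrite mulr_sumr; apply: ler_sum => a _.
  rewrite [leRHS]mulrCA ler_wpM2l ?nu_ge0 // ler_wpM2r ?nu_ge0 //.
  by apply: catalan_decr; rewrite leq_addr.
have p0 : 0 <= (1 - d) ^+ 2 by rewrite sqr_ge0.
have [d0' d1'] : 0 <= 1 - d /\ 1 - d <= 1 by rewrite subr_ge0 gerBl !ltW.
have p1 : (1 - d) ^+ 2 <= 1 by rewrite exprn_ile1.
apply: le_trans (ler_wpM2l p0 h1) _.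
set x := n.+1%:R * tau in ht *; have x0 : 0 <= x by rewrite /x !mulr_ge0.
have h2 := ler_wpM2l (mulr_ge0 c0 p0) ht; rewrite mulrDr in h2.
have h3 := ler_wpM2l c0 hu.
have h4 : catalan e * (1 - d) ^+ 2 * x <= x.
  rewrite -[leRHS]mul1r ler_wpM2r //; exact: mulr_ile1.
lra.
Qed.

(** For heights up to [A] the inside of the inner arc is almost independent of both
    heights, and the double sum factors into two splices. *)
Lemma nested_lower n n' e m' m : long n -> long n' -> long e -> long m' -> long m ->
  (n <= N)%N -> (n' <= N)%N ->
  (1 - d) ^+ 5 * (4 * catalan e * catalan (n' + m') * catalan (n + m)) - 32 * N%:R * tau <=
  nested_sum n n' e m' m.
Proof.
move=> hn hn' he hm' hm hnN hnN'; have hn3 := long3 hn; have hn3' := long3 hn'.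
have hl := splice_lower hn hm hnN; have hl' := splice_lower hn' hm' hnN'.
have [d0' d1'] : 0 <= 1 - d /\ 1 - d <= 1 by rewrite subr_ge0 gerBl !ltW.
have c0 := catalan_ge0 R e; have c1 := catalan_le1 R e.
have h1 : (1 - d) * catalan e * (splice n m A.+1 * splice n' m' A.+1) <=
    nested_sum n n' e m' m.
  pose f a b := nu (n'.*2 - b) 0 b * (catalan (e + a + b) * nu (m'.*2 - b) b 0).
  have f0 a b : 0 <= f a b by rewrite !mulr_ge0 ?nu_ge0.
  apply: le_trans (_ : \sum_(a < A.+1) nu (n.*2 - a) 0 a *
     ((\sum_(b < n'.+1) f a b) * nu (m.*2 - a) a 0) <= _); last first.
    apply: (@ler_sum_ord _ (fun a => nu (n.*2 - a) 0 a *
      ((\sum_(b < n'.+1) f a b) * nu (m.*2 - a) a 0))).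
      by clear -hn3 hM; lia.
    by move=> a; rewrite !mulr_ge0 ?nu_ge0 ?sumr_ge0.
  rewrite mulrCA mulr_suml; apply: ler_sum => a _.
  rewrite -mulrA ler_wpM2l ?nu_ge0 // mulrC ler_wpM2r ?nu_ge0 //.
  apply: le_trans (_ : \sum_(b < A.+1) f a b <= _); last first.
    by apply: ler_sum_ord => //; clear -hn3' hM; lia.
  rewrite mulr_sumr; apply: ler_sum => b _; rewrite /f.
  rewrite mulrCA ler_wpM2l ?nu_ge0 // ler_wpM2r ?nu_ge0 // -addnA.
  apply: catalan_close => //.
  by have := ltn_ord a; have := ltn_ord b; clear; lia.
apply: le_trans h1.
pose v := (1 - d) ^+ 2 * (8 * N%:R * tau).
have v0 : 0 <= v by rewrite /v !mulr_ge0 // sqr_ge0.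
have p0 : 0 <= (1 - d) ^+ 2 by rewrite sqr_ge0.
have p1 : (1 - d) ^+ 2 <= 1 by rewrite exprn_ile1.
have hc k : 0 <= (1 - d) ^+ 2 * (2 * catalan k) <= 2.
  rewrite mulr_ge0 ?mulr_ge0 ?catalan_ge0 //= mulrCA -[leRHS]mulr1 ler_pM2l //.
  by rewrite mulr_ile1 // ?catalan_ge0 ?catalan_le1.
have hp : (1 - d) ^+ 2 * (2 * catalan (n + m)) * ((1 - d) ^+ 2 * (2 * catalan (n' + m'))) - 4 * v
   <= splice n m A.+1 * splice n' m' A.+1.
  have /andP[? ?] := hc (n + m)%N; have /andP[? ?] := hc (n' + m')%N.
  apply: mul_sub_le; rewrite ?splice_ge0 // /v -mulrBr //.
have dc : 0 <= (1 - d) * catalan e by rewrite mulr_ge0.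
have dc1 : (1 - d) * catalan e <= 1 by rewrite mulr_ile1.
have h2 := ler_wpM2l dc hp; apply: le_trans h2; rewrite mulrBr.
have -> : (1 - d) * catalan e * ((1 - d) ^+ 2 * (2 * catalan (n + m)) *
   ((1 - d) ^+ 2 * (2 * catalan (n' + m')))) =
   (1 - d) ^+ 5 * (4 * catalan e * catalan (n' + m') * catalan (n + m)) by ring.
rewrite lerD2l lerN2.
have : (1 - d) * catalan e * (4 * v) <= 1 * (4 * v) by rewrite ler_wpM2r // mulr_ge0.
have : v <= 1 * (8 * N%:R * tau) by rewrite ler_wpM2r // !mulr_ge0.
by lra.
Qed.

Lemma nested_upper n n' e m' m : tau <= 1 -> long n -> long n' -> long m' -> long m ->
  (n <= N)%N -> (n' <= N)%N ->
  (1 - d) ^+ 4 * nested_sum n n' e m' m <=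
  4 * catalan e * catalan (n' + m') * catalan (n + m) + 5 * N.+1%:R ^+ 2 * tau.
Proof.
move=> t1 hn hn' hm' hm hnN hnN'; have hn3 := long3 hn; have hn3' := long3 hn'.
have [d0' d1'] : 0 <= 1 - d /\ 1 - d <= 1 by rewrite subr_ge0 gerBl !ltW.
have c0 := catalan_ge0 R e; have c1 := catalan_le1 R e.
have p0 : 0 <= (1 - d) ^+ 2 by rewrite sqr_ge0.
have p1 : (1 - d) ^+ 2 <= 1 by rewrite exprn_ile1.
have h1 : nested_sum n n' e m' m <= catalan e * (splice n m n.+1 * splice n' m' n'.+1).
  rewrite mulrCA mulr_suml; apply: ler_sum => a _.
  rewrite -[leRHS]mulrA ler_wpM2l ?nu_ge0 // [leLHS]mulrC ler_wpM2l ?nu_ge0 //.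
  rewrite mulr_sumr; apply: ler_sum => b _.
  rewrite [leRHS]mulrCA ler_wpM2l ?nu_ge0 // ler_wpM2r ?nu_ge0 //.
  by apply: catalan_decr; rewrite -addnA leq_addr.
have hS k k' : long k -> long k' -> (k <= N)%N ->
    (1 - d) ^+ 2 * splice k k' k.+1 <= 2 * catalan (k + k') + N.+1%:R * tau.
  move=> hk hk' hkN; have hu := splice_upper hk hk'.
  have hk3 := long3 hk.
  have hAk : (A < k.+1)%N by clear -hk3 hM; lia.
  have ht := ler_wpM2l p0 (splice_tail k' hAk hkN); apply: le_trans ht _.
  rewrite mulrDr lerD // -[leRHS]mul1r; apply: ler_pM => //; rewrite ?mulr_ge0 //.
  by rewrite ler_wpM2r // ler_nat.
have := hS _ _ hn' hm' hnN'; have := hS _ _ hn hm hnN.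
have q0 : 0 <= (1 - d) ^+ 4 by rewrite exprn_ge0.
have h2 := ler_wpM2l q0 h1.
set y := N.+1%:R * tau; have y0 : 0 <= y by rewrite /y mulr_ge0.
move=> hs hs'; apply: le_trans h2 _.
have h3 := ler_pM (mulr_ge0 p0 (splice_ge0 n m n.+1))
  (mulr_ge0 p0 (splice_ge0 n' m' n'.+1)) hs hs'.
have h4 := ler_wpM2l c0 h3.
rewrite [leLHS](_ : _ = catalan e * ((1 - d) ^+ 2 * splice n m n.+1 *
  ((1 - d) ^+ 2 * splice n' m' n'.+1))); last by ring.
apply: le_trans h4 _.
have yN : y <= N.+1%:R ^+ 2 * tau.
  by rewrite ler_wpM2r // expr2 ler_peMl // ler1n.
have yy : y * y <= N.+1%:R ^+ 2 * tau.
  rewrite /y mulrACA -expr2 ler_wpM2l ?sqr_ge0 //.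
  by rewrite -[leRHS]mulr1 ler_wpM2l.
have [? ?] := (catalan_ge0 R (n + m), catalan_le1 R (n + m)).
have [? ?] := (catalan_ge0 R (n' + m'), catalan_le1 R (n' + m')).
have k1 : catalan e * catalan (n + m) * y <= y.
  by rewrite -[leRHS]mul1r ler_wpM2r // mulr_ile1.
have k2 : catalan e * catalan (n' + m') * y <= y.
  by rewrite -[leRHS]mul1r ler_wpM2r // mulr_ile1.
have k3 : catalan e * (y * y) <= y * y by rewrite ler_piMl // mulr_ge0.
rewrite [leLHS](_ : _ = 4 * catalan e * catalan (n' + m') * catalan (n + m) +
  2 * (catalan e * catalan (n + m) * y) + 2 * (catalan e * catalan (n' + m') * y) +
  catalan e * (y * y)); last by ring.
lra.
Qed.

(** Two successive splices: the path before the first arc with the path between the arcs,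
    and the result, of length parameter [n + p - 2 A], with the path after the second arc. *)
Lemma disjoint_lower n e1 p e2 m : long n -> long e1 -> long p -> long e2 -> long m ->
  (n + p <= N)%N ->
  (1 - d) ^+ 6 * (4 * catalan e1 * catalan e2 * catalan (n + p + m)) -
    100 * N%:R ^+ 2 * tau <= disjoint_sum n e1 p e2 m.
Proof.
move=> hn he1 hp he2 hm hN; have hn3 := long3 hn; have hp3 := long3 hp.
have [d0' d1'] : 0 <= 1 - d /\ 1 - d <= 1 by rewrite subr_ge0 gerBl !ltW.
pose g a b := nu (n.*2 - a) 0 a * (nu (p.*2 - a - b) a b * nu (m.*2 - b) b 0).
have g0 a b : 0 <= g a b by rewrite !mulr_ge0 ?nu_ge0.
pose kap := ((1 - d) * catalan e1) * ((1 - d) * catalan e2).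
have hk1 k : 0 <= (1 - d) * catalan k <= 1.
  by rewrite mulr_ge0 ?catalan_ge0 //= mulr_ile1 ?catalan_ge0 ?catalan_le1.
have /andP[k0 k1] : 0 <= kap <= 1.
  have /andP[? ?] := hk1 e1; have /andP[? ?] := hk1 e2.
  by rewrite mulr_ge0 //= mulr_ile1.
have h1 : kap * (\sum_(a < A.+1) \sum_(b < A.+1) g a b) <= disjoint_sum n e1 p e2 m.
  pose f a b := nu (p.*2 - a - b) a b * (catalan (e2 + b) * nu (m.*2 - b) b 0).
  have f0 a b : 0 <= f a b by rewrite !mulr_ge0 ?nu_ge0.
  apply: le_trans (_ : \sum_(a < A.+1) nu (n.*2 - a) 0 a *
     (catalan (e1 + a) * (\sum_(b < p.+1) f a b)) <= _); last first.
    apply: (@ler_sum_ord _ (fun a => nu (n.*2 - a) 0 a *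
      (catalan (e1 + a) * (\sum_(b < p.+1) f a b)))).
      by clear -hn3 hp3 hM; lia.
    by move=> a; rewrite !mulr_ge0 ?nu_ge0 ?sumr_ge0.
  rewrite mulr_sumr; apply: ler_sum => a _.
  rewrite /g -mulr_sumr mulrCA ler_wpM2l ?nu_ge0 //.
  rewrite /kap -[leLHS](mulrA ((1 - d) * catalan e1)).
  have ha := ltn_ord a.
  apply: ler_pM.
  - by have /andP[] := hk1 e1.
  - by rewrite mulr_ge0 ?(andP (hk1 e2)).1 // sumr_ge0 // => b _; rewrite mulr_ge0 ?nu_ge0.
  - by apply: catalan_close => //; clear -ha; lia.
  apply: le_trans (_ : \sum_(b < A.+1) f a b <= _); last first.
    by apply: ler_sum_ord => //; clear -hp3 hM; lia.
  rewrite mulr_sumr; apply: ler_sum => b _; rewrite /f.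
  rewrite mulrCA ler_wpM2l ?nu_ge0 // ler_wpM2r ?nu_ge0 //.
  by apply: catalan_close => //; have := ltn_ord b; clear; lia.
apply: le_trans h1.
(* The first splice leaves a walk of half-length r instead of n + p. *)
pose r := (n + p - A.*2)%N.
have hr : long r by apply: (long_le hn); clear -hp3 hM; rewrite /r; lia.
have h2 : (1 - d) ^+ 2 * (2 * splice r m A.+1 - A.+1%:R * (8 * n%:R * tau)) <=
    \sum_(a < A.+1) \sum_(b < A.+1) g a b.
  rewrite exchange_big /=.
  pose y := 8 * n%:R * tau; have y0 : 0 <= y by rewrite /y !mulr_ge0.
  rewrite [leLHS](_ : _ = \sum_(b < A.+1)
      (1 - d) ^+ 2 * (2 * (nu (r.*2 - b) 0 b * nu (m.*2 - b) b 0) - y)); last first.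
    by rewrite -mulr_sumr sumrB -mulr_sumr sumr_const card_ord -[y *+ _]mulr_natl.
  apply: ler_sum => b _; have hb := ltn_ord b.
  have := @merge_lower R d M n p A b d0 (ltW d1) hn hp.
  move=> /(_ _ tau A0); rewrite -/r -/y => h.
  apply: le_trans (_ : (\sum_(a < A.+1) nu (n.*2 - a) 0 a * nu (p.*2 - a - b) a b) *
    nu (m.*2 - b) b 0 <= _); last first.
    by rewrite mulr_suml; apply: ler_sum => a _; rewrite /g mulrA.
  apply: le_trans (ler_wpM2r (nu_ge0 _ _ _ _) (h _ _)).
  - rewrite -[leRHS]mulrA ler_wpM2l ?sqr_ge0 // mulrBl mulrA lerD2l lerN2.
    by rewrite -[leRHS]mulr1 ler_wpM2l ?nu_le1.
  - by clear -hM hb; lia.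
  - by move=> t a ht ha; apply: (htau _ ha).1; clear -ht hN; lia.
have hrN : (r <= N)%N by clear -hN; rewrite /r; lia.
have h3 := splice_lower hr hm hrN.
have hcd : catalan (n + p + m) <= catalan (r + m).
  by apply: catalan_decr; clear; rewrite /r; lia.
have p0 : 0 <= (1 - d) ^+ 2 by rewrite sqr_ge0.
have p1 : (1 - d) ^+ 2 <= 1 by rewrite exprn_ile1.
have h4 := le_trans (ler_wpM2l k0 (ler_wpM2l p0 (lerB (ler_wpM2l (ler0n R 2) h3)
  (lexx (A.+1%:R * (8 * n%:R * tau)))))) (ler_wpM2l k0 h2).
apply: le_trans h4.
set c := catalan (n + p + m) in hcd *; have c0 : 0 <= c by exact: catalan_ge0.
pose E := 100 * N%:R ^+ 2 * tau.
have hAN : (A < n)%N by clear -hn3 hM; lia.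
have hE : 2 * (8 * N%:R * tau) + A.+1%:R * (8 * n%:R * tau) <= E.
  have e1' : A.+1%:R * n%:R <= N%:R * N%:R :> R.
    by rewrite -!natrM ler_nat; apply: leq_mul; clear -hAN hN; lia.
  have e2' : N%:R <= N%:R * N%:R :> R.
    by rewrite -!natrM ler_nat; clear -hAN hN; nia.
  have := ler_wpM2r t0 e1'; have := ler_wpM2r t0 e2'.
  have := mulr_ge0 (mulr_ge0 (ler0n R N) (ler0n R N)) t0.
  rewrite /E expr2; lra.
set z := A.+1%:R * _ in hE *; have z0 : 0 <= z by rewrite /z !mulr_ge0.
set y := 8 * N%:R * tau in hE *; have y0 : 0 <= y by rewrite /y !mulr_ge0.
have -> : (1 - d) ^+ 6 * (4 * catalan e1 * catalan e2 * c) =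
  kap * (1 - d) ^+ 2 * (1 - d) ^+ 2 * (4 * c) by rewrite /kap; ring.
have q0 : 0 <= kap * (1 - d) ^+ 2 by rewrite mulr_ge0.
have q1 : kap * (1 - d) ^+ 2 <= 1 by rewrite mulr_ile1.
have q20 : 0 <= kap * (1 - d) ^+ 2 * (1 - d) ^+ 2 by rewrite mulr_ge0.
have q21 : kap * (1 - d) ^+ 2 * (1 - d) ^+ 2 <= 1 by rewrite mulr_ile1.
have i1 := ler_wpM2l q20 hcd; have i2 := ler_wpM2r z0 q1.
have i3 := ler_wpM2r y0 q21.
rewrite -/E; move: (catalan (r + m)) i1 => cr i1.
rewrite [leRHS](_ : _ = kap * (1 - d) ^+ 2 * (1 - d) ^+ 2 * (4 * cr)
  - 2 * (kap * (1 - d) ^+ 2 * (1 - d) ^+ 2 * y) - kap * (1 - d) ^+ 2 * z); last by ring.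
lra.
Qed.

(** Outside the square of heights up to [A] each term is at most [tau], because the walk
    has to climb to [a] from 0 or to come down from [b] to 0. *)
Lemma disjoint_upper n e1 p e2 m : long n -> long p -> long m ->
  (n <= N)%N -> (p <= N)%N -> (m <= N)%N ->
  (1 - d) ^+ 4 * disjoint_sum n e1 p e2 m <=
  4 * catalan e1 * catalan e2 * catalan (n + p + m) + 2 * N.+1%:R ^+ 2 * tau.
Proof.
move=> hn hp hm hnN hpN hmN; have hn3 := long3 hn; have hp3 := long3 hp.
have [d0' d1'] : 0 <= 1 - d /\ 1 - d <= 1 by rewrite subr_ge0 gerBl !ltW.
pose g a b := nu (n.*2 - a) 0 a * (nu (p.*2 - a - b) a b * nu (m.*2 - b) b 0).
have g0 a b : 0 <= g a b by rewrite !mulr_ge0 ?nu_ge0.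
pose kap := catalan e1 * catalan e2.
have k0 : 0 <= kap by rewrite mulr_ge0 ?catalan_ge0.
have k1 : kap <= 1 by rewrite mulr_ile1 ?catalan_ge0 ?catalan_le1.
pose s := (minn n p).+1.
have h1 : disjoint_sum n e1 p e2 m <= kap * (\sum_(a < s) \sum_(b < p.+1) g a b).
  rewrite mulr_sumr; apply: ler_sum => a _.
  rewrite /g -[X in _ <= _ * X]mulr_sumr [leRHS]mulrCA ler_wpM2l ?nu_ge0 // /kap.
  rewrite -[leRHS](mulrA (catalan e1)); apply: ler_pM.
  - exact: catalan_ge0.
  - by rewrite sumr_ge0 // => b _; rewrite !mulr_ge0 ?nu_ge0.
  - by apply: catalan_decr; rewrite leq_addr.
  rewrite mulr_sumr; apply: ler_sum => b _.
  rewrite [leRHS]mulrCA ler_wpM2l ?nu_ge0 // ler_wpM2r ?nu_ge0 //.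
  by apply: catalan_decr; rewrite leq_addr.
have ga a b : (A < a)%N -> g a b <= tau.
  move=> ha; rewrite -[tau]mulr1; apply: ler_pM; rewrite ?mulr_ge0 ?nu_ge0 //.
    by apply: (htau _ ha).1; clear -hnN; lia.
  by rewrite mulr_ile1 ?nu_ge0 ?nu_le1.
have gb a b : (A < b)%N -> g a b <= tau.
  move=> hb; rewrite /g mulrA -[tau]mul1r; apply: ler_pM; rewrite ?mulr_ge0 ?nu_ge0 //.
    by rewrite mulr_ile1 ?nu_ge0 ?nu_le1.
  by apply: (htau _ hb).2; clear -hmN; lia.
have hAp : (A < p.+1)%N by clear -hp3 hM; lia.
have hAs : (A < s)%N by clear -hp3 hn3 hM; rewrite /s; lia.
have h2 : \sum_(a < s) \sum_(b < p.+1) g a b <=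
    \sum_(a < A.+1) \sum_(b < A.+1) g a b + 2 * (N.+1%:R ^+ 2 * tau).
  apply: le_trans (_ : \sum_(a < s) (\sum_(b < A.+1) g a b + p.+1%:R * tau) <= _).
    by apply: ler_sum => a _; exact: (@ler_sum_tail R (g a) A.+1 p.+1 tau hAp t0 (gb a)).
  rewrite big_split /= sumr_const card_ord -[X in _ + X]mulr_natl.
  have hf a : (A < a)%N -> \sum_(b < A.+1) g a b <= A.+1%:R * tau.
    move=> ha; apply: le_trans (_ : \sum_(b < A.+1) tau <= _).
      by apply: ler_sum => b _; exact: ga.
    by rewrite sumr_const card_ord mulr_natl.
  have := @ler_sum_tail R (fun a => \sum_(b < A.+1) g a b) A.+1 s _ hAs
    (mulr_ge0 (ler0n R A.+1) t0) hf.
  have l1 : s%:R * (p.+1%:R * tau) <= N.+1%:R ^+ 2 * tau.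
    rewrite mulrA ler_wpM2r // expr2 -!natrM ler_nat; apply: leq_mul => //.
    by clear -hnN; rewrite /s; lia.
  have l2 : s%:R * (A.+1%:R * tau) <= N.+1%:R ^+ 2 * tau.
    rewrite mulrA ler_wpM2r // expr2 -!natrM ler_nat; apply: leq_mul => //.
      by clear -hnN; rewrite /s; lia.
    by clear -hAp hpN; lia.
  lra.
have h3 : (1 - d) ^+ 4 * (\sum_(a < A.+1) \sum_(b < A.+1) g a b) <=
    4 * catalan (n + p + m).
  have h4 : (1 - d) ^+ 2 * (\sum_(a < A.+1) \sum_(b < A.+1) g a b) <=
     2 * splice (n + p) m A.+1.
    rewrite exchange_big /= !mulr_sumr; apply: ler_sum => b _; have hb := ltn_ord b.
    have := @merge_upper R d M n p A b d0 (ltW d1) hn hp.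
    move=> /(_ _) h.
    rewrite [leRHS]mulrA; apply: le_trans (ler_wpM2r (nu_ge0 _ _ _ _) (h _)).
      rewrite -[leRHS]mulrA ler_wpM2l ?sqr_ge0 // mulr_suml.
      by apply: ler_sum => a _; rewrite /g mulrA.
    by clear -hM hb; lia.
  have hnp : long (n + p) by apply: (long_le hn); rewrite leq_addr.
  have h5 := splice_upper hnp hm.
  have := ler_wpM2l (sqr_ge0 (1 - d)) h4.
  rewrite mulrA -exprD; lra.
have q0 : 0 <= (1 - d) ^+ 4 by rewrite exprn_ge0.
have q1 : (1 - d) ^+ 4 <= 1 by rewrite exprn_ile1.
have h4 := ler_wpM2l q0 h1; apply: le_trans h4 _.
have h5 := ler_wpM2l k0 (ler_wpM2l q0 h2).
rewrite mulrCA; apply: le_trans h5 _.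
have h6 := ler_wpM2l k0 h3.
set x := N.+1%:R ^+ 2 * tau; have x0 : 0 <= x by rewrite mulr_ge0 ?sqr_ge0.
have h7 : kap * (1 - d) ^+ 4 * x <= x.
  by rewrite -[leRHS]mul1r ler_wpM2r // mulr_ile1.
rewrite -[2 * _ * tau]mulrA -/x -/kap -[4 * _ * _]mulrA -/kap; lra.
Qed.
End Bounds.
End Sums.

(** * Asymptotics of the three sums *)

Section Asymptotics.
Variable R : realType.
Local Notation catalan := (catalan R).

Lemma near_nat_ge (x : R) : \forall N \near \oo, x <= N%:R.
Proof.
near=> N; apply: le_trans (_ : (Num.truncn `|x|).+1%:R <= _).
  by apply: le_trans (ler_norm x) (ltW _); exact: truncnS_gt.
by rewrite ler_nat; near: N; exact: nbhs_infty_ge.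
Unshelve. all: by end_near. Qed.

(** It suffices to bracket [T] up to factors [(1 - d) ^ 6], for every [d], and up to an
    error smaller than the main term by a factor [N]. *)
Lemma ratio_cvg1 (T X : nat -> R) (c : R) : 0 < c ->
  (forall N, 0 <= T N) ->
  (\forall N \near \oo, c / N%:R ^+ 6 <= X N) ->
  (forall d, 0 < d -> d < 1 -> exists2 C, 0 < C & \forall N \near \oo,
     (1 - d) ^+ 6 * X N - C / N%:R ^+ 7 <= T N /\
     (1 - d) ^+ 6 * T N <= X N + C / N%:R ^+ 7) ->
  T N / X N @[N --> \oo] --> (1 : R).
Proof.
move=> c0 T0 hX hT; apply/cvgrPdist_le => eps eps0.
pose e := Num.min eps 1; have e0 : 0 < e by rewrite lt_min eps0 ltr01.
have ee : e <= eps by rewrite ge_min lexx.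
have e1 : e <= 1 by rewrite ge_min lexx orbT.
(* (1 - d)^6 is then at least 1 - e/4; the other quarters of e absorb the error term. *)
pose d := e / 24; have d0 : 0 < d by rewrite divr_gt0.
have d1 : d < 1 by rewrite /d; lra.
have [C C0 hC] := hT d d0 d1.
near=> N.
have N1 : 1 <= N%:R :> R by near: N; exact: near_nat_ge.
have N0 : 0 < N%:R :> R by lra.
have XN : c / N%:R ^+ 6 <= X N by near: N.
have X0 : 0 < X N by apply: lt_le_trans XN; rewrite divr_gt0 // exprn_gt0.
have [h1 h2] : (1 - d) ^+ 6 * X N - C / N%:R ^+ 7 <= T N /\
     (1 - d) ^+ 6 * T N <= X N + C / N%:R ^+ 7 by near: N.
have hN : 4 * C / (c * e) <= N%:R by near: N; exact: near_nat_ge.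
have hE : C / N%:R ^+ 7 <= e / 4 * X N.
  apply: le_trans (_ : e / 4 * (c / N%:R ^+ 6) <= _); last by rewrite ler_wpM2l //; lra.
  rewrite (exprS _ 6) ler_pdivrMr ?mulr_gt0 ?exprn_gt0 //.
  rewrite ler_pdivrMr ?mulr_gt0 // in hN.
  rewrite [leRHS](_ : _ = e * c * N%:R / 4); first by lra.
  by field; rewrite gt_eqF.
have hd : 1 - e / 4 <= (1 - d) ^+ 6.
  have b k : 1 - k%:R * d <= (1 - d) ^+ k.
    elim: k => [|k IH]; first by rewrite mul0r subr0 expr0.
    have k0 : 0 <= k%:R :> R by [].
    have d1' : 0 <= 1 - d by lra.
    have g2 := ler_wpM2l d1' IH; have g3 := mulr_ge0 k0 (mulr_ge0 (ltW d0) (ltW d0)).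
    by rewrite exprS -natr1; apply: le_trans g2; lra.
  by apply: le_trans (b 6); rewrite /d; lra.
have l1 : (1 - e / 2) * X N <= T N.
  by have := ler_wpM2r (ltW X0) hd; lra.
have l2 : T N <= (1 + e) * X N.
  have g1 := ler_wpM2r (T0 N) hd.
  have g2 : (1 - e / 4) * T N <= (1 + e / 4) * X N by lra.
  have p : 0 < 1 - e / 4 by lra.
  rewrite -(ler_pM2l p); apply: le_trans g2 _; rewrite mulrA ler_wpM2r ?(ltW X0) //.
  by nra.
rewrite ler_distlC; apply/andP; split.
  by rewrite ler_pdivlMr //; apply: le_trans l1; rewrite ler_wpM2r ?(ltW X0) //; lra.
by rewrite ler_pdivrMr //; apply: le_trans l2 _; rewrite ler_wpM2r ?(ltW X0) //; lra.
Unshelve. all: by end_near. Qed.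

(** Heights up to [A] and shifts up to [M] are small at scale [d * eta * N], whereas heights
    above [A] have probability at most [tau]. *)
Definition scaled (d eta : R) (N A M : nat) (tau : R) :=
  [/\ (3 * A + 2 <= M)%N, (0 < A)%N, 0 <= tau <= 1,
    3 * M%:R <= d * (eta * N%:R) &
    forall t a, (t <= N.*2)%N -> (A < a)%N ->
       nu R t 0 a <= tau /\ nu R t a 0 <= tau].

(** The choice [A = 10 (N / q)] with [q] of order [1 / (d * eta)]; then [nu_tail] makes
    [tau] of order [N ^ (- 9)]. *)
Lemma near_scales (d eta : R) : 0 < d -> d < 1 -> 0 < eta ->
  exists2 C : R, 0 < C & \forall N \near \oo, exists A M tau,
    scaled d eta N A M tau /\ N%:R ^+ 2 * tau <= C / N%:R ^+ 7.
Proof.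
move=> d0 d1 eta0; have de0 : 0 < d * eta by rewrite mulr_gt0.
(* 3 M = 90 (N / q) + 6, and each of the two terms is at most d eta N / 2. *)
pose q := (Num.truncn (180 / (d * eta))).+1.
have hq : 180 / (d * eta) <= q%:R by apply/ltW; exact: truncnS_gt.
have [C C0 hC] := @nu_tail R q isT.
exists C => //; near=> N; exists (10 * (N %/ q))%N, (3 * (10 * (N %/ q)) + 2)%N.
exists (C / N.+1%:R ^+ 9).
have N1 : 1 <= N%:R :> R by near: N; exact: near_nat_ge.
have N0 : 0 < N%:R :> R by lra.
have NS0 : 0 < N.+1%:R :> R by rewrite ltr0n.
split; last first.
  rewrite mulrCA ler_pM2l // ler_pdivrMr ?exprn_gt0 // ler_pdivlMl ?exprn_gt0 //.
  by rewrite -exprD lerXn2r ?nnegrE // ler_nat.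
split => //.
- have : (q <= N)%N by near: N; exact: nbhs_infty_ge.
  by rewrite muln_gt0 /= divn_gt0.
- rewrite divr_ge0 ?exprn_ge0 ?(ltW C0) //= ler_pdivrMr ?exprn_gt0 // mul1r.
  have : C <= N%:R by near: N; exact: near_nat_ge.
  move=> /le_trans; apply; apply: le_trans (_ : N.+1%:R <= _); first by rewrite ler_nat.
  by rewrite exprS ler_peMr // exprn_ege1 // ler1n.
- rewrite natrD natrM natrM.
  have h6 : 12 / (d * eta) <= N%:R by near: N; exact: near_nat_ge.
  rewrite ler_pdivrMr // in h6.
  have hNq : (N %/ q)%:R * q%:R <= N%:R :> R by rewrite -natrM ler_nat leq_trunc_div.
  rewrite ler_pdivrMr // in hq.
  have hK : 180 * (N %/ q)%:R <= (d * eta) * N%:R.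
    have g1 := ler_wpM2r (ler0n R (N %/ q)) hq.
    have g2 := ler_wpM2l (ltW de0) hNq; lra.
  lra.
- by move=> t a; exact: hC.
Unshelve. all: by end_near. Qed.

Lemma catalan_ge N n : (0 < N)%N -> (n <= N)%N -> 6^-1 / N%:R ^+ 2 <= catalan n.
Proof.
move=> N0 hn; have N0' : 0 < N%:R :> R by rewrite ltr0n.
rewrite -invfM -[leLHS]mulr1 ler_pdivrMl ?mulr_gt0 ?exprn_gt0 //.
apply: le_trans (catalan_lower R n) _; rewrite ler_wpM2r ?catalan_ge0 //.
rewrite -natrX -natrM ler_nat; nia.
Qed.

(** Common frame of the three asymptotic statements: [good] collects the size conditions on
    the indices, and the bounds are those of the previous part. *)
Lemma asymp_of_bounds (eta : R) (T X : nat -> R) (good : nat -> Prop) (c : R) :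
  0 < eta -> 0 < c -> (forall N, 0 <= T N) -> (\forall N \near \oo, good N) ->
  (forall N, (0 < N)%N -> good N -> c / N%:R ^+ 6 <= X N) ->
  (forall d N A M tau, 0 < d -> d < 1 -> (0 < N)%N -> good N ->
     scaled d eta N A M tau ->
     (1 - d) ^+ 6 * X N - 100 * (N%:R ^+ 2 * tau) <= T N /\
     (1 - d) ^+ 6 * T N <= X N + 100 * (N%:R ^+ 2 * tau)) ->
  T N / X N @[N --> \oo] --> (1 : R).
Proof.
move=> eta0 c0 T0 hgood hX hT; apply: (ratio_cvg1 c0 T0).
  near=> N; apply: hX; last by near: N.
  by near: N; exact: nbhs_infty_ge.
move=> d d0 d1; have [C C0 hC] := near_scales d0 d1 eta0.
exists (100 * C); first by rewrite mulr_gt0.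
near=> N.
have N0 : (0 < N)%N by near: N; exact: nbhs_infty_ge.
have hN : good N by near: N.
have [A [M [tau [hs ht]]]] : exists A M tau,
    scaled d eta N A M tau /\ N%:R ^+ 2 * tau <= C / N%:R ^+ 7 by near: N.
have [h1 h2] := hT d N A M tau d0 d1 N0 hN hs.
rewrite -mulrA; split; lra.
Unshelve. all: by end_near. Qed.

Lemma powers_close (d x : R) k : 0 < d -> d < 1 -> 0 <= x -> (k <= 6)%N ->
  (1 - d) ^+ 6 * x <= (1 - d) ^+ k * x.
Proof. by move=> d0 d1 x0 hk; rewrite ler_wpM2r // ler_wiXn2l //; lra. Qed.

Lemma natr_le_sqr N : (0 < N)%N -> N%:R <= N%:R ^+ 2 :> R /\ N.+1%:R <= 2 * N%:R ^+ 2 :> R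
  /\ N.+1%:R ^+ 2 <= 4 * N%:R ^+ 2 :> R.
Proof. by move=> N0; rewrite -!natrX -!natrM !ler_nat; do ?split; nia. Qed.

Section Sequences.
Variable eta : R.
Hypothesis eta0 : 0 < eta.

(** One splice, hence one factor 2. *)
Lemma one_arc_asymp (n e m : nat -> nat) :
  (\forall N \near \oo, [/\ eta * N%:R <= (n N)%:R, eta * N%:R <= (e N)%:R,
     eta * N%:R <= (m N)%:R & (n N + e N + m N <= N)%N]) ->
  one_arc R (n N) (e N) (m N) / (2 * catalan (e N) * catalan (n N + m N))
    @[N --> \oo] --> (1 : R).
Proof.
move=> hl; apply: (asymp_of_bounds (c := 18^-1) eta0 _ _ hl); first by rewrite invr_gt0.
- by move=> N; rewrite sumr_ge0 // => a _; rewrite !mulr_ge0 ?nu_ge0 ?catalan_ge0.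
- move=> N N0 [_ _ _ hN].
  have N0' : 0 < N%:R :> R by rewrite ltr0n.
  have N1' : 1 <= N%:R :> R by rewrite ler1n.
  apply: le_trans (_ : 2 * (6^-1 / N%:R ^+ 2) * (6^-1 / N%:R ^+ 2) <= _).
    rewrite [leRHS](_ : _ = 18^-1 / N%:R ^+ 4); last by field; rewrite gt_eqF.
    rewrite ler_pM2l ?invr_gt0 // lef_pV2 ?posrE ?exprn_gt0 //.
    by rewrite ler_weXn2l.
  have k0 : 0 <= 6^-1 / N%:R ^+ 2 :> R by rewrite divr_ge0 ?invr_ge0 ?exprn_ge0.
  have hc k : (k <= N)%N -> 6^-1 / N%:R ^+ 2 <= catalan k by exact: catalan_ge.
  move: (6^-1 / _) k0 hc => k k0 hc.
  have [hn he] : (n N + m N <= N)%N /\ (e N <= N)%N by clear -hN; lia.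
  by apply: (ler_pM _ k0 _ (hc _ hn)); rewrite ?mulr_ge0 ?ler_pM2l // hc.
move=> d N A M tau d0 d1 N0 [hn he hm hN] [hM A0 /andP[t0 t1] hlong htau].
have hL k : eta * N%:R <= k%:R -> long d M k.
  by move=> hk; apply: le_trans hlong _; rewrite ler_pM2l.
have hnN : (n N <= N)%N by clear -hN; lia.
have lo := one_arc_lower d0 d1 hM A0 t0 htau (hL _ hn) (hL _ he) (hL _ hm) hnN.
have up := one_arc_upper d0 d1 hM t0 htau (e N) (hL _ hn) (hL _ hm) hnN.
have X0 : 0 <= 2 * catalan (e N) * catalan (n N + m N) by rewrite !mulr_ge0 ?catalan_ge0.
have T0 : 0 <= one_arc R (n N) (e N) (m N).
  by rewrite sumr_ge0 // => a _; rewrite !mulr_ge0 ?nu_ge0 ?catalan_ge0.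
have [/(ler_wpM2r t0) q1 [/(ler_wpM2r t0) q2 _]] := natr_le_sqr N0.
have q3 : (n N).+1%:R * tau <= N.+1%:R * tau by rewrite ler_wpM2r // ler_nat.
have q0 : 0 <= N%:R ^+ 2 * tau by rewrite mulr_ge0 ?sqr_ge0.
have := @powers_close d _ 3 d0 d1 X0 isT; have := @powers_close d _ 2 d0 d1 T0 isT.
split; lra.
Qed.

(** Two independent splices, hence a factor 4. *)
Lemma nested_asymp (n n' e m' m : nat -> nat) :
  (\forall N \near \oo, [/\ eta * N%:R <= (n N)%:R, eta * N%:R <= (n' N)%:R,
     eta * N%:R <= (e N)%:R, eta * N%:R <= (m' N)%:R &
     eta * N%:R <= (m N)%:R /\ (n N + n' N + e N + m' N + m N <= N)%N]) ->
  nested_sum R (n N) (n' N) (e N) (m' N) (m N) /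
     (4 * catalan (e N) * catalan (n' N + m' N) * catalan (n N + m N))
    @[N --> \oo] --> (1 : R).
Proof.
move=> hl; apply: (asymp_of_bounds (c := 54^-1) eta0 _ _ hl); first by rewrite invr_gt0.
- move=> N; rewrite sumr_ge0 // => a _; rewrite !mulr_ge0 ?nu_ge0 // sumr_ge0 // => b _.
  by rewrite !mulr_ge0 ?nu_ge0 ?catalan_ge0.
- move=> N N0 [_ _ _ _ [_ hN]].
  have N0' : 0 < N%:R :> R by rewrite ltr0n.
  have k0 : 0 <= 6^-1 / N%:R ^+ 2 :> R by rewrite divr_ge0 ?invr_ge0 ?exprn_ge0.
  apply: le_trans (_ : 4 * (6^-1 / N%:R ^+ 2) * (6^-1 / N%:R ^+ 2) * (6^-1 / N%:R ^+ 2) <= _).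
    rewrite [leRHS](_ : _ = 54^-1 / N%:R ^+ 6) //; field; rewrite gt_eqF //.
  have hc k : (k <= N)%N -> 6^-1 / N%:R ^+ 2 <= catalan k by exact: catalan_ge.
  move: (6^-1 / _) k0 hc => k k0 hc.
  have [g1 g2 g3] : [/\ (e N <= N)%N, (n' N + m' N <= N)%N & (n N + m N <= N)%N].
    by clear -hN; split; lia.
  apply: (ler_pM _ k0 _ (hc _ g3)); rewrite ?mulr_ge0 //.
  by apply: (ler_pM _ k0 _ (hc _ g2)); rewrite ?mulr_ge0 ?ler_pM2l // hc.
move=> d N A M tau d0 d1 N0 [hn hn' he hm' [hm hN]] [hM A0 /andP[t0 t1] hlong htau].
have hL k : eta * N%:R <= k%:R -> long d M k.
  by move=> hk; apply: le_trans hlong _; rewrite ler_pM2l.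
have hnN : (n N <= N)%N by clear -hN; lia.
have hnN' : (n' N <= N)%N by clear -hN; lia.
have lo := nested_lower d0 d1 hM A0 t0 htau (hL _ hn) (hL _ hn') (hL _ he) (hL _ hm') (hL _ hm) hnN hnN'.
have up := nested_upper d0 d1 hM t0 htau (e N) t1 (hL _ hn) (hL _ hn') (hL _ hm') (hL _ hm) hnN hnN'.
set X := 4 * _ * _ * _ in lo up *; set T := nested_sum _ _ _ _ _ _ in lo up *.
have X0 : 0 <= X by rewrite !mulr_ge0 ?catalan_ge0.
have T0 : 0 <= T.
  rewrite sumr_ge0 // => a _; rewrite !mulr_ge0 ?nu_ge0 // sumr_ge0 // => b _.
  by rewrite !mulr_ge0 ?nu_ge0 ?catalan_ge0.
have [/(ler_wpM2r t0) q1 [_ /(ler_wpM2r t0) q2]] := natr_le_sqr N0.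
have q0 : 0 <= N%:R ^+ 2 * tau by rewrite mulr_ge0 ?sqr_ge0.
have := @powers_close d _ 5 d0 d1 X0 isT; have := @powers_close d _ 4 d0 d1 T0 isT.
split; lra.
Qed.

(** Two successive splices, hence again a factor 4, but a single Catalan number for the
    three pieces outside the arcs. *)
Lemma disjoint_asymp (n e1 p e2 m : nat -> nat) :
  (\forall N \near \oo, [/\ eta * N%:R <= (n N)%:R, eta * N%:R <= (e1 N)%:R,
     eta * N%:R <= (p N)%:R, eta * N%:R <= (e2 N)%:R &
     eta * N%:R <= (m N)%:R /\ (n N + e1 N + p N + e2 N + m N <= N)%N]) ->
  disjoint_sum R (n N) (e1 N) (p N) (e2 N) (m N) /
     (4 * catalan (e1 N) * catalan (e2 N) * catalan (n N + p N + m N))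
    @[N --> \oo] --> (1 : R).
Proof.
move=> hl; apply: (asymp_of_bounds (c := 54^-1) eta0 _ _ hl); first by rewrite invr_gt0.
- move=> N; rewrite sumr_ge0 // => a _; rewrite !mulr_ge0 ?nu_ge0 ?catalan_ge0 //.
  by rewrite sumr_ge0 // => b _; rewrite !mulr_ge0 ?nu_ge0 ?catalan_ge0.
- move=> N N0 [_ _ _ _ [_ hN]].
  have N0' : 0 < N%:R :> R by rewrite ltr0n.
  have k0 : 0 <= 6^-1 / N%:R ^+ 2 :> R by rewrite divr_ge0 ?invr_ge0 ?exprn_ge0.
  apply: le_trans (_ : 4 * (6^-1 / N%:R ^+ 2) * (6^-1 / N%:R ^+ 2) * (6^-1 / N%:R ^+ 2) <= _).
    rewrite [leRHS](_ : _ = 54^-1 / N%:R ^+ 6) //; field; rewrite gt_eqF //.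
  have hc k : (k <= N)%N -> 6^-1 / N%:R ^+ 2 <= catalan k by exact: catalan_ge.
  move: (6^-1 / _) k0 hc => k k0 hc.
  have [g1 g2 g3] : [/\ (e1 N <= N)%N, (e2 N <= N)%N & (n N + p N + m N <= N)%N].
    by clear -hN; split; lia.
  apply: (ler_pM _ k0 _ (hc _ g3)); rewrite ?mulr_ge0 //.
  by apply: (ler_pM _ k0 _ (hc _ g2)); rewrite ?mulr_ge0 ?ler_pM2l // hc.
move=> d N A M tau d0 d1 N0 [hn he1 hp he2 [hm hN]] [hM A0 /andP[t0 t1] hlong htau].
have hL k : eta * N%:R <= k%:R -> long d M k.
  by move=> hk; apply: le_trans hlong _; rewrite ler_pM2l.
have hnp : (n N + p N <= N)%N by clear -hN; lia.
have hnN : (n N <= N)%N by clear -hN; lia.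
have hpN : (p N <= N)%N by clear -hN; lia.
have hmN : (m N <= N)%N by clear -hN; lia.
have lo := disjoint_lower d0 d1 hM A0 t0 htau (hL _ hn) (hL _ he1) (hL _ hp) (hL _ he2) (hL _ hm) hnp.
have up := disjoint_upper d0 d1 hM t0 htau (e1 N) (e2 N) (hL _ hn) (hL _ hp) (hL _ hm) hnN hpN hmN.
set X := 4 * _ * _ * _ in lo up *; set T := disjoint_sum _ _ _ _ _ _ in lo up *.
have T0 : 0 <= T.
  rewrite sumr_ge0 // => a _; rewrite !mulr_ge0 ?nu_ge0 ?catalan_ge0 //.
  by rewrite sumr_ge0 // => b _; rewrite !mulr_ge0 ?nu_ge0 ?catalan_ge0.
have [_ [_ /(ler_wpM2r t0) q2]] := natr_le_sqr N0.
have q0 : 0 <= N%:R ^+ 2 * tau by rewrite mulr_ge0 ?sqr_ge0.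
have := @powers_close d _ 4 d0 d1 T0 isT.
split; lra.
Qed.
End Sequences.
End Asymptotics.

(** * The constant, by Wallis' integrals *)

Section Wallis.
Variable R : realType.
Local Notation mu := (@lebesgue_measure R).

Definition wallis (k : nat) : R := \int[mu]_(x in `[0, pi / 2]) (cos x ^+ k).

Let pihalf_gt0 : 0 < pi / 2 :> R. Proof. by rewrite divr_gt0 ?pi_gt0. Qed.

Lemma continuous_cosX k : continuous (fun x : R => cos x ^+ k).
Proof.
move=> x; apply: (@continuous_comp _ _ _ (@cos R) (fun y => y ^+ k)).
  exact: continuous_cos.
exact: exprn_continuous.
Qed.

Lemma integrable_cosX k : mu.-integrable `[0, pi / 2] (EFin \o (fun x : R => cos x ^+ k)).
Proof.
apply: continuous_compact_integrable; first exact: segment_compact.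
exact/continuous_subspaceT/continuous_cosX.
Qed.

Lemma Rintegral_FTC (f F : R -> R) : continuous f -> continuous F ->
  (forall x : R, is_derive x (1 : R) F (f x)) ->
  \int[mu]_(x in `[0, pi / 2]) f x = F (pi / 2) - F 0.
Proof.
move=> cf cF dF; rewrite /Rintegral (@continuous_FTC2 _ f F) //.
- exact/continuous_subspaceT.
- split=> [x _| |]; first by case: (dF x).
    by apply: cvg_at_right_filter; exact: cF.
  by apply: cvg_at_left_filter; exact: cF.
- by move=> x _; rewrite derive1E; case: (dF x).
Qed.

Lemma wallis0 : wallis 0 = pi / 2.
Proof.
rewrite /wallis (@Rintegral_FTC _ (@id R)) ?subr0 //.
- exact: (@continuous_cosX 0).
- by move=> x; exact: cvg_id.
Qed.

Lemma wallis1 : wallis 1 = 1.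
Proof.
rewrite /wallis (@Rintegral_FTC _ (@sin R)) ?sin_pihalf ?sin0 ?subr0 //.
- exact: (@continuous_cosX 1).
- exact: continuous_sin.
Qed.

(** Fundamental theorem of calculus for [sin x * cos x ^ (k + 1)], which vanishes at both
    ends and has derivative [(k + 2) cos x ^ (k + 2) - (k + 1) cos x ^ k]. *)
Lemma wallisSS k : k.+2%:R * wallis k.+2 = k.+1%:R * wallis k.
Proof.
apply/eqP; rewrite -subr_eq0; apply/eqP.
rewrite /wallis -!RintegralZl //; try exact: integrable_cosX.
have hi c j : mu.-integrable `[0, pi / 2] (EFin \o (fun x : R => c * cos x ^+ j)).
  apply: continuous_compact_integrable; first exact: segment_compact.
  by apply/continuous_subspaceT => x; apply: cvgM; [exact: cvg_cst|exact: continuous_cosX].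
rewrite -RintegralB //.
pose F := (@sin R) * ((@cos R) ^+ k.+1).
pose f (x : R) := k.+2%:R * cos x ^+ k.+2 - k.+1%:R * cos x ^+ k.
have cf : continuous f.
  move=> x; apply: cvgB; apply: cvgM; (exact: cvg_cst || exact: continuous_cosX).
have FE x : F x = sin x * cos x ^+ k.+1.
  by rewrite /F; congr (_ * _); elim: (k.+1) => [|j IH] //; rewrite !exprS -IH.
have cF : continuous F.
  rewrite (_ : F = fun x => sin x * cos x ^+ k.+1); last exact/funext.
  by move=> x; apply: cvgM; [exact: continuous_sin|exact: continuous_cosX].
have dF (x : R) : is_derive x (1 : R) F (f x).
  apply: is_derive_eq.
  have e : sin x ^+ 2 = 1 - cos x ^+ 2 by rewrite -(cos2Dsin2 x); ring.
  have -> : (@cos R ^+ k.+1) x = cos x ^+ k.+1.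
    by elim: (k.+1) => [|j IH] //; rewrite !exprS -IH.
  rewrite /f /GRing.scale /= !exprS -!natr1.
  have -> : sin x * ((k%:R + 1) * cos x ^+ k * - sin x) =
    - ((k%:R + 1) * cos x ^+ k * sin x ^+ 2) by ring.
  by rewrite e; ring.
by rewrite (Rintegral_FTC cf cF dF) !FE cos_pihalf sin0 expr0n /= mulr0 mul0r subrr.
Qed.

Lemma wallis_decr k : wallis k.+1 <= wallis k.
Proof.
apply: le_Rintegral => //; try exact: integrable_cosX.
move=> x /=; rewrite in_itv /= => /andP[x0 x1].
have c0 : 0 <= cos x.
  by apply: cos_ge0_pihalf; rewrite x1 andbT (le_trans _ x0) // oppr_le0 ltW.
by rewrite exprS ler_piMl ?exprn_ge0 // cos_le1.
Qed.

Lemma wallis_mul k : k.+1%:R * (wallis k * wallis k.+1) = pi / 2.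
Proof.
elim: k => [|k IH]; first by rewrite wallis0 wallis1 mul1r mulr1.
by rewrite mulrCA wallisSS -IH; ring.
Qed.

(** Both sides satisfy the same recurrence, by [wallisSS] and [catalanS]. *)
Lemma wallis_catalan n : wallis n.*2 = pi / 2 * (n.+1%:R * catalan R n).
Proof.
elim: n => [|n IH]; first by rewrite wallis0 /catalan nu0 mul1r mulr1.
have h := wallisSS n.*2; have h' := catalanS R n.
have n0 : (n.*2.+2)%:R != 0 :> R by rewrite pnatr_eq0.
rewrite doubleS; apply: (mulfI n0); rewrite h IH.
have e1 : (n.*2 + 4)%:R = 2 * n.+2%:R :> R by rewrite -natrM; congr _%:R; lia.
have e2 : (n.*2.+2)%:R = 2 * n.+1%:R :> R by rewrite -natrM; congr _%:R; lia.
rewrite e1 in h'; rewrite e2.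
have -> : n.*2.+1%:R * (pi / 2 * (n.+1%:R * catalan R n)) =
  pi / 2 * n.+1%:R * (n.*2.+1%:R * catalan R n) by ring.
by rewrite -h'; ring.
Qed.

(** The square of Wallis' integral of index [2n] lies between its products with the next
    and with the previous one, which [wallis_mul] evaluates. *)
Lemma catalan_sqr_bounds n : (0 < n)%N ->
  (n.*2)%:R / (n.*2.+1)%:R <= pi * n%:R * (n.+1%:R * catalan R n) ^+ 2 <= 1.
Proof.
case: n => // n _; set w := n.+2%:R * _.
have p0 : 0 < pi :> R := pi_gt0 R.
have w0 : 0 <= w by rewrite mulr_ge0 ?catalan_ge0.
have hw : wallis n.+1.*2 = pi / 2 * w by exact: wallis_catalan.
have hu : n.+1.*2%:R * (wallis n.+1.*2 * wallis n.+1.*2) <= pi / 2.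
  rewrite -(wallis_mul n.*2.+1) doubleS ler_wpM2l //.
  by rewrite ler_wpM2r ?wallis_decr // -doubleS hw mulr_ge0 // ltW.
have hl : pi / 2 <= n.+1.*2.+1%:R * (wallis n.+1.*2 * wallis n.+1.*2).
  rewrite -(wallis_mul n.+1.*2) ler_wpM2l // ler_wpM2l ?wallis_decr //.
  by rewrite hw mulr_ge0 // ltW.
rewrite hw in hu hl.
have e : n.+1.*2%:R = 2 * n.+1%:R :> R by rewrite -natrM mul2n.
have ph : 0 < pi / 2 :> R by lra.
apply/andP; split.
  rewrite ler_pdivrMr ?ltr0n // -(ler_pM2l ph) e.
  have := ler_wpM2l (_ : 0 <= 2 * n.+1%:R) hl; rewrite mulr_ge0 // => /(_ isT).
  lra.
rewrite -(ler_pM2l ph) mulr1; apply: le_trans hu; rewrite e; lra.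
Qed.
End Wallis.

(** * Index sequences of linear growth *)

Section Tracks.
Variable R : realType.

(** Within bounded distance of the line [x * N], as are floors of multiples of [N] and
    their truncated differences. *)
Definition tracks (k : nat -> nat) (x : R) :=
  exists C : R, \forall N \near \oo, `|(k N)%:R - x * N%:R| <= C.

Lemma cvg_eq_near (f g : nat -> R) (l : R) :
  (\forall N \near \oo, f N = g N) -> f N @[N --> \oo] --> l ->
  g N @[N --> \oo] --> l.
Proof. by move=> h; apply: cvg_trans; exact: near_eq_cvg. Qed.

Lemma cvg_invn : (N%:R^-1 : R) @[N --> \oo] --> (0 : R).
Proof.
apply/cvgrPdist_le => e e0; near=> N.
have hN : e^-1 <= N%:R by near: N; exact: near_nat_ge.
have N0 : 0 < N%:R :> R by apply: lt_le_trans hN; rewrite invr_gt0.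
rewrite sub0r normrN ger0_norm ?invr_ge0 //.
by rewrite -[e]invrK lef_pV2 ?posrE ?invr_gt0.
Unshelve. all: by end_near. Qed.

Lemma tracks_cvg k x : tracks k x -> (k N)%:R / N%:R @[N --> \oo] --> x.
Proof.
case=> C hC; apply/cvgrPdist_le => e e0; near=> N.
have hN : `|C| / e <= N%:R by near: N; exact: near_nat_ge.
have N1 : 1 <= N%:R :> R by near: N; exact: near_nat_ge.
have N0 : 0 < N%:R :> R by lra.
have h : `|(k N)%:R - x * N%:R| <= C by near: N.
rewrite distrC -(ler_pM2r N0) -{2}(ger0_norm (ltW N0)) -normrM mulrBl divfK ?gt_eqF //.
apply: le_trans h _; rewrite ler_pdivrMr // in hN.
by rewrite mulrC (le_trans (ler_norm C)).
Unshelve. all: by end_near. Qed.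

Lemma tracksD k l x y : tracks k x -> tracks l y ->
  tracks (fun N => (k N + l N)%N) (x + y).
Proof.
case=> C hC [D hD]; exists (C + D); near=> N.
have h1 : `|(k N)%:R - x * N%:R| <= C by near: N.
have h2 : `|(l N)%:R - y * N%:R| <= D by near: N.
rewrite natrD (_ : _ - _ = ((k N)%:R - x * N%:R) + ((l N)%:R - y * N%:R)); last by ring.
by apply: le_trans (ler_normD _ _) _; rewrite lerD.
Unshelve. all: by end_near. Qed.

Lemma tracks_ge k x eta : tracks k x -> eta < x ->
  \forall N \near \oo, eta * N%:R <= (k N)%:R.
Proof.
case=> C hC hx; near=> N.
have h : `|(k N)%:R - x * N%:R| <= C by near: N.
have hN : C / (x - eta) <= N%:R by near: N; exact: near_nat_ge.
rewrite ler_pdivrMr ?subr_gt0 // in hN.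
move: h; rewrite ler_norml => /andP[h _]; lra.
Unshelve. all: by end_near. Qed.

Lemma tracks_lt k l x y : tracks k x -> tracks l y -> x < y ->
  \forall N \near \oo, (k N < l N)%N.
Proof.
case=> C hC [D hD] xy; near=> N.
have h1 : `|(k N)%:R - x * N%:R| <= C by near: N.
have h2 : `|(l N)%:R - y * N%:R| <= D by near: N.
have hN : (C + D + 1) / (y - x) <= N%:R by near: N; exact: near_nat_ge.
rewrite ler_pdivrMr ?subr_gt0 // in hN.
rewrite -(ltr_nat R); move: h1 h2; rewrite !ler_norml => /andP[_ h1] /andP[h2 _]; lra.
Unshelve. all: by end_near. Qed.

Lemma tracks_shift (c : nat) k l x : tracks k x ->
  (\forall N \near \oo, (l N <= k N + c)%N /\ (k N <= l N + c)%N) -> tracks l x.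
Proof.
case=> C hC hl; exists (C + c%:R); near=> N.
have h1 : `|(k N)%:R - x * N%:R| <= C by near: N.
have [h2 h3] : (l N <= k N + c)%N /\ (k N <= l N + c)%N by near: N.
move: h2 h3; rewrite -!(ler_nat R) !natrD => h2 h3.
move: h1; rewrite !ler_norml => /andP[h1 h1']; apply/andP; split; lra.
Unshelve. all: by end_near. Qed.

Lemma tracksB k l x y : tracks k x -> tracks l y -> y < x ->
  tracks (fun N => (k N - l N)%N) (x - y).
Proof.
move=> hk hl xy; have hlt := tracks_lt hl hk xy.
case: hk hl => C hC [D hD]; exists (C + D); near=> N.
have h1 : `|(k N)%:R - x * N%:R| <= C by near: N.
have h2 : `|(l N)%:R - y * N%:R| <= D by near: N.
have h3 : (l N < k N)%N by near: N.
rewrite natrB; last exact: ltnW.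
rewrite (_ : _ - _ = ((k N)%:R - x * N%:R) - ((l N)%:R - y * N%:R)); last by ring.
by apply: le_trans (ler_normB _ _) _; rewrite lerD.
Unshelve. all: by end_near. Qed.

Lemma tracks_id : tracks id 1.
Proof. by exists 0; near=> N; rewrite mul1r subrr normr0. Unshelve. all: by end_near. Qed.

(** The rank from 0 of the position or value [floor (x N)], which is numbered from 1. *)
Definition floor_pred (x : R) (N : nat) : nat := (`|Num.floor (x * N%:R)|%N).-1.

Lemma near_floor_pred x : 0 < x ->
  \forall N \near \oo, Num.floor (x * N%:R) = (floor_pred x N).+1%:Z.
Proof.
move=> x0; near=> N.
have hN : x^-1 <= N%:R by near: N; exact: near_nat_ge.
have h1 : 1 <= x * N%:R by rewrite -ler_pdivrMl // mulr1.
have : (1 <= Num.floor (x * N%:R))%R by rewrite floor_ge_int_tmp.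
rewrite /floor_pred; case: (Num.floor _) => [[|n]|n] //=.
Unshelve. all: by end_near. Qed.

Lemma tracks_floor x : 0 < x -> tracks (floor_pred x) x.
Proof.
move=> x0; exists 2; near=> N.
have h : Num.floor (x * N%:R) = (floor_pred x N).+1%:Z by near: N; exact: near_floor_pred.
have h1 := floor_le (x * N%:R); have h2 := floorD1_gt (x * N%:R).
rewrite h in h1 h2.
have e : ((floor_pred x N).+1%:Z)%:~R = (floor_pred x N)%:R + 1 :> R.
  by rewrite -pmulrn -natr1.
rewrite intrD e in h2; rewrite e in h1.
rewrite ler_norml; apply/andP; split; lra.
Unshelve. all: by end_near. Qed.

(** Limit of [N ^ (3/2)] times the normalized Catalan number of index about [x * N]. *)
Definition catalan_limit (x : R) := (Num.sqrt pi * x `^ (3 / 2))^-1.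

(** Squares are easier: [catalan_sqr_bounds] gives the limit of [catalan ^ 2 * N ^ 3], and
    the square root is continuous. *)
Lemma catalan_cvg k x : 0 < x -> tracks k x ->
  catalan R (k N) * N%:R `^ (3 / 2) @[N --> \oo] --> catalan_limit x.
Proof.
move=> x0 hk.
have hkN := tracks_cvg hk.
have hNk : N%:R / (k N)%:R @[N --> \oo] --> x^-1.
  apply: cvg_eq_near (cvgV (lt0r_neq0 x0) hkN).
  by near=> N; rewrite /= invf_div.
have hk0 : \forall N \near \oo, (0 < k N)%N.
  near=> N; rewrite -(ltr_nat R).
  apply: lt_le_trans (_ : x / 2 * N%:R <= _).
    rewrite mulr_gt0 ?divr_gt0 // ltr0n; near: N; exact: nbhs_infty_gt.
  by near: N; apply: tracks_ge hk _; lra.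
have hki : (k N)%:R^-1 @[N --> \oo] --> (0 : R).
  rewrite -[X in _ --> X](mulr0 x^-1); apply: cvg_eq_near (cvgM hNk cvg_invn).
  near=> N; rewrite /= mulrAC divff ?mul1r // pnatr_eq0 -lt0n.
  near: N; exact: nbhs_infty_gt.
(* b n tends to 1 as n grows, and catalan^2 N^3 is b times powers of N / k N. *)
pose b n : R := pi * n%:R * (n.+1%:R * catalan R n) ^+ 2.
have hb : b (k N) @[N --> \oo] --> (1 : R).
  apply: (@squeeze_cvgr _ _ _ _ (fun N => 1 - (k N)%:R^-1) (fun=> 1)).
  - near=> N; have k0 : (0 < k N)%N by near: N.
    have /andP[h1 h2] := catalan_sqr_bounds R k0; rewrite h2 andbT.
    apply: le_trans h1; rewrite ler_pdivlMr ?ltr0n // mulrBl mul1r.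
    have kr0 : 0 < (k N)%:R :> R by rewrite ltr0n.
    rewrite lerBlDr -natr1 lerD2l ler_pdivlMl // mulr1 natr1 ler_nat; lia.
  - rewrite -[X in _ --> X](subr0 1); apply: cvgB => //; exact: cvg_cst.
  - exact: cvg_cst.
have hNk1 : N%:R / (k N).+1%:R @[N --> \oo] --> x^-1.
  have h1 : (1 + (k N)%:R^-1)^-1 @[N --> \oo] --> ((1 + 0)^-1 : R).
    by apply: cvgV; [rewrite addr0 oner_eq0|apply: cvgD => //; exact: cvg_cst].
  rewrite addr0 invr1 in h1.
  rewrite -[X in _ --> X](mulr1 x^-1); apply: cvg_eq_near (cvgM hNk h1).
  near=> N; have k0 : (0 < k N)%N by near: N.
  have kr0 : 0 < (k N)%:R :> R by rewrite ltr0n.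
  rewrite /= -natr1; field; lra.
have hsq : pi^-1 * b (k N) * (N%:R / (k N)%:R) * (N%:R / (k N).+1%:R) ^+ 2
    @[N --> \oo] --> pi^-1 * 1 * x^-1 * (x^-1) ^+ 2.
  apply: cvgM; last first.
    by rewrite !expr2; apply: cvgM.
  apply: cvgM => //; apply: cvgM => //; exact: cvg_cst.
have p0 : 0 < pi :> R := pi_gt0 R.
have eq3 (y : R) : 0 <= y -> y `^ (3 / 2) = Num.sqrt (y ^+ 3).
  by move=> y0; rewrite -powR12_sqrt ?exprn_ge0 // -powR_mulrn // -powRrM.
have -> : catalan_limit x = Num.sqrt (pi^-1 * 1 * x^-1 * x^-1 ^+ 2).
  rewrite /catalan_limit eq3 ?ltW // -sqrtrM ?ltW // -sqrtrV ?mulr_ge0 ?exprn_ge0 ?ltW //.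
  congr (Num.sqrt _); move: (@pi R) p0 => q q0.
  by field; rewrite !lt0r_neq0.
apply: (cvg_eq_near _ (cvg_comp _ _ hsq (@sqrt_continuous _ _))); near=> N.
have k0 : (0 < k N)%N by near: N.
have kr0 : 0 < (k N)%:R :> R by rewrite ltr0n.
rewrite /= eq3 // -[catalan _ _]ger0_norm ?catalan_ge0 // -sqrtr_sqr -sqrtrM ?sqr_ge0 //.
congr (Num.sqrt _); rewrite /b -natr1.
move: (@pi R) p0 => q q0; field.
by rewrite !lt0r_neq0 ?addr_gt0.
Unshelve. all: by end_near. Qed.
End Tracks.

(** * Probabilities and covariances as sums over heights *)

Section Counts.
Variable R : realType.

Lemma npathsE L x y : (npaths L x y)%:R = 2 ^+ L * nu R L x y.
Proof. by rewrite /nu mulrC divfK // expf_neq0 // pnatr_eq0. Qed.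

(** When [2m - a] is truncated to 0, the path cannot come down from [a]; so the truncation
    in the counts and in the sums agree. *)
Lemma nu_trunc L a : (L < a)%N -> nu R (L - a) a 0 = 0.
Proof. by move=> h; rewrite nu_far //; lia. Qed.

(** The lengths of the three pieces add up to [2 (N - 1)], whatever the height. *)
Lemma count_one_arc N i j : (j <= i)%N -> (i < N)%N ->
  (\sum_(a < j.+1) npaths (j.*2 - a) 0 a *
    (npaths (i + a - j).*2 0 0 * npaths (N.*2 - (i.+1.*2 + a)) a 0))%:R =
  4 ^+ (N - 1) * one_arc R j (i - j) (N - i.+1).
Proof.
move=> hij hiN; rewrite natr_sum mulr_sumr; apply: eq_bigr => a _.
have ha := ltn_ord a; rewrite !natrM !npathsE /catalan.
rewrite (_ : (i + a - j) = i - j + a)%N; last by lia.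
rewrite (_ : N.*2 - (i.+1.*2 + a) = (N - i.+1).*2 - a)%N; last by lia.
have [h|h] := leqP a (N - i.+1).*2; last by rewrite nu_trunc // !mulr0.
rewrite (_ : 4 = 2 ^+ 2); last by rewrite -natrX.
rewrite -exprM (_ : 2 * (N - 1) = (j.*2 - a) + (i - j + a).*2 + ((N - i.+1).*2 - a))%N; last by lia.
by rewrite !exprD; ring.
Qed.

Lemma count_nested N i1 i2 j1 j2 : (j2 < j1)%N -> (j1 <= i1)%N -> (i1 < i2)%N -> (i2 < N)%N ->
  (\sum_(a < j2.+1) npaths (j2.*2 - a) 0 a *
    ((\sum_(b < (j1 - j2.+1).+1) npaths ((j1 - j2.+1).*2 - b) 0 b *
       (npaths (i1 + a - j2 + b - (j1 - j2.+1)).*2 0 0 *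
        npaths ((i2 + a - j2).*2 - ((i1 + a - j2).+1.*2 + b)) b 0)) *
     npaths (N.*2 - (i2.+1.*2 + a)) a 0))%:R =
  4 ^+ (N - 2) * nested_sum R j2 (j1 - j2.+1) (i1 - j1).+1 (i2 - i1.+1) (N - i2.+1).
Proof.
move=> h1 h2 h3 h4; rewrite natr_sum mulr_sumr; apply: eq_bigr => a _.
have ha := ltn_ord a; rewrite !natrM natr_sum.
rewrite (_ : N.*2 - (i2.+1.*2 + a) = (N - i2.+1).*2 - a)%N; last by lia.
rewrite [X in _ * (_ * X)]npathsE.
have [h|h] := leqP a (N - i2.+1).*2; last by rewrite nu_trunc // !mulr0.
rewrite !mulr_suml !mulr_sumr; apply: eq_bigr => b _.
have hb := ltn_ord b; rewrite !natrM !npathsE /catalan.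
rewrite (_ : i1 + a - j2 + b - (j1 - j2.+1) = (i1 - j1).+1 + a + b)%N; last by lia.
rewrite (_ : (i2 + a - j2).*2 - ((i1 + a - j2).+1.*2 + b) = (i2 - i1.+1).*2 - b)%N; last by lia.
have [h'|h'] := leqP b (i2 - i1.+1).*2; last by rewrite (nu_trunc h') // !(mulr0, mul0r).
rewrite (_ : 4 = 2 ^+ 2); last by rewrite -natrX.
rewrite -exprM (_ : 2 * (N - 2) = (j2.*2 - a) + ((j1 - j2.+1).*2 - b) +
  ((i1 - j1).+1 + a + b).*2 + ((i2 - i1.+1).*2 - b) + ((N - i2.+1).*2 - a))%N; last by lia.
by rewrite !exprD; ring.
Qed.

Lemma count_disjoint N i1 i2 j1 j2 : (j1 <= i1)%N -> (i1 < j2)%N -> (j2 <= i2)%N -> (i2 < N)%N ->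
  (\sum_(a < (minn j1 (j2 - i1.+1)).+1) npaths (j1.*2 - a) 0 a *
    (npaths (i1 + a - j1).*2 0 0 *
     (\sum_(b < (j2 - i1.+1).+1) npaths ((j2 - i1.+1).*2 - a - b) a b *
       (npaths (i2 + b - j2).*2 0 0 *
        npaths (N.*2 - (i2.+1.*2 + b)) b 0))))%:R =
  4 ^+ (N - 2) * disjoint_sum R j1 (i1 - j1) (j2 - i1.+1) (i2 - j2) (N - i2.+1).
Proof.
move=> h1 h2 h3 h4; rewrite natr_sum mulr_sumr; apply: eq_bigr => a _.
have ha := ltn_ord a; rewrite !natrM natr_sum !npathsE.
rewrite !mulr_sumr; apply: eq_bigr => b _.
have hb := ltn_ord b; rewrite !natrM !npathsE /catalan.
rewrite (_ : N.*2 - (i2.+1.*2 + b) = (N - i2.+1).*2 - b)%N; last by lia.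
rewrite (_ : i1 + a - j1 = i1 - j1 + a)%N; last by lia.
rewrite (_ : i2 + b - j2 = i2 - j2 + b)%N; last by lia.
have [h|h] := leqP b (N - i2.+1).*2; last by rewrite nu_trunc // !mulr0.
rewrite (_ : 4 = 2 ^+ 2); last by rewrite -natrX.
rewrite -exprM (_ : 2 * (N - 2) = (j1.*2 - a) + (i1 - j1 + a).*2 +
  ((j2 - i1.+1).*2 - a - b) + (i2 - j2 + b).*2 + ((N - i2.+1).*2 - b))%N; last by lia.
by rewrite !exprD; ring.
Qed.

Lemma card_avoids312R N : #|@avoids312 N|%:R = 4 ^+ N * catalan R N.
Proof.
rewrite card_avoids312 npathsE /catalan (_ : 4 = 2 ^+ 2); last by rewrite -natrX.
by rewrite -exprM mul2n.
Qed.

Lemma card_avoids312_gt0 N : 0 < #|@avoids312 N|%:R :> R.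
Proof. by rewrite card_avoids312R mulr_gt0 ?catalan_gt0 // exprn_gt0. Qed.

Lemma expr4_div N k : (k <= N)%N -> 4 ^+ (N - k) / 4 ^+ N = 4 ^- k :> R.
Proof.
move=> h; have e0 j : 4 ^+ j != 0 :> R by rewrite expf_neq0 // pnatr_eq0.
by rewrite -{2}(subnK h) exprD invfM mulrA divff // mul1r.
Qed.

Lemma prob_sends N i j : (j <= i)%N -> (i < N)%N ->
  prob312 R (@sends N i.+1%:Z j.+1%:Z) =
  one_arc R j (i - j) (N - i.+1) / (4 * catalan R N).
Proof.
move=> hij hiN; rewrite /prob312 card_sends // count_one_arc // card_avoids312R.
have := @expr4_div N 1 (ltac:(lia)).
move: (one_arc _ _ _ _) (catalan R N) => x c h; rewrite !invfM.
rewrite (_ : 4 ^+ (N - 1) * x * (_ / c) = (4 ^+ (N - 1) / 4 ^+ N) * (x / c)); last by ring.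
by rewrite h expr1 mulrCA.
Qed.

Lemma prob_nested N i1 i2 j1 j2 : (j2 < j1)%N -> (j1 <= i1)%N -> (i1 < i2)%N -> (i2 < N)%N ->
  prob312 R (fun s : 'S_N => sends i1.+1%:Z j1.+1%:Z s && sends i2.+1%:Z j2.+1%:Z s) =
  nested_sum R j2 (j1 - j2.+1) (i1 - j1).+1 (i2 - i1.+1) (N - i2.+1) / (16 * catalan R N).
Proof.
move=> h1 h2 h3 h4; rewrite /prob312 card_sends_nested // count_nested // card_avoids312R.
have := @expr4_div N 2 (ltac:(lia)).
move: (nested_sum _ _ _ _ _ _) (catalan R N) => x c h; rewrite !invfM.
rewrite (_ : 4 ^+ (N - 2) * x * (_ / c) = (4 ^+ (N - 2) / 4 ^+ N) * (x / c)); last by ring.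
by rewrite h -natrX mulrCA.
Qed.

Lemma prob_disjoint N i1 i2 j1 j2 : (j1 <= i1)%N -> (i1 < j2)%N -> (j2 <= i2)%N -> (i2 < N)%N ->
  prob312 R (fun s : 'S_N => sends i1.+1%:Z j1.+1%:Z s && sends i2.+1%:Z j2.+1%:Z s) =
  disjoint_sum R j1 (i1 - j1) (j2 - i1.+1) (i2 - j2) (N - i2.+1) / (16 * catalan R N).
Proof.
move=> h1 h2 h3 h4; rewrite /prob312 card_sends_disjoint // count_disjoint // card_avoids312R.
have := @expr4_div N 2 (ltac:(lia)).
move: (disjoint_sum _ _ _ _ _ _) (catalan R N) => x c h; rewrite !invfM.
rewrite (_ : 4 ^+ (N - 2) * x * (_ / c) = (4 ^+ (N - 2) / 4 ^+ N) * (x / c)); last by ring.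
by rewrite h -natrX mulrCA.
Qed.

Lemma prob_crossing N i1 i2 j1 j2 : (j1 < j2)%N -> (j2 <= i1)%N -> (i1 < i2)%N ->
  prob312 R (fun s : 'S_N => sends i1.+1%:Z j1.+1%:Z s && sends i2.+1%:Z j2.+1%:Z s) = 0.
Proof. by move=> h1 h2 h3; rewrite /prob312 card_sends_crossing // mul0r. Qed.

Lemma expect312E N (X : 'S_N -> R) :
  expect312 X = (\sum_(s : 'S_N | avoids312 s) X s) / #|@avoids312 N|%:R.
Proof.
rewrite /expect312 mulr_suml; apply: eq_bigr => s hs; congr (_ * _).
rewrite /prob312 (_ : #|_| = 1%N) ?mul1r //.
rewrite -(card1 s); apply: eq_card => s'; rewrite !inE.
by case: eqVneq => [->|]; rewrite ?hs ?andbF.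
Qed.

Lemma expect312_indicator N (A : pred 'S_N) :
  expect312 (fun s => (A s)%:R) = prob312 R A.
Proof.
rewrite expect312E /prob312; congr (_ / _).
rewrite -sum1_card natr_sum [RHS](eq_bigl (fun s => avoids312 s && A s)) //.
by rewrite [RHS]big_mkcondr; apply: eq_bigr => s _; case: (A s).
Qed.

Lemma cov312E N (X Y : 'S_N -> R) :
  cov312 X Y = expect312 (fun s => X s * Y s) - expect312 X * expect312 Y.
Proof.
rewrite /cov312; set x := expect312 X; set y := expect312 Y.
have c0 := card_avoids312_gt0 N; set c := #|_|%:R in c0.
have sc : (\sum_(s : 'S_N | avoids312 s) 1 : R) = c.
  by rewrite /c -sum1_card natr_sum.
have hX : \sum_(s : 'S_N | avoids312 s) X s = c * x.
  by rewrite /x expect312E -/c mulrC divfK // gt_eqF.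
have hY : \sum_(s : 'S_N | avoids312 s) Y s = c * y.
  by rewrite /y expect312E -/c mulrC divfK // gt_eqF.
rewrite !expect312E -/c.
rewrite (eq_bigr (fun s => X s * Y s - x * Y s - y * X s + x * y * 1)); last first.
  by move=> s _; ring.
rewrite big_split !sumrB /= -!mulr_sumr hX hY sc; field; exact: lt0r_neq0.
Qed.

Lemma cov312_Z N i1 j1 i2 j2 :
  cov312 (@Z312 R N i1 j1) (@Z312 R N i2 j2) =
  prob312 R (fun s : 'S_N => sends i1 j1 s && sends i2 j2 s) -
  prob312 R (@sends N i1 j1) * prob312 R (@sends N i2 j2).
Proof.
rewrite cov312E /Z312 !expect312_indicator; congr (_ - _).
rewrite -[RHS]expect312_indicator; congr (expect312 _); apply/funext => s.
by rewrite -natrM mulnb.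
Qed.
End Counts.

(** * Limits of the probabilities and of the covariance *)

Section Limits.
Variable R : realType.
Local Notation catalan := (catalan R).
Local Notation catalan_limit := (@catalan_limit R).

Lemma powR32_sqr N : (N%:R `^ (3 / 2)) ^+ 2 = N%:R ^+ 3 :> R.
Proof.
rewrite -powR_mulrn ?powR_ge0 // -powRrM -powR_mulrn //; congr (_ `^ _); lra.
Qed.

Lemma catalan_limit_gt0 x : 0 < x -> 0 < catalan_limit x.
Proof. by move=> x0; rewrite invr_gt0 mulr_gt0 ?powR_gt0 // sqrtr_gt0 pi_gt0. Qed.

Lemma catalan_limit1 : catalan_limit 1 = (Num.sqrt pi)^-1.
Proof. by rewrite /catalan_limit powR1 mulr1. Qed.

(** Limit of [N ^ (3/2) * P(sigma_i = j)], where [x] is the slope of [i - j]. *)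
Definition single_limit (x : R) := catalan_limit x * catalan_limit (1 - x) / catalan_limit 1 / 2.
(** Limit of [N ^ 3] times the probability of two arcs, where [x], [y] and [z] are the
    slopes of the three regions into which the arcs cut the word. *)
Definition joint_limit (x y z : R) := catalan_limit x * catalan_limit y * catalan_limit z / catalan_limit 1 / 4.

Lemma sqrt_pi_sqr : Num.sqrt pi ^+ 2 = pi :> R.
Proof. by rewrite sqr_sqrtr // pi_ge0. Qed.

Lemma single_limitE x : 0 < x -> x < 1 ->
  single_limit x = (2 * Num.sqrt pi * (x `^ (3 / 2) * (1 - x) `^ (3 / 2)))^-1.
Proof.
move=> x0 x1; have s0 : 0 < Num.sqrt pi :> R by rewrite sqrtr_gt0 pi_gt0.
have := powR_gt0 (3 / 2) x0; have := @powR_gt0 R (1 - x) (3 / 2).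
rewrite subr_gt0 /single_limit catalan_limit1 /catalan_limit.
move: (x `^ _) ((1 - x) `^ _) (Num.sqrt pi) s0 => p q s s0 /(_ x1) q0 p0.
by field; rewrite !lt0r_neq0.
Qed.

Lemma joint_limitE x y z : 0 < x -> 0 < y -> 0 < z ->
  joint_limit x y z = (4 * pi * (x `^ (3 / 2) * y `^ (3 / 2) * z `^ (3 / 2)))^-1.
Proof.
move=> x0 y0 z0; have s0 : 0 < Num.sqrt pi :> R by rewrite sqrtr_gt0 pi_gt0.
have := powR_gt0 (3 / 2) x0; have := powR_gt0 (3 / 2) y0; have := powR_gt0 (3 / 2) z0.
rewrite -sqrt_pi_sqr /joint_limit catalan_limit1 /catalan_limit.
move: (x `^ _) (y `^ _) (z `^ _) (Num.sqrt pi) s0 => p q r s s0 p0 q0 r0.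
by field; rewrite !lt0r_neq0.
Qed.

Lemma joint_limit_cvg (T : nat -> R) k1 k2 k3 x1 x2 x3 :
  0 < x1 -> 0 < x2 -> 0 < x3 -> tracks k1 x1 -> tracks k2 x2 -> tracks k3 x3 ->
  T N / (4 * catalan (k1 N) * catalan (k2 N) * catalan (k3 N)) @[N --> \oo] --> (1 : R) ->
  N%:R ^+ 3 * (T N / (16 * catalan N)) @[N --> \oo] --> joint_limit x1 x2 x3.
Proof.
move=> x10 x20 x30 h1 h2 h3 hT.
have c1 := catalan_cvg x10 h1; have c2 := catalan_cvg x20 h2.
have c3 := catalan_cvg x30 h3; have c4 := catalan_cvg ltr01 (@tracks_id R).
have k1n : catalan_limit 1 != 0 by rewrite lt0r_neq0 ?catalan_limit_gt0.
rewrite /joint_limit -[catalan_limit x1 * _ * _ / _]mul1r.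
apply: cvg_eq_near (cvgM (cvgM hT (cvgM (cvgM (cvgM c1 c2) c3) (cvgV k1n c4))) (cvg_cst _)).
near=> N.
have N0 : 0 < N%:R :> R by rewrite ltr0n; near: N; exact: nbhs_infty_gt.
have y0 : 0 < N%:R `^ (3 / 2) :> R by rewrite powR_gt0.
rewrite /= -powR32_sqr.
have := catalan_gt0 R (k1 N); have := catalan_gt0 R (k2 N).
have := catalan_gt0 R (k3 N); have := catalan_gt0 R N.
move: (catalan _) (catalan _) (catalan _) (catalan _) (_ `^ _) y0 (T N).
move=> c d e f y y0 t c0 d0 e0 f0; field.
by rewrite !lt0r_neq0.
Unshelve. all: by end_near. Qed.

Lemma single_limit_cvg (T : nat -> R) k1 k2 x :
  0 < x -> x < 1 -> tracks k1 x -> tracks k2 (1 - x) ->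
  T N / (2 * catalan (k1 N) * catalan (k2 N)) @[N --> \oo] --> (1 : R) ->
  N%:R `^ (3 / 2) * (T N / (4 * catalan N)) @[N --> \oo] --> single_limit x.
Proof.
move=> x0 x1 h1 h2 hT; have x1' : 0 < 1 - x by rewrite subr_gt0.
have c1 := catalan_cvg x0 h1; have c2 := catalan_cvg x1' h2.
have c4 := catalan_cvg ltr01 (@tracks_id R).
have k1n : catalan_limit 1 != 0 by rewrite lt0r_neq0 ?catalan_limit_gt0.
rewrite /single_limit -[catalan_limit x * _ / _]mul1r.
apply: cvg_eq_near (cvgM (cvgM hT (cvgM (cvgM c1 c2) (cvgV k1n c4))) (cvg_cst _)).
near=> N.
have N0 : 0 < N%:R :> R by rewrite ltr0n; near: N; exact: nbhs_infty_gt.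
have y0 : 0 < N%:R `^ (3 / 2) :> R by rewrite powR_gt0.
have := catalan_gt0 R (k1 N); have := catalan_gt0 R (k2 N); have := catalan_gt0 R N.
rewrite /=; move: (catalan _) (catalan _) (catalan _) (_ `^ _) y0 (T N).
move=> c d e y y0 t c0 d0 e0; field.
by rewrite !lt0r_neq0.
Unshelve. all: by end_near. Qed.

Lemma tracks_gap k l (x y : R) : tracks k x -> tracks l y -> y < x ->
  tracks (fun N => (k N - (l N).+1)%N) (x - y).
Proof.
move=> hk hl yx; apply: (tracks_shift (c := 1) (tracksB hk hl yx)).
by near=> N; lia.
Unshelve. all: by end_near. Qed.

Lemma prob_single_cvg (a b : R) : 0 < a -> a < b -> b < 1 ->
  N%:R `^ (3 / 2) * prob312 R (@sends N (Num.floor (b * N%:R)) (Num.floor (a * N%:R)))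
    @[N --> \oo] --> single_limit (b - a).
Proof.
move=> a0 ab b1; have b0 : 0 < b := lt_trans a0 ab.
pose i := floor_pred b; pose j := floor_pred a.
have hi : tracks i b := tracks_floor b0; have hj : tracks j a := tracks_floor a0.
have hd := tracksB hi hj ab; have hm := tracks_gap (@tracks_id R) hi b1.
have hji := tracks_lt hj hi ab; have hiN := tracks_lt hi (@tracks_id R) b1.
have := @single_limit_cvg (fun N => one_arc R (j N) (i N - j N) (N - (i N).+1)) _ _ (b - a)
  _ _ hd (_ : tracks (fun N => (j N + (N - (i N).+1))%N) _) _.
have e : 1 - (b - a) = a + (1 - b) by ring.
rewrite e => h; apply: cvg_eq_near (h _ _ _ _); last first.
- pose eta := Num.min a (Num.min (b - a) (1 - b)) / 2.
  have m0 : 0 < Num.min a (Num.min (b - a) (1 - b)) by rewrite !lt_min a0 !subr_gt0 ab.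
  have [l1 l2 l3] : [/\ eta < a, eta < b - a & eta < 1 - b].
    have : Num.min a (Num.min (b - a) (1 - b)) <= a by rewrite ge_min lexx.
    have : Num.min a (Num.min (b - a) (1 - b)) <= b - a by rewrite !ge_min lexx ?orbT.
    have : Num.min a (Num.min (b - a) (1 - b)) <= 1 - b by rewrite !ge_min lexx ?orbT.
    by rewrite /eta; split; lra.
  apply: (@one_arc_asymp R eta); first by rewrite divr_gt0.
  have g1 := tracks_ge hj l1; have g2 := tracks_ge hd l2; have g3 := tracks_ge hm l3.
  near=> N; split; [by near: N|by near: N|by near: N|].
  have s1 : (j N < i N)%N by near: N.
  have s2 : (i N < N)%N by near: N.
  by clear -s1 s2; lia.
- exact: tracksD hj hm.
- lra.
- by rewrite subr_gt0.
near=> N.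
have s1 : (j N < i N)%N by near: N.
have s2 : (i N < N)%N by near: N.
have -> : Num.floor (b * N%:R) = (i N).+1%:Z by near: N; exact: near_floor_pred.
have -> : Num.floor (a * N%:R) = (j N).+1%:Z by near: N; exact: near_floor_pred.
by rewrite prob_sends // ltnW.
Unshelve. all: by end_near. Qed.

Lemma exists_below5 (x1 x2 x3 x4 x5 : R) :
  0 < x1 -> 0 < x2 -> 0 < x3 -> 0 < x4 -> 0 < x5 ->
  exists2 eta, 0 < eta & [/\ eta < x1, eta < x2, eta < x3, eta < x4 & eta < x5].
Proof.
move=> h1 h2 h3 h4 h5.
pose m := Num.min x1 (Num.min x2 (Num.min x3 (Num.min x4 x5))).
have m0 : 0 < m by rewrite !lt_min h1 h2 h3 h4.
exists (m / 2); first by rewrite divr_gt0.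
have lt y : m <= y -> m / 2 < y by lra.
by split; apply: lt; rewrite !ge_min lexx ?orbT.
Qed.

Definition joint312 (b1 a1 b2 a2 : R) N : R := prob312 R (fun s : 'S_N =>
  sends (Num.floor (b1 * N%:R)) (Num.floor (a1 * N%:R)) s &&
  sends (Num.floor (b2 * N%:R)) (Num.floor (a2 * N%:R)) s).

(** The regions are the inside of the inner arc, the part between the two arcs, and the
    outside of the outer arc. *)
Lemma joint_nested_cvg (a1 a2 b1 b2 : R) :
  0 < a2 -> a2 < a1 -> a1 < b1 -> b1 < b2 -> b2 < 1 ->
  N%:R ^+ 3 * joint312 b1 a1 b2 a2 N @[N --> \oo] -->
    joint_limit (b1 - a1) ((b2 - a2) - (b1 - a1)) (1 - (b2 - a2)).
Proof.
move=> a20 a21 ab1 b12 b21.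
have a10 : 0 < a1 by lra. have b10 : 0 < b1 by lra. have b20 : 0 < b2 by lra.
pose i1 := floor_pred b1; pose j1 := floor_pred a1.
pose i2 := floor_pred b2; pose j2 := floor_pred a2.
have hi1 : tracks i1 b1 := tracks_floor b10; have hj1 : tracks j1 a1 := tracks_floor a10.
have hi2 : tracks i2 b2 := tracks_floor b20; have hj2 : tracks j2 a2 := tracks_floor a20.
have hd : tracks (fun N => (i1 N - j1 N).+1) (b1 - a1).
  by apply: (tracks_shift (c := 1) (tracksB hi1 hj1 ab1)); near=> N; lia.
have hn' := tracks_gap hj1 hj2 a21; have hm' := tracks_gap hi2 hi1 b12.
have hm := tracks_gap (@tracks_id R) hi2 b21.
have t1 := tracks_lt hj2 hj1 a21; have t2 := tracks_lt hj1 hi1 ab1.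
have t3 := tracks_lt hi1 hi2 b12; have t4 := tracks_lt hi2 (@tracks_id R) b21.
have e1 : (b2 - a2) - (b1 - a1) = (a1 - a2) + (b2 - b1) by ring.
have e2 : 1 - (b2 - a2) = a2 + (1 - b2) by ring.
rewrite e1 e2.
apply: cvg_eq_near (joint_limit_cvg _ _ _ hd (tracksD hn' hm') (tracksD hj2 hm) _); try lra; last first.
  have [||||| eta eta0 [g1 g2 g3 g4 g5]] := @exists_below5 a2 (a1 - a2) (b1 - a1) (b2 - b1) (1 - b2);
    try lra.
  apply: (nested_asymp eta0 (n := j2) (n' := fun N => (j1 N - (j2 N).+1)%N)
    (e := fun N => (i1 N - j1 N).+1) (m' := fun N => (i2 N - (i1 N).+1)%N)
    (m := fun N => (N - (i2 N).+1)%N)).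
  have u1 := tracks_ge hj2 g1; have u2 := tracks_ge hn' g2; have u3 := tracks_ge hd g3.
  have u4 := tracks_ge hm' g4; have u5 := tracks_ge hm g5.
  near=> N; split; [by near: N|by near: N|by near: N|by near: N|split; first by near: N].
  have s1 : (j2 N < j1 N)%N by near: N.
  have s2 : (j1 N < i1 N)%N by near: N.
  have s3 : (i1 N < i2 N)%N by near: N.
  have s4 : (i2 N < N)%N by near: N.
  by clear -s1 s2 s3 s4; lia.
near=> N.
have s1 : (j2 N < j1 N)%N by near: N.
have s2 : (j1 N < i1 N)%N by near: N.
have s3 : (i1 N < i2 N)%N by near: N.
have s4 : (i2 N < N)%N by near: N.
rewrite /joint312.
have -> : Num.floor (b1 * N%:R) = (i1 N).+1%:Z by near: N; exact: near_floor_pred.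
have -> : Num.floor (a1 * N%:R) = (j1 N).+1%:Z by near: N; exact: near_floor_pred.
have -> : Num.floor (b2 * N%:R) = (i2 N).+1%:Z by near: N; exact: near_floor_pred.
have -> : Num.floor (a2 * N%:R) = (j2 N).+1%:Z by near: N; exact: near_floor_pred.
by rewrite prob_nested // ltnW.
Unshelve. all: by end_near. Qed.

(** The regions are the insides of the two arcs and the part outside both. *)
Lemma joint_disjoint_cvg (a1 a2 b1 b2 : R) :
  0 < a1 -> a1 < b1 -> b1 < a2 -> a2 < b2 -> b2 < 1 ->
  N%:R ^+ 3 * joint312 b1 a1 b2 a2 N @[N --> \oo] -->
    joint_limit (b1 - a1) (b2 - a2) (1 - (b1 - a1) - (b2 - a2)).
Proof.
move=> a10 ab1 ba ab2 b21.
have b10 : 0 < b1 by lra. have a20 : 0 < a2 by lra. have b20 : 0 < b2 by lra.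
pose i1 := floor_pred b1; pose j1 := floor_pred a1.
pose i2 := floor_pred b2; pose j2 := floor_pred a2.
have hi1 : tracks i1 b1 := tracks_floor b10; have hj1 : tracks j1 a1 := tracks_floor a10.
have hi2 : tracks i2 b2 := tracks_floor b20; have hj2 : tracks j2 a2 := tracks_floor a20.
have hd1 := tracksB hi1 hj1 ab1; have hd2 := tracksB hi2 hj2 ab2.
have hp := tracks_gap hj2 hi1 ba; have hm := tracks_gap (@tracks_id R) hi2 b21.
have t1 := tracks_lt hj1 hi1 ab1; have t2 := tracks_lt hi1 hj2 ba.
have t3 := tracks_lt hj2 hi2 ab2; have t4 := tracks_lt hi2 (@tracks_id R) b21.
have e1 : 1 - (b1 - a1) - (b2 - a2) = a1 + (a2 - b1) + (1 - b2) by ring.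
rewrite e1.
apply: cvg_eq_near (joint_limit_cvg _ _ _ hd1 hd2 (tracksD (tracksD hj1 hp) hm) _); try lra; last first.
  have [||||| eta eta0 [g1 g2 g3 g4 g5]] := @exists_below5 a1 (b1 - a1) (a2 - b1) (b2 - a2) (1 - b2);
    try lra.
  apply: (disjoint_asymp eta0 (n := j1) (e1 := fun N => (i1 N - j1 N)%N)
    (p := fun N => (j2 N - (i1 N).+1)%N) (e2 := fun N => (i2 N - j2 N)%N)
    (m := fun N => (N - (i2 N).+1)%N)).
  have u1 := tracks_ge hj1 g1; have u2 := tracks_ge hd1 g2; have u3 := tracks_ge hp g3.
  have u4 := tracks_ge hd2 g4; have u5 := tracks_ge hm g5.
  near=> N; split; [by near: N|by near: N|by near: N|by near: N|split; first by near: N].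
  have s1 : (j1 N < i1 N)%N by near: N.
  have s2 : (i1 N < j2 N)%N by near: N.
  have s3 : (j2 N < i2 N)%N by near: N.
  have s4 : (i2 N < N)%N by near: N.
  by clear -s1 s2 s3 s4; lia.
near=> N.
have s1 : (j1 N < i1 N)%N by near: N.
have s2 : (i1 N < j2 N)%N by near: N.
have s3 : (j2 N < i2 N)%N by near: N.
have s4 : (i2 N < N)%N by near: N.
rewrite /joint312.
have -> : Num.floor (b1 * N%:R) = (i1 N).+1%:Z by near: N; exact: near_floor_pred.
have -> : Num.floor (a1 * N%:R) = (j1 N).+1%:Z by near: N; exact: near_floor_pred.
have -> : Num.floor (b2 * N%:R) = (i2 N).+1%:Z by near: N; exact: near_floor_pred.
have -> : Num.floor (a2 * N%:R) = (j2 N).+1%:Z by near: N; exact: near_floor_pred.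
by rewrite prob_disjoint // ltnW.
Unshelve. all: by end_near. Qed.

Lemma joint_crossing_near (a1 a2 b1 b2 : R) :
  0 < a1 -> a1 < a2 -> a2 < b1 -> b1 < b2 ->
  \forall N \near \oo, joint312 b1 a1 b2 a2 N = 0.
Proof.
move=> a10 a12 ab b12.
have b10 : 0 < b1 by lra. have a20 : 0 < a2 by lra. have b20 : 0 < b2 by lra.
have t1 := tracks_lt (tracks_floor a10) (tracks_floor a20) a12.
have t2 := tracks_lt (tracks_floor a20) (tracks_floor b10) ab.
have t3 := tracks_lt (tracks_floor b10) (tracks_floor b20) b12.
near=> N; rewrite /joint312.
have -> : Num.floor (b1 * N%:R) = (floor_pred b1 N).+1%:Z by near: N; exact: near_floor_pred.
have -> : Num.floor (a1 * N%:R) = (floor_pred a1 N).+1%:Z by near: N; exact: near_floor_pred.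
have -> : Num.floor (b2 * N%:R) = (floor_pred b2 N).+1%:Z by near: N; exact: near_floor_pred.
have -> : Num.floor (a2 * N%:R) = (floor_pred a2 N).+1%:Z by near: N; exact: near_floor_pred.
apply: prob_crossing; first by near: N.
  by apply/ltnW; near: N.
by near: N.
Unshelve. all: by end_near. Qed.

Lemma scaled_cov_cvg (a1 a2 b1 b2 l : R) :
  0 < a1 -> a1 < b1 -> b1 < 1 -> 0 < a2 -> a2 < b2 -> b2 < 1 ->
  N%:R ^+ 3 * joint312 b1 a1 b2 a2 N @[N --> \oo] --> l ->
  N%:R ^+ 3 * cov312
      (@Z312 R N (Num.floor (b1 * N%:R)) (Num.floor (a1 * N%:R)))
      (@Z312 R N (Num.floor (b2 * N%:R)) (Num.floor (a2 * N%:R))) @[N --> \oo] -->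
    l - single_limit (b1 - a1) * single_limit (b2 - a2).
Proof.
move=> a10 ab1 b11 a20 ab2 b21 hl.
have h1 := prob_single_cvg a10 ab1 b11; have h2 := prob_single_cvg a20 ab2 b21.
apply: cvg_eq_near (cvgB hl (cvgM h1 h2)); near=> N.
rewrite cov312_Z -/(joint312 b1 a1 b2 a2 N).
set P := prob312 R (@sends N (Num.floor (b1 * _)) _).
set Q := prob312 R (@sends N (Num.floor (b2 * _)) _).
change (N%:R ^+ 3 * joint312 b1 a1 b2 a2 N -
  (N%:R `^ (3 / 2) * P) * (N%:R `^ (3 / 2) * Q) =
  N%:R ^+ 3 * (joint312 b1 a1 b2 a2 N - P * Q)).
by rewrite -powR32_sqr; ring.
Unshelve. all: by end_near. Qed.

Lemma asymp_of_limit (f : nat -> R) (Q : R) : 0 < Q ->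
  N%:R ^+ 3 * f N @[N --> \oo] --> (4 * pi * Q)^-1 ->
  asymp_equiv f (fun N => 1 / (4 * pi) * (N%:R ^- 3 / Q)).
Proof.
move=> Q0 hf; have p0 : 0 < pi :> R := pi_gt0 R.
have K0 : 4 * pi * Q != 0 by rewrite lt0r_neq0 ?mulr_gt0.
rewrite /asymp_equiv -(mulVf K0).
apply: cvg_eq_near (cvgM hf (cvg_cst _)); near=> N.
have N0 : 0 < N%:R :> R by rewrite ltr0n; near: N; exact: nbhs_infty_gt.
rewrite /=; move: (@pi R) p0 (f N) => p p0 y; field.
by rewrite !lt0r_neq0.
Unshelve. all: by end_near. Qed.

(** With [w] the quotient of [D1 D2 (1 - D1) (1 - D2)] by [x y z], the joint limit is
    [w ^ (3/2)] times the product of the two single limits; so the sign of the limit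
    covariance is that of [w - 1]. *)
Lemma joint_limit_gap (x y z D1 D2 w : R) : 0 < x -> 0 < y -> 0 < z ->
  0 < D1 -> D1 < 1 -> 0 < D2 -> D2 < 1 -> 1 < w ->
  w * (x * y * z) = D1 * D2 * (1 - D1) * (1 - D2) ->
  let L := (w `^ (3 / 2) - 1) /
    (4 * pi * (D1 * D2 * (1 - D1) * (1 - D2)) `^ (3 / 2)) in
  joint_limit x y z - single_limit D1 * single_limit D2 = L /\ 0 < L.
Proof.
move=> x0 y0 z0 D10 D11 D20 D21 w1 e /=.
have D11' : 0 < 1 - D1 by rewrite subr_gt0.
have D21' : 0 < 1 - D2 by rewrite subr_gt0.
have w0 : 0 < w by apply: lt_trans w1.
have p0 : 0 < pi :> R := pi_gt0 R.
have qw : 1 < w `^ (3 / 2).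
  have : 1 `^ (3 / 2) < w `^ (3 / 2) by apply: gt0_ltr_powR; rewrite ?nnegrE // ltW.
  by rewrite powR1.
have eE : (D1 * D2 * (1 - D1) * (1 - D2)) `^ (3 / 2) =
   D1 `^ (3 / 2) * D2 `^ (3 / 2) * (1 - D1) `^ (3 / 2) * (1 - D2) `^ (3 / 2).
  by rewrite !powRM ?mulr_ge0 // ltW.
have eW : (D1 * D2 * (1 - D1) * (1 - D2)) `^ (3 / 2) =
   w `^ (3 / 2) * (x `^ (3 / 2) * y `^ (3 / 2) * z `^ (3 / 2)).
  by rewrite -e !powRM ?mulr_ge0 // ltW.
split; last first.
  rewrite divr_gt0 ?subr_gt0 // mulr_gt0 ?mulr_gt0 // powR_gt0 //.
  by rewrite !mulr_gt0.
rewrite joint_limitE // !single_limitE //.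
have s2 := sqrt_pi_sqr; have s0 : 0 < Num.sqrt pi :> R by rewrite sqrtr_gt0 pi_gt0.
have hJ : (4 * pi * (x `^ (3 / 2) * y `^ (3 / 2) * z `^ (3 / 2)))^-1 =
  w `^ (3 / 2) / (4 * pi * (D1 * D2 * (1 - D1) * (1 - D2)) `^ (3 / 2)).
  rewrite eW; have := powR_gt0 (3 / 2) x0; have := powR_gt0 (3 / 2) y0.
  have := powR_gt0 (3 / 2) z0; have := powR_gt0 (3 / 2) w0.
  move: (x `^ _) (y `^ _) (z `^ _) (w `^ _) (@pi R) p0 => a b c d p p0 d0 c0 b0 a0.
  by field; rewrite !lt0r_neq0.
rewrite hJ mulrBl mul1r eE; congr (_ - _).
have := powR_gt0 (3 / 2) D10; have := powR_gt0 (3 / 2) D20.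
have := powR_gt0 (3 / 2) D11'; have := powR_gt0 (3 / 2) D21'.
move: (D1 `^ _) (D2 `^ _) ((1 - D1) `^ _) ((1 - D2) `^ _) => a b c d d0 c0 b0 a0.
move: (Num.sqrt pi) s0 s2 => s s0 <-.
by field; rewrite !lt0r_neq0.
Qed.
End Limits.

Theorem corollary2p13 (R : realType) (a1 a2 b1 b2 : R) :
  let i1 (N : nat) : int := Num.floor (b1 * N%:R) in
  let i2 (N : nat) : int := Num.floor (b2 * N%:R) in
  let j1 (N : nat) : int := Num.floor (a1 * N%:R) in
  let j2 (N : nat) : int := Num.floor (a2 * N%:R) in
  let D1 : R := b1 - a1 in
  let D2 : R := b2 - a2 in
  let joint (N : nat) : R :=
    prob312 R (fun s : 'S_N => sends (i1 N) (j1 N) s && sends (i2 N) (j2 N) s) in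
  let scaled_cov (N : nat) : R :=
    N%:R ^+ 3 * cov312 (@Z312 R N (i1 N) (j1 N)) (@Z312 R N (i2 N) (j2 N)) in
  let den : R := 4 * pi * (D1 * D2 * (1 - D1) * (1 - D2)) `^ (3 / 2) in
  [/\ (0 < a2 -> a2 < a1 -> a1 < b1 -> b1 < b2 -> b2 < 1 ->
       let L := (((D2 * (1 - D1)) / (D2 - D1)) `^ (3 / 2) - 1) / den in
       [/\ asymp_equiv joint
             (fun N => 1 / (4 * pi) *
               (N%:R ^- 3 / ((D2 - D1) * D1 * (1 - D2)) `^ (3 / 2))),
           scaled_cov @ \oo --> L
         & 0 < L]),
      (0 < a1 -> a1 < b1 -> b1 < a2 -> a2 < b2 -> b2 < 1 ->
       let L := (((1 - D1) * (1 - D2) / (1 - D1 - D2)) `^ (3 / 2) - 1) / den in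
       [/\ asymp_equiv joint
             (fun N => 1 / (4 * pi) *
               (N%:R ^- 3 / ((1 - D1 - D2) * D1 * D2) `^ (3 / 2))),
           scaled_cov @ \oo --> L
         & 0 < L])
    & (0 < a1 -> a1 < a2 -> a2 < b1 -> b1 < b2 -> b2 < 1 ->
       let L := - 1 / den in
       [/\ \forall N \near \oo, joint N = 0,
           scaled_cov @ \oo --> L
         & L < 0])].
Proof.
move=> i1 i2 j1 j2 D1 D2 joint scaled_cov den; split.
- move=> a20 a21 ab1 b12 b21 L.
  have a10 : 0 < a1 by lra. have b11 : b1 < 1 by lra.
  have ab2 : a2 < b2 by lra.
  have D10 : 0 < D1 by rewrite /D1; lra. have D11 : D1 < 1 by rewrite /D1; lra.
  have D20 : 0 < D2 by rewrite /D2; lra. have D21 : D2 < 1 by rewrite /D2; lra.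
  have y0 : 0 < D2 - D1 by rewrite /D1 /D2; lra.
  have z0 : 0 < 1 - D2 by lra.
  have hJ := joint_nested_cvg a20 a21 ab1 b12 b21; rewrite -/D1 -/D2 in hJ.
  have w1 : 1 < D2 * (1 - D1) / (D2 - D1).
    by rewrite ltr_pdivlMr // mul1r; have := mulr_gt0 D10 z0; lra.
  have [eL L0] := joint_limit_gap D10 y0 z0 D10 D11 D20 D21 w1
    (ltac:(by field; rewrite lt0r_neq0)).
  split; last exact: L0.
    apply: asymp_of_limit; first by rewrite powR_gt0 // !mulr_gt0.
    rewrite (mulrC (D2 - D1)) !powRM ?mulr_ge0 ?(ltW D10) ?(ltW y0) ?(ltW z0) //.
    rewrite -joint_limitE //; exact: hJ.
  by rewrite /L /den -eL; apply: scaled_cov_cvg.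
- move=> a10 ab1 ba ab2 b21 L.
  have a20 : 0 < a2 by lra. have b11 : b1 < 1 by lra.
  have D10 : 0 < D1 by rewrite /D1; lra. have D11 : D1 < 1 by rewrite /D1; lra.
  have D20 : 0 < D2 by rewrite /D2; lra. have D21 : D2 < 1 by rewrite /D2; lra.
  have z0 : 0 < 1 - D1 - D2 by rewrite /D1 /D2; lra.
  have hJ := joint_disjoint_cvg a10 ab1 ba ab2 b21; rewrite -/D1 -/D2 in hJ.
  have w1 : 1 < (1 - D1) * (1 - D2) / (1 - D1 - D2).
    by rewrite ltr_pdivlMr // mul1r; have := mulr_gt0 D10 D20; lra.
  have [eL L0] := joint_limit_gap D10 D20 z0 D10 D11 D20 D21 w1
    (ltac:(by field; rewrite lt0r_neq0)).
  split; last exact: L0.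
    apply: asymp_of_limit; first by rewrite powR_gt0 // !mulr_gt0.
    rewrite -[_ * D1 * D2]mulrA [(1 - D1 - D2) * _]mulrC !powRM ?mulr_ge0 ?(ltW D10) ?(ltW D20) ?(ltW z0) //.
    rewrite -joint_limitE //; exact: hJ.
  by rewrite /L /den -eL; apply: scaled_cov_cvg.
move=> a10 a12 ab b12 b21 L.
have hz := joint_crossing_near a10 a12 ab b12.
have ab1 : a1 < b1 by lra. have ab2 : a2 < b2 by lra.
have b11 : b1 < 1 by lra. have a20 : 0 < a2 by lra.
have D10 : 0 < D1 by rewrite /D1; lra. have D11 : 0 < 1 - D1 by rewrite /D1; lra.
have D20 : 0 < D2 by rewrite /D2; lra. have D21 : 0 < 1 - D2 by rewrite /D2; lra.
have den0 : 0 < den.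
  by rewrite /den mulr_gt0 ?mulr_gt0 ?pi_gt0 // powR_gt0 // !mulr_gt0.
split; [exact: hz| |by rewrite /L mulN1r oppr_lt0 invr_gt0].
have hJ : N%:R ^+ 3 * joint312 b1 a1 b2 a2 N @[N --> \oo] --> (0 : R).
  apply: cvg_eq_near (cvg_cst 0); near=> N.
  by rewrite (_ : joint312 _ _ _ _ _ = 0) ?mulr0 //; near: N.
have -> : L = 0 - single_limit D1 * single_limit D2.
  have [d11 d21] : D1 < 1 /\ D2 < 1 by rewrite -!(subr_gt0 _ 1).
  rewrite (single_limitE D10 d11) (single_limitE D20 d21) /L /den sub0r mulN1r.
  rewrite !powRM ?mulr_ge0 ?(ltW D10) ?(ltW D11) ?(ltW D20) ?(ltW D21) //; congr (- _).
  rewrite -invfM; congr (_^-1).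
  by move: (Num.sqrt pi) (@sqrt_pi_sqr R) => s <-; ring.
exact: scaled_cov_cvg.
Unshelve. all: by end_near. Qed.
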